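(* Assume the standing setting and Hypothesis $(H_a)$, and let $\varphi,\theta$ be a naturally normalized system at $a$ with expansion coefficients $\varphi_n,\theta_n$ about $\lambda$ and regularization index $\ell_a$. Then for all $k\ge0$: $\lim_{x\to a^+}\varphi_{k+1}(x)/\varphi_k(x)=0$ and $\lim_{x\to a^+}\theta_{k+1}(x)/\theta_k(x)=0$; and, if $\ell_a<\infty$, also $\lim_{x\to a^+}\varphi_k(x)/\theta_{\ell_a+k}(x)=0$ and $\lim_{x\to a^+}\theta_{\ell_a+k+1}(x)/\varphi_k(x)=0$.
   Context: Standing setting: Let $-\infty\le a<b\le\infty$ and let $p,q,r$ be Lebesgue measurable functions on $(a,b)$ with $r>0$ a.e., $r\in L^1_{loc}((a,b))$; $p>0$ a.e., $1/p\in L^1_{loc}((a,b))$; $q$ real-valued a.e., $q\in L^1_{loc}((a,b))$. Let $\tau f=\frac1r\big[-(pf')'+qf\big]$ act on functions $f$ with $f,pf'\in AC_{loc}((a,b))$; write $f^{[1]}=pf'$ and $W(f,g)=fg^{[1]}-f^{[1]}g$. For $\lambda\in\mathbb R$, the equation $\tau f=\lambda f$ is nonoscillatory at $a$ if its nontrivial real solutions have finitely many zeros near $a$; then there is a solution $u_a$, unique up to constant multiples, with $\lim_{x\to a^+}u_a(x)/v_a(x)=0$ for every solution $v_a$ linearly independent of $u_a$; $u_a$ is called principal at $a$ and any such $v_a$ nonprincipal at $a$. Hypothesis $(H_a)$: there exist $\lambda\in\mathbb R$ such that $\tau f=\lambda f$ is nonoscillatory at $a$, and $c\in(a,b)$,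 such that $\int_a^c|u_a(x)v_a(x)r(x)|\,dx<\infty$, where $u_a$, $v_a$ are principal resp. nonprincipal solutions of $\tau f=\lambda f$ at $a$. Construction (C): fix $\lambda\in\mathbb R$ as in $(H_a)$ and let $u_a$ (principal) and $v_a$ (nonprincipal) be solutions of $\tau f=\lambda f$ with $W(v_a,u_a)=1$. Set $\varphi_0=u_a$, $\varphi_n(x)=\int_a^x[u_a(t)v_a(x)-v_a(t)u_a(x)]\varphi_{n-1}(t)r(t)\,dt$ for $n\ge1$, $x\in(a,b)$, and $\varphi(z,x)=\sum_{n\ge0}\varphi_n(x)(z-\lambda)^n$; this series converges for all $z\in\mathbb C$, $x\in(a,b)$, is entire in $z$ and solves $\tau\varphi(z,\cdot)=z\varphi(z,\cdot)$. Definition (RI): let $\theta(z,x)$ be any solution of $\tau\theta(z,\cdot)=z\theta(z,\cdot)$, entire in $z$ for each $x$, real for real $z$, with $W(\theta(z,\cdot),\varphi(z,\cdot))=1$, and write $\theta(z,x)=\sum_{n\ge0}\theta_n(x)(z-\lambda)^n$ (same $\lambda$ as in (C)). The limits $\lim_{x\to a^+}\varphi_0(x)/\theta_n(x)$ exist in $\mathbb R\cup\{\pm\infty\}$. The regularization index $\ell_a\in\mathbb N_0\cup\{\infty\}$ at $a$ is the smallest integer $\ell\ge0$ with $\lim_{x\to a^+}\varphi_0(x)/\theta_n(x)=0$ for $n=0,\dots,\ell$ and $\lim_{x\to a^+}\varphi_0(x)/\theta_{\ell+1}(x)\neq0$; if $\lim_{x\to a^+}\varphi_0(x)/\theta_n(x)=0$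 for all $n\ge0$, then $\ell_a=\infty$. ($\ell_a$ does not depend on the choice of $\theta$ or of the constant normalization of $\varphi$.) Naturally normalized system at $a$: a pair $\varphi,\theta$ where $\varphi$ is a nonzero constant multiple of the function of Construction (C) (equivalently: an entire-in-$z$ solution family, principal at $a$ for all real $z$, with $\lim_{x\to a^+}\varphi(z_1,x)/\varphi(z_2,x)=1$ for $z_1,z_2\in\mathbb R$), $\theta$ is as in Definition (RI) (entire in $z$, real for real $z$, $W(\theta(z,\cdot),\varphi(z,\cdot))=1$), and additionally $\lim_{x\to a^+}\theta_n(x)/\varphi_0(x)=0$ for all $n>\ell_a$ (vacuous if $\ell_a=\infty$). *)

(* Defs.v *)
From HB Require Import structures.
From mathcomp Require Import all_boot all_order all_algebra.
From mathcomp Require Import all_classical all_reals all_analysis.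
From mathcomp Require Import complex.
Set Implicit Arguments. Unset Strict Implicit. Unset Printing Implicit Defensive.
Import Order.TTheory GRing.Theory Num.Theory.
Import numFieldNormedType.Exports.
Import ComplexField.
Local Open Scope classical_set_scope.
Local Open Scope ring_scope.
Local Open Scope complex_scope.

Section SLDefs.
Context {R : realType}.
Local Notation mu := (@completed_lebesgue_measure R).

Definition oitv (a b : \bar R) : set R := [set x | (a < x%:E)%E /\ (x%:E < b)%E].

Definition loc_integrable (a b : \bar R) (f : R -> R) :=
  forall c d : R, oitv a b c -> oitv a b d -> mu.-integrable `[c, d] (EFin \o f).

Definition abs_cont_on (c d : R) (f : R -> R) :=
  forall e : R, 0 < e -> exists2 delta : R, 0 < delta &
    forall (n : nat) (x y : nat -> R),
      (forall k, (k < n)%N -> [/\ c <= x k, x k <= y k & y k <= d]) ->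
      (forall k, (k.+1 < n)%N -> y k <= x k.+1) ->
      \sum_(k < n) (y k - x k) < delta ->
      \sum_(k < n) `|f (y k) - f (x k)| < e.

Definition ACloc (a b : \bar R) (f : R -> R) :=
  forall c d : R, oitv a b c -> oitv a b d -> abs_cont_on c d f.

Definition cRe (f : R -> R[i]) : R -> R := fun x => complex.Re (f x).
Definition cIm (f : R -> R[i]) : R -> R := fun x => complex.Im (f x).
Definition cderivable (f : R -> R[i]) (x : R) :=
  derivable (cRe f) x 1 /\ derivable (cIm f) x 1.
Definition cderive (f : R -> R[i]) (x : R) : R[i] :=
  Complex (derive1 (cRe f) x) (derive1 (cIm f) x).

Definition cACloc (a b : \bar R) (f : R -> R[i]) := ACloc a b (cRe f) /\ ACloc a b (cIm f).

(* (f, f1) is a solution of tau f = z f on (a,b), f1 being the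
   quasi-derivative f^[1] = p f' (the locally AC representative) *)
Definition is_sol (p q r : R -> R) (a b : \bar R) (z : R[i]) (f f1 : R -> R[i]) :=
  [/\ cACloc a b f, cACloc a b f1,
      ({ae mu, forall x, oitv a b x ->
        cderivable f x /\ (p x)%:C * cderive f x = f1 x}) &
      ({ae mu, forall x, oitv a b x ->
        cderivable f1 x /\
        ((r x)%:C)^-1 * (- cderive f1 x + (q x)%:C * f x) = z * f x})].

Definition rsol (p q r : R -> R) (a b : \bar R) (lam : R) (u u1 : R -> R) :=
  is_sol p q r a b lam%:C (fun x => (u x)%:C) (fun x => (u1 x)%:C).

Definition wronsk {T : pzRingType} (f f1 g g1 : R -> T) (x : R) : T :=
  f x * g1 x - f1 x * g x.

Definition at_a (a : \bar R) : set_system R :=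
  match a with EFin s => s^'+ | _ => -oo end.

Definition lim0 (a : \bar R) (f g : R -> R) :=
  (\forall x \near at_a a, g x != 0) /\
  (fun x => f x / g x) @ at_a a --> (0 : R).

Definition nontrivial (a b : \bar R) (u : R -> R) := exists2 x, oitv a b x & u x != 0.

Definition nonosc (p q r : R -> R) (a b : \bar R) (lam : R) :=
  forall u u1 : R -> R, rsol p q r a b lam u u1 -> nontrivial a b u ->
    exists2 c, oitv a b c & finite_set [set x | (a < x%:E)%E /\ x < c /\ u x = 0].

Definition lin_indep (a b : \bar R) (u v : R -> R) :=
  forall al be : R, (forall x, oitv a b x -> al * u x + be * v x = 0) -> al = 0 /\ be = 0.

Definition principal (p q r : R -> R) (a b : \bar R) (lam : R) (u u1 : R -> R) :=
  [/\ rsol p q r a b lam u u1, nontrivial a b u &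
      forall v v1, rsol p q r a b lam v v1 -> lin_indep a b u v -> lim0 a u v].

(* v is a nonprincipal solution at a (w.r.t. the principal u) *)
Definition nonprincipal (p q r : R -> R) (a b : \bar R) (lam : R) (u v v1 : R -> R) :=
  rsol p q r a b lam v v1 /\ lin_indep a b u v.

Fixpoint phiC (r : R -> R) (a : \bar R) (u v : R -> R) (n : nat) : R -> R :=
  match n with
  | 0 => u
  | n'.+1 => fun x => Rintegral mu [set t | (a < t%:E)%E /\ t <= x]
               (fun t => (u t * v x - v t * u x) * phiC r a u v n' t * r t)
  end.

Definition phiN (r : R -> R) (a : \bar R) (u v : R -> R) (cst : R) (n : nat) : R -> R :=
  fun x => cst * phiC r a u v n x.

Definition cseries_to (s : nat -> R[i]) (l : R[i]) :=
  (fun N => \sum_(k < N) complex.Re (s k)) @ \oo --> complex.Re l /\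
  (fun N => \sum_(k < N) complex.Im (s k)) @ \oo --> complex.Im l.

Definition reg_index (a : \bar R) (phi0 : R -> R) (thn : nat -> R -> R) (ell : nat) :=
  (forall n, (n <= ell)%N -> lim0 a phi0 (thn n)) /\ ~ lim0 a phi0 (thn ell.+1).

End SLDefs.

(* Main.v *)
Require Import Defs.
From HB Require Import structures.
From mathcomp Require Import all_boot all_order all_algebra.
From mathcomp Require Import all_classical all_reals all_analysis.
From mathcomp Require Import complex measurable_realfun ring lra.
Import Order.TTheory GRing.Theory Num.Theory.
Import numFieldNormedType.Exports.
Import ComplexField.
Set Implicit Arguments. Unset Strict Implicit. Unset Printing Implicit Defensive.
Local Open Scope classical_set_scope.
Local Open Scope ring_scope.
Local Open Scope complex_scope.

(* Only real z near lam matter. Divide every solution by the nonprincipal v: with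
   w = u / v, which increases strictly from 0 at a, and the density rho = v^2 r, variation of
   constants turns tau f = z f into an integral equation whose kernel depends on w alone.
   On D = (a, c] put
     T g (x) = int_D min(w(t) - w(x), 0) g rho,    H g (x) = int_D min(w(t), w(x)) g rho.
   The integral of w rho is finite by (H_a), phi_{n+1} / v = T (phi_n / v), and
   theta(z) / v = A - B(z) w + (z - lam) H (theta(z) / v); letting x tend to a in
   W(theta(z), phi(z)) = 1 shows that A = 1 / cst does not depend on z. Comparing expansions in
   z - lam gives theta_0 / v = A - b_0 w and theta_{n+1} / v = - b_{n+1} w + H (theta_n / v).
   Both H and -T have nonnegative kernels, so they carry "g_1 = o(g_0), g_0 of constant sign"
   over to the images, for H up to multiples of w (that is, of u). This gives
   theta_{k+1} = o(theta_k) as long as u = o(theta_k); from theta_{l+1} = o(u) on, the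
   normalization forces theta_{n+1} / v = T (theta_n / v), so that theta_{l+k} and phi_k are
   iterates of the same operator T. *)

(** * The completed Lebesgue measure *)

(** [H g] asks only for [w g rho] to be integrable, so it exists for every bounded [g];
    [T g = H g - w * (integral of g rho)] asks for [g rho] to be integrable. The regularization
    index marks the point from which on the coefficients of theta lie in the domain of [T]. Constant
    signs matter because a pointwise bound between two functions passes to their integrals only if
    no cancellation occurs; near [a] a sign survives [H] as long as [w] is negligible against the
    result. That [A] is free of [z] leaves no constant term in [theta_{n+1} / v], which therefore
    tends to 0, whereas [theta_0 / v] tends to [1 / cst], not to 0. The obstacle in comparing
    expansions is that the series of theta is known to converge only pointwise in [x], so it cannot
    simply be put under the integral sign of [H]. Keeping [|z - lam|] times the integral of [w rho]
    below 1/2 makes [theta(z) / v] bounded on [D] and the series of [phi(z) / v] dominated by a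
    geometric one. *)

Section CompletedLebesgue.
Context {R : realType}.
Local Notation mu := (@completed_lebesgue_measure R).
Local Notation lm := (@lebesgue_measure R).
Local Notation cT := (caratheodory_type (wlength (R:=R) idfun)^*%mu).
Local Notation bT := (measurableTypeR R).

Lemma lebesgue_measurable_completed (A : set R) :
  measurable (A : set bT) -> measurable (A : set cT).
Proof. exact: sub_caratheodory. Qed.

Lemma measurable_fun_completed (D : set R) (f : R -> R) :
  measurable_fun (D : set bT) (f : bT -> R) -> measurable (D : set bT) ->
  measurable_fun (D : set cT) (f : cT -> R).
Proof. by move=> mf mD _ Y mY; apply: lebesgue_measurable_completed; exact: mf. Qed.

(** The identity from the completed to the Borel sigma-algebra is measurable and pushes [mu] forward
    to [lm]. *)
Lemma completed_integralE (D : set R) (f : R -> R) :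
  measurable (D : set bT) -> measurable_fun (setT : set bT) (f : bT -> R) ->
  mu.-integrable D (EFin \o f) ->
  (\int[mu]_(x in D) (f x)%:E = \int[lm]_(x in D) (f x)%:E)%E.
Proof.
move=> mD mf intf.
have mi : measurable_fun [set: cT] (idfun : cT -> bT).
  by move=> _ Y mY; rewrite setTI; exact: lebesgue_measurable_completed.
have := @integral_pushforward _ _ cT bT R idfun mi mu D (EFin \o f).
move=> /(_ _ intf mD) <-; last exact/measurable_EFinP.
by apply: eq_measure_integral => A mA _.
Qed.

Lemma completed_integrable (D : set R) (f : R -> R) :
  measurable (D : set bT) -> measurable_fun (setT : set bT) (f : bT -> R) ->
  mu.-integrable D (EFin \o f) -> lm.-integrable D (EFin \o f).
Proof.
move=> mD mf intf.
have mi : measurable_fun [set: cT] (idfun : cT -> bT).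
  by move=> _ Y mY; rewrite setTI; exact: lebesgue_measurable_completed.
have mf' : measurable_fun [set: bT] (EFin \o f) by exact/measurable_EFinP.
have := integrable_pushforward mi mf' intf mD.
move=> /integrableP[m1 h]; apply/integrableP; split; first exact: measurable_funTS.
by move: h; congr (_ < _)%E; apply: eq_measure_integral.
Qed.

Lemma completed_measurable_decomp (A : set R) : measurable (A : set cT) ->
  exists2 B : set R, measurable (B : set bT) &
    exists2 N : set R, lm.-negligible N & B `|` N = A.
Proof.
move=> mA; have : measurable_realfun.completed_algebra_gen lm A.
  by rewrite -g_sigma_completed_algebra_genE completed_caratheodory_measurable.
by [].
Qed.

(** The cover [A] of a completed null set is a Borel set plus a Lebesgue null set, and the two
    measures agree on Borel sets. *)
Lemma completed_negligibleE (N : set R) : mu.-negligible N <-> lm.-negligible N.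
Proof.
split=> [|[A [mA A0 NA]]]; last first.
  by exists A; split => //; exact: lebesgue_measurable_completed.
move=> [A [mA A0 NA]]; have [B mB [M nM BMA]] := completed_measurable_decomp mA.
apply: (@negligibleS _ _ _ lm A N NA); rewrite -BMA; apply: negligibleU => //.
apply/negligibleP => //; apply/eqP; rewrite eq_le measure_ge0 andbT -A0.
rewrite -[X in (X <= _)%E]/(mu B) le_measure ?inE//.
  exact: lebesgue_measurable_completed.
by rewrite -BMA; left.
Qed.

Lemma completed_ae (P : set R) :
  {ae mu, forall x, P x} <-> {ae lm, forall x, P x}.
Proof. exact: completed_negligibleE. Qed.

(** Each set [ratr q < f x] is a Borel set [B q] up to a null set. One Borel null set [M] contains
    these countably many defects; once [f] is set to 0 on [M], every superlevel set is a countable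
    union of sets [B q] minus [M], plus [M] itself when the level is negative. *)
Lemma completed_borel_version (f : R -> R) :
  measurable_fun (setT : set cT) (f : cT -> R) ->
  exists2 g : R -> R, measurable_fun (setT : set bT) (g : bT -> R) &
    {ae lm, forall x, g x = f x}.
Proof.
move=> mf.
have mE (q : rat) : measurable ([set x | ratr q < f x] : set cT).
  have := mf measurableT `]ratr q, +oo[%classic (measurable_itv _).
  rewrite setTI; congr (_ _); apply/seteqP.
  by split=> x /=; rewrite in_itv /= andbT.
have HB q := completed_measurable_decomp (mE q).
pose B q := sval (cid2 (HB q)).
have mB q : measurable (B q : set bT) by rewrite /B; case: cid2.
have HN q : exists2 N : set R, lm.-negligible N & B q `|` N = [set x | ratr q < f x].
  by rewrite /B; case: cid2.
have [M [mM M0 subM]] : lm.-negligible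
    (\bigcup_n (oapp (fun q => [set x | ratr q < f x] `\` B q) set0 (unpickle n))).
  apply: negligible_bigcup => n; case: unpickle => [q|] /=; last first.
    exact: negligible_set0.
  have [N nN eN] := HN q; rewrite -eN; apply: negligibleS nN.
  by move=> x [[]].
have subMq q x : ratr q < f x -> ~ M x -> B q x.
  move=> fx nMx; apply: contrapT => nB; apply: nMx; apply: subM.
  by exists (pickle q); [exact: I|rewrite pickleK; split].
have subBq q x : B q x -> ratr q < f x.
  by move=> Bx; have [N _ /seteqP[/(_ x) + _]] := HN q; apply; left.
exists (f \_ (~` M)); last first.
  exists M; split => // x /= nfx; apply: contrapT => nMx; apply: nfx.
  by rewrite patchE mem_set.
move=> _; apply: (measurability _ (RGenOInfty.measurableE R)) => //.
move=> /= _ [_ [y ->] <-]; rewrite setTI.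
have -> : (f \_ (~` M)) @^-1` `]y, +oo[ =
    \bigcup_n (oapp (fun q : rat => if y < ratr q then B q `\` M else set0) set0
       (unpickle n)) `|` (if y < 0 then M else set0).
  apply/seteqP; split => x /=; rewrite in_itv /= andbT patchE.
    case: ifPn => [/set_mem nMx yx|/negP xM].
      have [q] := rat_in_itvoo yx; rewrite in_itv /= => /andP[yq qx].
      left; exists (pickle q); first exact: I.
      by rewrite pickleK /= yq; split; [exact: subMq|].
    move=> y0; right; rewrite y0; apply: contrapT => nM; apply: xM.
    by rewrite inE.
  move=> [[n _]|].
    case: unpickle => [q|//] /=; case: ifPn => // yq [Bx nM].
    by rewrite mem_set//; exact: (lt_trans yq (subBq _ _ Bx)).
  case: ifPn => // y0 Mx; case: ifPn => [/set_mem//|_] //.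
apply: measurableU; last by case: ifP => _ //; exact: measurable0.
apply: bigcupT_measurable => n; case: unpickle => [q|] /=; last exact: measurable0.
case: ifP => _; last exact: measurable0.
exact: measurableD.
Qed.
End CompletedLebesgue.

(** * Absolutely continuous functions *)

Section FTC.
Context {R : realType}.
Local Notation mu := (@completed_lebesgue_measure R).
Local Notation lm := (@lebesgue_measure R).
Implicit Types (f g : R -> R) (c d x y t e : R).

(** Chaining through the short intervals around the supremum of the reachable endpoints reaches that
    supremum, and then a point beyond it unless it is [d]. *)
Lemma cousin (P : R -> R -> Prop) c d : c <= d ->
  (forall x y z, c <= x -> x <= y -> y <= z -> z <= d -> P x y -> P y z -> P x z) ->
  (forall t, c <= t -> t <= d -> exists2 e, 0 < e & forall x y,
     c <= x -> x <= t -> t <= y -> y <= d -> t - e < x -> y < t + e -> P x y) ->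
  P c d.
Proof.
move=> cd Pcat Ploc.
pose S := [set x | c <= x /\ x <= d /\ P c x].
have Sc : S c.
  split=> //; split=> //; have [e e0] := Ploc _ (lexx c) cd.
  by apply => //; lra.
have ubS : has_ubound S by exists d => x [_ []].
have supS : has_sup S by split => //; exists c.
have c_sup : c <= sup S by exact: ub_le_sup.
have sup_d : sup S <= d by apply: ge_sup; [exists c|move=> x [_ []]].
have [e e0 Pe] := Ploc _ c_sup sup_d.
have [x [cx [xd Pcx]] xs] := sup_adherent e0 supS.
have xsup : x <= sup S by exact: ub_le_sup.
have Psup : P c (sup S).
  by apply: (Pcat c x) => //; apply: Pe => //; lra.
have [sd|] := ltP (sup S) d; last by move=> ds; have <- : sup S = d by lra.
pose y := Num.min (sup S + e / 2) d.
have [y1 y2] : sup S < y /\ y <= d.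
  by rewrite /y; case: (leP (sup S + e / 2) d) => ?; split; lra.
have y3 : y < sup S + e.
  by rewrite /y; case: (leP (sup S + e / 2) d) => ?; lra.
have Sy : S y.
  split; first by lra.
  split => //; apply: (Pcat c (sup S)) => //; first by lra.
  by apply: Pe => //; lra.
have := ub_le_sup ubS Sy; lra.
Qed.

Lemma derivable_linear_approx f t e : derivable f t 1 -> 0 < e ->
  exists2 eta : R, 0 < eta & forall y, `|y - t| < eta ->
    `|f y - f t - derive1 f t * (y - t)| <= e * `|y - t|.
Proof.
move=> df e0; have := df; rewrite /derivable => /cvgrPdist_lt /(_ _ e0) H.
have {H} [eta /= eta0 H] := H.
exists eta => // y yt; have [->|nyt] := eqVneq y t.
  by rewrite !subrr mulr0 subr0 normr0 mulr0.
have yt0 : y - t != 0 by rewrite subr_eq0.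
have := H (y - t); rewrite /= sub0r normrN => /(_ yt yt0) /=.
rewrite derive1E /derive; set L := lim _.
have -> : (y - t) *: 1 + t = y by rewrite /GRing.scale /= mulr1 subrK.
rewrite /GRing.scale /= => /ltW.
have -> : f y - f t - L * (y - t) = - ((L - (y - t)^-1 * (f y - f t)) * (y - t)).
  by field.
by rewrite normrN normrM => h; rewrite ler_wpM2r.
Qed.

Lemma Rintegral_itv_oc_add (U : set R) (k : R -> R) c x y :
  measurable U -> lm.-integrable U (EFin \o k) -> c <= x -> x <= y ->
  \int[lm]_(t in U `&` `]c, y]) k t =
  \int[lm]_(t in U `&` `]c, x]) k t + \int[lm]_(t in U `&` `]x, y]) k t.
Proof.
move=> mU ik cx xy.
have e : U `&` `]c, y]%classic = (U `&` `]c, x]%classic) `|` (U `&` `]x, y]%classic).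
  rewrite -setIUr; congr (_ `&` _); apply/seteqP; split => t /=; rewrite !in_itv /=.
    by move=> /andP[ct ty]; case: (leP t x) => ?; [left|right]; apply/andP.
  by move=> [/andP[h1 h2]|/andP[h1 h2]]; apply/andP; split; lra.
rewrite e Rintegral_setU//; [exact: measurableI|exact: measurableI| |].
  rewrite -e; apply: integrableS ik => //; first exact: measurableI.
apply/disj_setPS => t [[_ /=]]; rewrite in_itv /= => /andP[_ h1] [_ /=].
by rewrite in_itv /= => /andP[h2 _]; lra.
Qed.

(* [h = f - F] has derivative 0 off a null set, which is covered by an open [U] of small
   measure. Cousin's lemma chains short intervals, each either inside [U], where the
   increment of [h] is absorbed by absolute continuity, or with an increment of [h] at most
   [e] times its length. *)
Lemma abs_cont_FTC_borel f g c d : c <= d -> abs_cont_on c d f ->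
  lm.-integrable setT (EFin \o g) ->
  {ae lm, forall x, c <= x <= d -> derivable f x 1 /\ derive1 f x = g x} ->
  f d - f c = \int[lm]_(x in `[c, d]) g x.
Proof.
move=> cd ACf ig aef.
pose F y := \int[lm]_(t in `]-oo, y]) g t.
have igS (A : set R) : measurable A -> lm.-integrable A (EFin \o g).
  by move=> mA; apply: integrableS ig.
have inS (A : set R) : measurable A -> lm.-integrable A (EFin \o (fun t => `|g t|)).
  by move=> mA; apply: integrable_norm; exact: igS.
have mg : measurable_fun setT g by apply/measurable_EFinP; apply: (measurable_int lm).
have FB x y : x <= y -> F y - F x = \int[lm]_(t in `]x, y]) g t.
  by move=> xy; rewrite /F Rintegral_itvB//; exact: igS.
have aeF : {ae lm, forall x, derivable F x 1 /\ derive1 F x = g x}.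
  apply: FTC1Ny => [y|]; first exact: igS.
  split => //; first exact: openT.
  move=> K _ cK; have mK : measurable K by exact: compact_measurable.
  by have /integrableP[] := igS _ mK.
pose h x := f x - F x.
(* The part [e * (d - c)] pays for the intervals with a derivative estimate. The two further [e]
   bound, over the intervals inside [U], the variation of [f] and that of [F]. *)
suff H e : 0 < e -> `|h d - h c| <= e * (d - c + 2).
  have hh : h d = h c.
    apply/eqP; rewrite -subr_eq0 -normr_le0; apply/ler_addgt0Pr => e e0.
    have p0 : 0 < d - c + 2 by lra.
    have := H (e / (d - c + 2)) (divr_gt0 e0 p0).
    by rewrite divfK ?gt_eqF// add0r.
  have -> : f d - f c = F d - F c by move: hh; rewrite /h; lra.
  by rewrite FB// Rintegral_itv_obnd_cbnd//; exact: igS.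
move=> e0; have [d1 d10 H1] := ACf _ e0.
have [d2 [d20 H2]] := integral_normr_continuous ig e0.
have [A [mA A0 NA]] : exists A : set R, [/\ measurable A, lm A = 0%E &
   [set x | ~ ((c <= x <= d -> derivable f x 1 /\ derive1 f x = g x)
           /\ (derivable F x 1 /\ derive1 F x = g x))] `<=` A].
  have [A1 [mA1 A10 NA1]] := aef; have [A2 [mA2 A20 NA2]] := aeF.
  have [A [mA A0 sA]] : lm.-negligible (A1 `|` A2).
    by apply: negligibleU; apply/negligibleP.
  exists A; split=> // x /= /not_andP[nx|nx]; apply: sA.
    by left; exact: NA1.
  by right; exact: NA2.
have dmin : 0 < Num.min d1 d2 by case: (leP d1 d2).
have [|U [oU AU UA]] := lebesgue_regularity_outer mA _ dmin.
  exact: (eq_ind_r (fun z => (z < +oo)%E) (ltry 0) A0).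
have mU : measurable U by exact: open_measurable.
have lmU : (lm U < (Num.min d1 d2)%:E)%E.
  apply: le_lt_trans UA; rewrite -[leRHS]adde0 -A0.
  rewrite -measureU//; [|exact: measurableD|by rewrite setDE -setIA setICl setI0].
  apply: le_measure; rewrite ?inE//; first by apply: measurableU => //; exact: measurableD.
  by move=> x Ux; have [Ax|nAx] := pselect (A x); [right|left].
have lmUoo : (lm U < +oo)%E by apply: lt_trans lmU _; exact: ltry.
have i1 : lm.-integrable U (EFin \o (fun=> 1 : R)).
  apply: measurable_bounded_integrable => //.
  by exists 1; split => // M M1 x _ /=; rewrite normr1 ltW.
pose m x := \int[lm]_(t in U `&` `]c, x]) (1 : R).
pose m' x := \int[lm]_(t in U `&` `]c, x]) `|g t|.
have mB x y : c <= x -> x <= y -> m y - m x = \int[lm]_(t in U `&` `]x, y]) (1 : R).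
  by move=> cx xy; rewrite /m (Rintegral_itv_oc_add mU i1 cx xy) addrAC subrr add0r.
have m'B x y : c <= x -> x <= y -> m' y - m' x = \int[lm]_(t in U `&` `]x, y]) `|g t|.
  move=> cx xy; rewrite /m' (Rintegral_itv_oc_add mU (inS _ mU) cx xy).
  by rewrite addrAC subrr add0r.
(* The witnesses list the intervals inside [U], with total length at most the measure of [U] between
   [x] and [y]. Keeping the list lets absolute continuity of [f] be applied once, to all of them
   together. *)
pose P x y := exists (n : nat) (X Y : nat -> R),
  [/\ (forall k, (k < n)%N -> [/\ x <= X k, X k <= Y k & Y k <= y]),
      (forall k, (k.+1 < n)%N -> Y k <= X k.+1),
      \sum_(k < n) (Y k - X k) <= m y - m x &
      `|h y - h x| <= e * (y - x) + \sum_(k < n) `|f (Y k) - f (X k)| + (m' y - m' x)].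
have : P c d.
  apply: cousin => //.
  - move=> x y z cx xy yz zd [n [X [Y [XY YX s1 s2]]]] [n' [X' [Y' [XY' YX' s1' s2']]]].
    exists (n + n')%N, (fun k => if (k < n)%N then X k else X' (k - n)%N),
      (fun k => if (k < n)%N then Y k else Y' (k - n)%N); split.
    + move=> k kn; case: ifPn => kn1; first by have [h1 h2 h3] := XY _ kn1; split=> //; exact: le_trans h3 yz.
      have : (k - n < n')%N by rewrite ltn_subLR// leqNgt.
      by move=> /XY'[h1 h2 h3]; split=> //; exact: le_trans xy h1.
    + move=> k kn; case: ifPn => kn1; case: ifPn => kn2.
      * exact: YX.
      * have [_ _ h1] := XY _ kn1.
        have : (k.+1 - n < n')%N by rewrite ltn_subLR// leqNgt.
        by move=> /XY'[h2 _ _]; exact: le_trans h1 h2.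
      * by move: kn1; rewrite -leqNgt => h1; move: kn2; rewrite ltnNge ltnW.
      * rewrite -leqNgt in kn1.
        by rewrite subSn//; apply: YX'; rewrite -subSn// ltn_subLR// ltnW.
    + rewrite big_split_ord /=.
      under eq_bigr do rewrite ltn_ord.
      under [X in _ + X]eq_bigr do rewrite ltnNge leq_addr /= addKn.
      by apply: le_trans (lerD s1 s1') _; rewrite addrC subrKA.
    + rewrite big_split_ord /=.
      under eq_bigr do rewrite ltn_ord.
      under [X in _ + (_ + X) + _]eq_bigr do rewrite ltnNge leq_addr /= addKn.
      have : `|h z - h x| <= `|h z - h y| + `|h y - h x|.
        by apply: le_trans (ler_normD _ _); rewrite addrA subrK.
      lra.
  - move=> t ct td; have [Ut|nUt] := pselect (U t).
      have [eta /= eta0 etaU] : \forall y \near t, U y by exact: open_nbhs_nbhs.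
      exists eta => // x y cx xt ty yd tx yt.
      have sub : U `&` `]x, y]%classic = `]x, y]%classic.
        apply/setIidPr => s /=; rewrite in_itv /= => /andP[xs sy].
        by apply: etaU => /=; rewrite ltr_norml; apply/andP; split; lra.
      exists 1%N, (fun=> x), (fun=> y).
      have xy : x <= y by lra.
      split => //.
      + rewrite big_ord1 mB// sub Rintegral_cst//= mul1r lebesgue_measure_itv /=.
        by rewrite lte_fin; case: ltP => h1 /=; lra.
      + rewrite big_ord1 m'B// sub.
        have : `|h y - h x| <= `|f y - f x| + `|F y - F x|.
          apply: le_trans (ler_normB _ _); rewrite /h.
          by rewrite [leRHS](_ : _ = `|f y - F y - (f x - F x)|)//; congr `|_|; ring.
        have : `|F y - F x| <= \int[lm]_(t in `]x, y]) `|g t|.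
          by rewrite FB//; apply: le_normr_Rintegral => //; exact: igS.
        have : 0 <= e * (y - x) by apply: mulr_ge0; lra.
        lra.
    have ntN : ~ A t by move=> /AU.
    have [dfg [dFt Fgt]] : (c <= t <= d -> derivable f t 1 /\ derive1 f t = g t)
           /\ (derivable F t 1 /\ derive1 F t = g t).
      by apply: contrapT => nt; apply: ntN; apply: NA.
    have [|dft fgt] := dfg; first by rewrite ct td.
    have e20 : 0 < e / 2 by lra.
    have [eta1 eta10 L1] := derivable_linear_approx dft e20.
    have [eta2 eta20 L2] := derivable_linear_approx dFt e20.
    have L y : `|y - t| < Num.min eta1 eta2 -> `|h y - h t| <= e * `|y - t|.
      rewrite lt_min => /andP[/L1 h1 /L2 h2].
      rewrite fgt in h1; rewrite Fgt in h2.
      have -> : h y - h t = (f y - f t - g t * (y - t)) - (F y - F t - g t * (y - t)).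
        by rewrite /h; ring.
      by apply: le_trans (ler_normB _ _) _; lra.
    exists (Num.min eta1 eta2); first by rewrite lt_min eta10.
    move=> x y cx xt ty yd tx yt; have xy : x <= y by lra.
    exists 0%N, (fun=> x), (fun=> x); split => //.
    + by rewrite big_ord0 mB//; apply: Rintegral_ge0.
    + rewrite big_ord0 addr0 m'B//.
      have : 0 <= \int[lm]_(s in U `&` `]x, y]) `|g s| by apply: Rintegral_ge0.
      have : `|h y - h x| <= `|h y - h t| + `|h t - h x|.
        by apply: le_trans (ler_normD _ _); rewrite addrA subrK.
      have : `|h y - h t| <= e * (y - t).
        have -> : y - t = `|y - t| by rewrite ger0_norm ?subr_ge0.
        by apply: L; rewrite ger0_norm ?subr_ge0// ltrBlDl.
      have : `|h t - h x| <= e * (t - x).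
        have -> : t - x = `|x - t| by rewrite distrC ger0_norm ?subr_ge0.
        rewrite distrC; apply: L.
        by rewrite distrC ger0_norm ?subr_ge0// ltrBlDl -ltrBlDr.
      lra.
move=> [n [X [Y [XY YX s1 s2]]]].
have sU (A' : set R) : measurable A' -> (lm (U `&` A') < (Num.min d1 d2)%:E)%E.
  move=> mA'; apply: le_lt_trans lmU; apply: le_measure; rewrite ?inE//.
  exact: measurableI.
have mc0 : m c = 0 by rewrite /m set_itv_ge ?setI0 ?Rintegral_set0// bnd_simp ltxx.
have m'c0 : m' c = 0 by rewrite /m' set_itv_ge ?setI0 ?Rintegral_set0// bnd_simp ltxx.
have mUcd : measurable (U `&` `]c, d]) by apply: measurableI.
have hU := sU `]c, d]%classic (measurable_itv _).
have md : m d < d1.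
  rewrite /m Rintegral_cst// mul1r -lte_fin fineK.
    by apply: (lt_le_trans hU); rewrite lee_fin ge_min lexx.
  by rewrite ge0_fin_numE//; apply: lt_trans hU (ltry _).
have m'd : m' d < e.
  apply: H2 => //; apply: (lt_le_trans hU).
  by rewrite lee_fin ge_min lexx orbT.
have := H1 n X Y XY YX; rewrite mc0 m'c0 in s1 s2.
have -> : e * (d - c + 2) = e * (d - c) + e + e by ring.
lra.
Qed.
End FTC.

(** * Transfer to the completed measure, and algebra of absolutely continuous functions *)

Section FTCcompleted.
Context {R : realType}.
Local Notation mu := (@completed_lebesgue_measure R).
Local Notation lm := (@lebesgue_measure R).
Local Notation cT := (caratheodory_type (wlength (R:=R) idfun)^*%mu).
Local Notation bT := (measurableTypeR R).
Implicit Types (f g h : R -> R) (c d x y t e : R).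

Lemma completed_aeS (P Q : set R) : (forall x, P x -> Q x) ->
  {ae mu, forall x, P x} -> {ae mu, forall x, Q x}.
Proof. exact: (@filterS _ _ (ae_filter_ringOfSetsType mu) P Q). Qed.

Lemma completed_aeS2 (P1 P2 Q : set R) : (forall x, P1 x -> P2 x -> Q x) ->
  {ae mu, forall x, P1 x} -> {ae mu, forall x, P2 x} -> {ae mu, forall x, Q x}.
Proof. exact: (@filterS2 _ _ (ae_filter_ringOfSetsType mu) P1 P2 Q). Qed.

(** Reduction to the Borel case: [g], cut off outside [[c, d]], is replaced by a Borel version,
    which changes neither the integral nor the almost everywhere hypothesis. *)
Lemma abs_cont_FTC f g c d : c <= d -> abs_cont_on c d f ->
  mu.-integrable `[c, d] (EFin \o g) ->
  {ae mu, forall x, c <= x <= d -> derivable f x 1 /\ derive1 f x = g x} ->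
  f d - f c = \int[mu]_(x in `[c, d]) g x.
Proof.
move=> cd ACf ig aef.
have mcd : measurable (`[c, d]%classic : set cT).
  exact: lebesgue_measurable_completed.
have ig1 : mu.-integrable setT (EFin \o (g \_ `[c, d])).
  rewrite -restrict_EFin; apply/integrable_restrict => //; rewrite setTI //.
have mg1 : measurable_fun (setT : set cT) ((g \_ `[c, d]) : cT -> R).
  by apply/measurable_EFinP; apply: (measurable_int mu).
have [g0 mg0 g0E] := completed_borel_version mg1.
have mg0' : measurable_fun (setT : set cT) (g0 : cT -> R).
  exact: measurable_fun_completed.
have g0E' : {ae mu, forall x, g0 x = (g \_ `[c, d]) x}.
  exact/completed_ae.
have ig0 : mu.-integrable setT (EFin \o g0).
  apply/integrableP; split; first exact/measurable_EFinP.
  have [_] := integrableP _ _ _ ig1; congr (_ < _)%E.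
  apply: ae_eq_integral; first exact: measurableT.
  - by apply/measurable_EFinP; exact: measurableT_comp.
  - by apply/measurable_EFinP; exact: measurableT_comp.
  - by apply: completed_aeS g0E' => x /= gx _; rewrite gx.
have il0 : lm.-integrable setT (EFin \o g0).
  by apply: completed_integrable.
have mcd0 : measurable (`[c, d]%classic : set bT) by [].
rewrite (abs_cont_FTC_borel cd ACf il0).
  rewrite /Rintegral -completed_integralE//; last first.
    by apply: integrableS ig0.
  congr fine; apply: ae_eq_integral; first exact: mcd.
  - by apply/measurable_EFinP; apply: measurable_funTS.
  - exact: measurable_int ig.
  - by apply: completed_aeS g0E' => x /= -> xcd; rewrite patchE mem_set.
apply/completed_ae; apply: completed_aeS2 aef g0E' => x /= h1 h2 xcd; rewrite h2 patchE mem_set ?in_itv//=.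
exact: h1.
Qed.

Lemma abs_cont_on_uniform c d f e : abs_cont_on c d f -> 0 < e ->
  exists2 eta : R, 0 < eta & forall x y, c <= x <= d -> c <= y <= d ->
    `|y - x| < eta -> `|f y - f x| < e.
Proof.
move=> ACf e0; have [eta eta0 H] := ACf _ e0; exists eta => // x y xcd ycd.
wlog xy : x y xcd ycd / x <= y.
  move=> W; have [xy|yx] := leP x y; first exact: W.
  by rewrite distrC [X in _ -> X < _]distrC; apply: W => //; exact: ltW.
move=> yx; have := H 1%N (fun=> x) (fun=> y); rewrite !big_ord1; apply.
- by move=> k _; case/andP: xcd; case/andP: ycd.
- by [].
- by move: yx; rewrite ger0_norm ?subr_ge0.
Qed.

Lemma abs_cont_on_continuous c d f : abs_cont_on c d f ->
  {within `[c, d], continuous f}.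
Proof.
move=> ACf; apply/subspace_continuousP => x /=; rewrite in_itv /= => xcd.
apply/cvgrPdist_lt => e e0; have [eta eta0 H] := abs_cont_on_uniform ACf e0.
rewrite /within /=; exists eta => //= y yx; rewrite in_itv /= => ycd.
by rewrite /= distrC; apply: H => //; rewrite distrC.
Qed.

Lemma within_continuous_bounded c d f : {within `[c, d], continuous f} ->
  exists2 M, 0 < M & forall x, c <= x <= d -> `|f x| <= M.
Proof.
move=> cf; have := continuous_compact cf (@segment_compact R c d).
move=> /compact_bounded[M [_ HM]]; exists (`|M| + 1); first by rewrite ltr_wpDl.
move=> x xcd; apply: (HM (`|M| + 1)); last by exists x.
by rewrite (le_lt_trans (ler_norm _))// ltrDl.
Qed.

(** Common source of the results on products, differences and inverses, where the constant [M] comes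
    from boundedness on the compact interval. *)
Lemma abs_cont_on_dominated c d f g h M : 0 < M ->
  abs_cont_on c d f -> abs_cont_on c d g ->
  (forall x y, c <= x <= d -> c <= y <= d ->
     `|h y - h x| <= M * (`|f y - f x| + `|g y - g x|)) ->
  abs_cont_on c d h.
Proof.
move=> M0 ACf ACg H e e0; have e1 : 0 < e / (2 * M) by rewrite divr_gt0// mulr_gt0.
have [d1 d10 H1] := ACf _ e1; have [d2 d20 H2] := ACg _ e1.
exists (Num.min d1 d2); first by rewrite lt_min d10.
move=> n x y xy yx; rewrite lt_min => /andP[/(H1 n x y xy yx) h1 /(H2 n x y xy yx) h2].
apply: (@le_lt_trans _ _ (\sum_(k < n) M * (`|f (y k) - f (x k)| + `|g (y k) - g (x k)|))).
  apply: ler_sum => k _; have [a1 a2 a3] := xy k (ltn_ord k).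
  by apply: H; apply/andP; split; lra.
rewrite -mulr_sumr big_split /=.
have -> : e = M * (e / (2 * M) + e / (2 * M)) by field; rewrite gt_eqF.
by rewrite ltr_pM2l// ltrD.
Qed.

Lemma abs_cont_onM c d f g : abs_cont_on c d f -> abs_cont_on c d g ->
  abs_cont_on c d (fun x => f x * g x).
Proof.
move=> ACf ACg.
have [M M0 HM] := within_continuous_bounded (abs_cont_on_continuous ACf).
have [N N0 HN] := within_continuous_bounded (abs_cont_on_continuous ACg).
apply: (abs_cont_on_dominated (addr_gt0 M0 N0) ACf ACg) => x y xcd ycd.
have -> : f y * g y - f x * g x = f y * (g y - g x) + (f y - f x) * g x by ring.
apply: le_trans (ler_normD _ _) _; rewrite !normrM.
have := HM y ycd; have := HN x xcd.
have := normr_ge0 (f y - f x); have := normr_ge0 (g y - g x).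
have := normr_ge0 (f y); have := normr_ge0 (g x); nra.
Qed.

Lemma abs_cont_onB c d f g : abs_cont_on c d f -> abs_cont_on c d g ->
  abs_cont_on c d (fun x => f x - g x).
Proof.
move=> ACf ACg; apply: (abs_cont_on_dominated ltr01 ACf ACg) => x y xcd ycd.
have -> : f y - g y - (f x - g x) = (f y - f x) - (g y - g x) by ring.
by rewrite mul1r ler_normB.
Qed.

Lemma abs_cont_onV c d f : abs_cont_on c d f ->
  (forall x, c <= x <= d -> f x != 0) -> abs_cont_on c d (fun x => (f x)^-1).
Proof.
move=> ACf f0; have cV : {within `[c, d], continuous (fun x => (f x)^-1)}.
  apply/subspace_continuousP => x xcd; apply: cvgV.
    by apply: f0; move: xcd; rewrite /= in_itv.
  by have /subspace_continuousP := abs_cont_on_continuous ACf; apply.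
have [M M0 HM] := within_continuous_bounded cV.
apply: (abs_cont_on_dominated (mulr_gt0 M0 M0) ACf ACf) => x y xcd ycd.
have -> : (f y)^-1 - (f x)^-1 = (f y)^-1 * (f x)^-1 * (f x - f y).
  by field; rewrite !f0.
rewrite !normrM distrC; apply: ler_pM => //.
  by apply: ler_pM => //; exact: HM.
by rewrite lerDl.
Qed.

End FTCcompleted.

(** * Power series *)

Section PowerSeries.
Context {R : realType}.
Implicit Types (a : nat -> R) (e K M y : R).

Lemma sum_pow_le2 y m : 0 <= y -> y <= 1 / 2 -> \sum_(j < m) y ^+ j <= 2.
Proof.
move=> y0 y1; apply: (@le_trans _ _ (2 - 2 * (1 / 2 : R) ^+ m)); last first.
  by rewrite gerBl mulr_ge0// exprn_ge0//; lra.
elim: m => [|m IH]; first by rewrite big_ord0 expr0; lra.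
rewrite big_ord_recr /= exprS.
have : y ^+ m <= (1 / 2) ^+ m by rewrite lerXn2r ?nnegrE//; lra.
lra.
Qed.

(** Convergence at [e0] bounds the terms there by some [M]; for [e <= e0 / 2] the terms from [N] on
    are then dominated by a geometric series of ratio [e / e0 <= 1 / 2]. *)
Lemma pseries_remainder a (f : R -> R) e0 : 0 < e0 ->
  (forall e, 0 < e -> e <= e0 ->
     (fun n => \sum_(k < n) a k * e ^+ k) @ \oo --> f e) ->
  forall N, exists2 K, 0 <= K & forall e, 0 < e -> e <= e0 / 2 ->
     `|f e - \sum_(k < N) a k * e ^+ k| <= K * e ^+ N.
Proof.
move=> e00 cf N.
have [M M0 HM] : exists2 M, 0 <= M & forall k, `|a k * e0 ^+ k| <= M.
  have h : [series a k * e0 ^+ k]_k @ \oo --> f e0.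
    by rewrite seriesEord; exact: cf.
  have : cvgn (fun k => a k * e0 ^+ k).
    apply/cvg_ex; exists 0; apply: cvg_series_cvg_0.
    by apply/cvg_ex; exists (f e0).
  move=> /cvg_seq_bounded [M [_ HM]]; exists (`|M| + 1); first by rewrite addr_ge0.
  by move=> k; apply: (HM (`|M| + 1)) => //; rewrite (le_lt_trans (ler_norm _))// ltrDl.
exists (2 * M / e0 ^+ N); first by rewrite divr_ge0 ?mulr_ge0// exprn_ge0// ltW.
move=> e e_gt0 ee.
have part m : `|\sum_(k < N + m) a k * e ^+ k - \sum_(k < N) a k * e ^+ k|
    <= 2 * M / e0 ^+ N * e ^+ N.
  rewrite big_split_ord /= addrAC subrr add0r.
  apply: (@le_trans _ _ (\sum_(j < m) M * (e / e0) ^+ N * (e / e0) ^+ j)).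
    apply: le_trans (ler_norm_sum _ _ _) _; apply: ler_sum => j _.
    have -> : a (N + j)%N * e ^+ (N + j) = (a (N + j)%N * e0 ^+ (N + j)) * (e / e0) ^+ (N + j).
      by rewrite expr_div_n -mulrA; congr (_ * _); field; rewrite expf_neq0// gt_eqF.
    rewrite normrM -mulrA -exprD; apply: ler_pM => //.
    by rewrite ger0_norm// exprn_ge0// divr_ge0// ltW.
  rewrite -mulr_sumr expr_div_n.
  have -> : 2 * M / e0 ^+ N * e ^+ N = M * (e ^+ N / e0 ^+ N) * 2 by ring.
  rewrite ler_wpM2l//; first by rewrite mulr_ge0// divr_ge0// exprn_ge0// ltW.
  apply: sum_pow_le2; first by rewrite divr_ge0// ltW.
  by rewrite ler_pdivrMr//; lra.
have ce : (fun n => `|\sum_(k < n) a k * e ^+ k - \sum_(k < N) a k * e ^+ k|) @ \oo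
    --> `|f e - \sum_(k < N) a k * e ^+ k|.
  apply: cvg_norm; apply: cvgB; last exact: cvg_cst.
  by apply: cf => //; lra.
apply: (cvgr_to_le ce).
near=> n; rewrite -(@subnKC N n); last by near: n; exact: nbhs_infty_ge.
exact: part.
Unshelve. all: by end_near. Qed.

(** Letting [e] tend to 0 gives [a 0 = 0]; dividing by [e] then lowers [N] by one. *)
Lemma poly_small_coef0 N a K e0 : 0 < e0 ->
  (forall e, 0 < e -> e <= e0 -> `|\sum_(k < N) a k * e ^+ k| <= K * e ^+ N) ->
  forall k, (k < N)%N -> a k = 0.
Proof.
elim: N a => [//|N IH] a e00 H.
have sumE e : \sum_(k < N.+1) a k * e ^+ k = a 0 + e * \sum_(k < N) a k.+1 * e ^+ k.
  rewrite big_ord_recl expr0 mulr1; congr (_ + _); rewrite mulr_sumr.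
  by apply: eq_bigr => i _; rewrite lift0 exprS; ring.
have K0 : 0 <= K.
  have := le_trans (normr_ge0 _) (H e0 e00 (lexx _)).
  by rewrite pmulr_lge0// exprn_gt0.
have a0 : a 0 = 0.
  apply/eqP; rewrite -normr_le0; apply/ler_addgt0Pr => d d0; rewrite add0r.
  pose S := \sum_(k < N) `|a k.+1|.
  have S0 : 0 <= S by apply: sumr_ge0.
  (* [e <= 1] controls all powers, so that [|a 0| <= K * e + S * e]; the last bound on [e] makes
     this at most [d]. *)
  pose e := Num.min (Num.min e0 1) (d / (K + S + 1)).
  have e_gt0 : 0 < e by rewrite !lt_min e00 ltr01 divr_gt0//; lra.
  have ee0 : e <= e0 by rewrite !ge_min lexx.
  have e1 : e <= 1 by rewrite !ge_min lexx orbT.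
  have ed : e * (K + S + 1) <= d by rewrite -ler_pdivlMr ?ge_min ?lexx ?orbT//; lra.
  have := H e e_gt0 ee0; rewrite sumE => h.
  have h1 : `|\sum_(k < N) a k.+1 * e ^+ k| <= S.
    apply: le_trans (ler_norm_sum _ _ _) _; apply: ler_sum => k _.
    rewrite normrM [X in _ * X]ger0_norm ?exprn_ge0 ?(ltW e_gt0)//.
    by rewrite ler_piMr// exprn_ile1// ltW.
  have h2 : K * e ^+ N.+1 <= K * e.
    by rewrite ler_wpM2l// exprS ler_piMr ?(ltW e_gt0)// exprn_ile1// ltW.
  have -> : a 0 = (a 0 + e * \sum_(k < N) a k.+1 * e ^+ k) - e * \sum_(k < N) a k.+1 * e ^+ k.
    by ring.
  apply: le_trans (ler_normB _ _) _; rewrite [X in _ + X]normrM (gtr0_norm e_gt0).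
  have : e * `|\sum_(k < N) a k.+1 * e ^+ k| <= e * S by rewrite ler_wpM2l// ltW.
  nra.
case=> [//|k]; rewrite ltnS; apply: (IH (fun k => a k.+1)) => // e e_gt0 ee.
have := H e e_gt0 ee; rewrite sumE a0 add0r normrM (gtr0_norm e_gt0) exprS.
by rewrite mulrCA ler_pM2l.
Qed.

(** Applied to the supremum [S] of [|g|], the improvement gives [S <= K + S / 2]. The crude bound
    [M] only serves to make [S] finite, so that half of it can be subtracted. *)
Lemma sup_halving (U : Type) (E : set U) (g : U -> R) K M :
  (forall t, E t -> `|g t| <= M) ->
  (forall M', (forall t, E t -> `|g t| <= M') -> forall t, E t -> `|g t| <= K + M' / 2) ->
  forall t, E t -> `|g t| <= 2 * K.
Proof.
move=> HM Hh t Et; pose S := [set `|g x| | x in E].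
have supS : has_sup S by split; [exists `|g t|, t|exists M => _ [x Ex <-]; exact: HM].
have HS x : E x -> `|g x| <= sup S by move=> Ex; apply: ub_le_sup; [exact: supS.2|exists x].
have : sup S <= K + sup S / 2.
  by apply: ge_sup; [exact: supS.1|move=> _ [x Ex <-]; exact: Hh].
by have := HS t Et; lra.
Qed.

End PowerSeries.

(** * The operators H and T *)

Section VolterraKernel.
Context d (T : measurableType d) (R : realType) (mu : {measure set T -> \bar R}).
Variables (D : set T) (w rho : T -> R) (c : T).
Hypothesis mD : measurable D.
Hypothesis mw : measurable_fun D w.
Hypothesis mrho : measurable_fun D rho.
Hypothesis w_gt0 : forall t, D t -> 0 < w t.
Hypothesis rho_gt0 : forall t, D t -> 0 < rho t.
Hypothesis Dc : D c.
Hypothesis w_lec : forall t, D t -> w t <= w c.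
Hypothesis w_small : forall e : R, 0 < e -> exists2 t, D t & w t < e.
Hypothesis mass : forall x, D x -> mu (D `&` [set t | w t < w x]) <> 0%E.
Hypothesis w_int : mu.-integrable D (EFin \o (fun t => w t * rho t)).

Implicit Types (f g h k : T -> R) (x y t : T) (e s : R).

Definition wint (k : T -> R) : R := \int[mu]_(t in D) (k t * rho t).
Definition wintegrable (k : T -> R) : Prop :=
  measurable_fun D k /\ mu.-integrable D (EFin \o (fun t => k t * rho t)).
(** Sublevel sets of [w] stand for neighbourhoods of the endpoint [a]: for the strictly increasing
    quotient [u / v] they are the intervals [(a, x]]. *)
Definition wnear (P : T -> Prop) : Prop :=
  exists2 x, D x & forall t, D t -> w t <= w x -> P t.
Definition wlittleo (f g : T -> R) : Prop :=
  wnear (fun t => g t != 0) /\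
  forall e : R, 0 < e -> wnear (fun t => `|f t| <= e * `|g t|).
(** Used with [|s| = 1], so that [s * g] is [|g|] near the endpoint. *)
Definition wsign (s : R) (g : T -> R) : Prop := wnear (fun t => 0 < s * g t).
Definition wbounded (g : T -> R) : Prop :=
  measurable_fun D g /\ exists M : R, forall t, D t -> `|g t| <= M.
Definition wlow (x t : T) : R := if w t <= w x then 1 else 0.
Definition whigh (x t : T) : R := if w t <= w x then 0 else 1.
(** Both kernels are Green's kernels of minus the second derivative in the variable [w]; they differ
    by [w x], a solution of the homogeneous equation. *)
Definition Hop (g : T -> R) (x : T) : R := wint (fun t => Num.min (w t) (w x) * g t).
Definition Top (g : T -> R) (x : T) : R := wint (fun t => Num.min (w t - w x) 0 * g t).

Lemma wnear_and (P Q : T -> Prop) : wnear P -> wnear Q -> wnear (fun t => P t /\ Q t).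
Proof.
move=> [x Dx Px] [y Dy Qy]; have [xy|yx] := leP (w x) (w y).
  by exists x => // t Dt tx; split; [exact: Px|apply: Qy => //; exact: le_trans xy].
exists y => // t Dt ty; split; [apply: Px => //|exact: Qy].
exact: le_trans ty (ltW yx).
Qed.

Lemma wnearS (P Q : T -> Prop) : (forall t, D t -> P t -> Q t) -> wnear P -> wnear Q.
Proof. by move=> PQ [x Dx Px]; exists x => // t Dt tx; apply: PQ => //; exact: Px. Qed.

Lemma wnear_small e : 0 < e -> wnear (fun t => w t <= e).
Proof.
move=> e0; have [x Dx xe] := w_small e0.
by exists x => // t Dt tx; apply: le_trans tx (ltW xe).
Qed.

Lemma wnear_witness (P : T -> Prop) : wnear P -> exists2 t, D t & P t.
Proof. by move=> [x Dx Px]; exists x => //; apply: Px. Qed.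

Let measurable_cst a : measurable_fun D (fun=> a : R).
Proof. by []. Qed.

Lemma measurable_wlow x : measurable_fun D (wlow x).
Proof.
apply: measurable_fun_if => //; first exact: measurable_fun_ler.
Qed.

Lemma measurable_whigh x : measurable_fun D (whigh x).
Proof.
apply: measurable_fun_if => //; first exact: measurable_fun_ler.
Qed.

Lemma measurable_Hker x : measurable_fun D (fun t => Num.min (w t) (w x)).
Proof. exact: measurable_minr. Qed.

Lemma measurable_Tker x : measurable_fun D (fun t => Num.min (w t - w x) 0).
Proof. by apply: measurable_minr => //; apply: measurable_funB. Qed.

Let measurable_fun_normr g : measurable_fun D g -> measurable_fun D (fun t => `|g t|).
Proof. by move=> mg; apply: measurableT_comp. Qed.

Lemma wintegrableD f g : wintegrable f -> wintegrable g ->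
  wintegrable (fun t => f t + g t).
Proof.
move=> [mf If] [mg Ig]; split; first exact: measurable_funD.
have := integrableD mD If Ig; congr (_.-integrable _ _).
by apply/funext => t /=; rewrite mulrDl.
Qed.

Lemma wintegrableZ a g : wintegrable g -> wintegrable (fun t => a * g t).
Proof.
move=> [mg Ig]; split; first exact: measurable_funM.
have := integrableZl mD a Ig; congr (_.-integrable _ _).
by apply/funext => t /=; rewrite -mulrA.
Qed.

Lemma wintegrableB f g : wintegrable f -> wintegrable g ->
  wintegrable (fun t => f t - g t).
Proof.
move=> If Ig; have := wintegrableD If (wintegrableZ (-1) Ig).
by congr wintegrable; apply/funext => t; rewrite mulN1r.
Qed.

Lemma wintegrable_le k g : measurable_fun D g -> wintegrable k ->
  (forall t, D t -> `|g t| <= k t) -> wintegrable g.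
Proof.
move=> mg [mk Ik] gk; split => //.
apply: le_integrable Ik => //; first by apply/measurable_EFinP/measurable_funM.
move=> t Dt /=; rewrite lee_fin !normrM; apply: ler_pM => //.
by apply: le_trans (gk _ Dt) _; exact: ler_norm.
Qed.

Lemma wintegrable_norm g : wintegrable g -> wintegrable (fun t => `|g t|).
Proof.
move=> [mg Ig]; split; first exact: measurable_fun_normr.
have := integrable_norm Ig; apply: eq_integrable => // t /set_mem Dt /=.
by rewrite normrM (gtr0_norm (rho_gt0 Dt)).
Qed.

Lemma wintD f g : wintegrable f -> wintegrable g ->
  wint (fun t => f t + g t) = wint f + wint g.
Proof.
move=> [mf If] [mg Ig]; rewrite /wint -RintegralD//.
by apply: eq_Rintegral => t _ /=; rewrite mulrDl.
Qed.

Lemma wintZ a g : wintegrable g -> wint (fun t => a * g t) = a * wint g.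
Proof.
move=> [mg Ig]; rewrite /wint -RintegralZl//.
by apply: eq_Rintegral => t _ /=; rewrite mulrA.
Qed.

Lemma wintB f g : wintegrable f -> wintegrable g ->
  wint (fun t => f t - g t) = wint f - wint g.
Proof.
move=> [mf If] [mg Ig]; rewrite /wint -RintegralB//.
by apply: eq_Rintegral => t _ /=; rewrite mulrBl.
Qed.

Lemma eq_wint f g : (forall t, D t -> f t = g t) -> wint f = wint g.
Proof. by move=> fg; apply: eq_Rintegral => t /set_mem Dt; rewrite fg. Qed.

Lemma eq_wintegrable f g : (forall t, D t -> f t = g t) -> wintegrable f -> wintegrable g.
Proof.
move=> fg [mf If]; split.
  by apply: eq_measurable_fun mf => t /set_mem Dt; rewrite fg.
by apply: eq_integrable If => // t /set_mem Dt /=; rewrite fg.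
Qed.

Lemma le_wint f g : wintegrable f -> wintegrable g ->
  (forall t, D t -> f t <= g t) -> wint f <= wint g.
Proof.
move=> [mf If] [mg Ig] fg; apply: le_Rintegral => // t Dt.
by rewrite ler_wpM2r ?fg// ltW// rho_gt0.
Qed.

Lemma wint_ge0 f : (forall t, D t -> 0 <= f t) -> 0 <= wint f.
Proof. by move=> f0; apply: Rintegral_ge0 => t Dt; rewrite mulr_ge0 ?f0// ltW// rho_gt0. Qed.

Lemma wint_norm g k : wintegrable g -> wintegrable k ->
  (forall t, D t -> `|g t| <= k t) -> `|wint g| <= wint k.
Proof.
move=> Ig Ik gk; apply: (@le_trans _ _ (wint (fun t => `|g t|))).
  apply: le_trans (le_normr_Rintegral mD Ig.2) _.
  rewrite le_eqVlt; apply/orP; left; apply/eqP.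
  by apply: eq_Rintegral => t /set_mem Dt /=; rewrite normrM (gtr0_norm (rho_gt0 Dt)).
by apply: le_wint => //; exact: wintegrable_norm.
Qed.

Lemma wintegrable_w : wintegrable w. Proof. by []. Qed.

Lemma wintegrable_Ow a g : measurable_fun D g ->
  (forall t, D t -> `|g t| <= a * w t) -> wintegrable g.
Proof. by move=> mg ga; apply: (wintegrable_le mg (wintegrableZ a wintegrable_w)). Qed.

(** Where [w t > w x], a bound [M] on [g] is at most [(M / w x) * w t]. *)
Lemma wintegrable_high x g : D x -> wbounded g ->
  wintegrable (fun t => whigh x t * g t).
Proof.
move=> Dx [mg [M HM]]; apply: (@wintegrable_Ow (M / w x)).
  by apply: measurable_funM => //; exact: measurable_whigh.
move=> t Dt; rewrite /whigh normrM; have M0 := le_trans (normr_ge0 _) (HM _ Dt).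
have x0 := w_gt0 Dx; have t0 := w_gt0 Dt.
case: (leP (w t) (w x)) => tx; first by rewrite normr0 mul0r mulr_ge0 ?divr_ge0 // ltW.
rewrite normr1 mul1r; apply: le_trans (HM _ Dt) _.
by rewrite mulrAC ler_pdivlMr// ler_wpM2l// ltW.
Qed.

Lemma wintegrable_low x g : wintegrable g -> wintegrable (fun t => wlow x t * g t).
Proof.
move=> Ig; apply: (wintegrable_le _ (wintegrable_norm Ig)).
  by apply: measurable_funM; [exact: measurable_wlow|exact: Ig.1].
move=> t Dt; rewrite /wlow; case: ifP => _; first by rewrite mul1r.
by rewrite mul0r normr0.
Qed.

Lemma wintegrable_low_eq x g : D x -> wbounded g ->
  wintegrable (fun t => wlow x t * g t) -> wintegrable g.
Proof.
move=> Dx gb Il; have := wintegrableD Il (wintegrable_high Dx gb).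
apply: eq_wintegrable => t _; rewrite /wlow /whigh.
by case: ifP => _; ring.
Qed.

(** Dominated convergence along points [X n] with [w (X n) < 1 / n.+1]: as [w] is positive, every
    [t] eventually leaves these sublevel sets. Their monotonicity then covers all [x] near the
    endpoint. *)
Lemma wint_tail k e : wintegrable k -> 0 < e ->
  wnear (fun x => wint (fun t => wlow x t * `|k t|) <= e).
Proof.
move=> Ik e0; have Ink := wintegrable_norm Ik.
have small n : exists x, D x /\ w x < n.+1%:R^-1.
  by have [|x Dx xn] := @w_small n.+1%:R^-1; [rewrite invr_gt0|exists x].
have [X HX] := choice small.
have DX n : D (X n) by have [] := HX n.
pose f_ n t := ((wlow (X n) t * `|k t|) * rho t)%:E.
have : (\int[mu]_(t in D) f_ n t)%E @[n --> \oo] --> (\int[mu]_(t in D) (cst 0 : T -> \bar R) t)%E.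
  apply: (@dominated_cvg _ _ _ _ _ mD f_ (cst 0)
     (EFin \o (fun t => `|k t| * rho t))) => //.
  - move=> n; apply/measurable_EFinP/measurable_funM => //.
    by apply: measurable_funM; [exact: measurable_wlow|exact: Ink.1].
  - move=> t Dt; apply: cvg_near_cst.
    have := @near_infty_natSinv_lt R (PosNum (w_gt0 Dt)).
    apply: filterS => n /= nt; rewrite /f_ /wlow ifF ?mul0r//.
    by apply/negbTE; rewrite -ltNge; apply: lt_trans nt; have [] := HX n.
  - exact: Ink.2.
  - move=> n t Dt; rewrite lee_fin /f_ /wlow.
    case: ifP => _; rewrite ?mul1r ?mul0r ?normr0.
      by rewrite ger0_norm// mulr_ge0// ltW// rho_gt0.
    by rewrite mulr_ge0// ltW// rho_gt0.
rewrite integral0 => /fine_cvgP[_ /cvgrPdist_lt /(_ _ e0)].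
move=> [N _ /(_ N (leqnn N))] /=; rewrite sub0r normrN => hN.
exists (X N) => // x Dx xN; apply: le_trans (ltW hN).
apply: le_trans (ler_norm _); apply: le_wint; [exact: wintegrable_low|exact: wintegrable_low|].
move=> t Dt; apply: ler_wpM2r => //; rewrite /wlow.
case: ifP => tx; last by case: ifP.
by rewrite ifT// (le_trans tx).
Qed.

Lemma wbounded_wint g : wbounded g -> wintegrable (fun t => w t * g t).
Proof.
move=> [mg [M HM]]; apply: (@wintegrable_Ow M); first exact: measurable_funM.
move=> t Dt; rewrite normrM mulrC (gtr0_norm (w_gt0 Dt)).
by apply: ler_wpM2r; [rewrite ltW// w_gt0|exact: HM].
Qed.

Lemma wintegrable_wM g : wintegrable g -> wintegrable (fun t => w t * g t).
Proof.
move=> Ig; apply: (wintegrable_le _ (wintegrableZ (w c) (wintegrable_norm Ig))).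
  by apply: measurable_funM => //; exact: Ig.1.
move=> t Dt; rewrite normrM (gtr0_norm (w_gt0 Dt)).
by rewrite ler_wpM2r// w_lec.
Qed.

(** * Mapping properties of [Hop] *)

Lemma Hker_ge0 x t : D x -> D t -> 0 <= Num.min (w t) (w x).
Proof. by move=> Dx Dt; rewrite le_min !ltW// w_gt0. Qed.

Lemma wintegrable_Hker g x : D x -> measurable_fun D g ->
  wintegrable (fun t => w t * g t) ->
  wintegrable (fun t => Num.min (w t) (w x) * g t).
Proof.
move=> Dx mg Ig; apply: (wintegrable_le _ (wintegrable_norm Ig)).
  by apply: measurable_funM => //; exact: measurable_Hker.
move=> t Dt; rewrite !normrM ler_wpM2r// ger0_norm ?Hker_ge0//.
by rewrite (gtr0_norm (w_gt0 Dt)) ge_min lexx.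
Qed.

Lemma wintegrable_Tker g x : D x -> wintegrable g ->
  wintegrable (fun t => Num.min (w t - w x) 0 * g t).
Proof.
move=> Dx Ig; apply: (wintegrable_le _ (wintegrableZ (w x) (wintegrable_norm Ig))).
  by apply: measurable_funM => //; [exact: measurable_Tker|exact: Ig.1].
move=> t Dt; rewrite normrM ler_wpM2r//.
by have := w_gt0 Dt; have := w_gt0 Dx; case: (leP (w t - w x) 0) => h ? ?;
  [rewrite ler0_norm//; lra|rewrite normr0; lra].
Qed.

(** For [g >= 0], [Hop g x] is a nondecreasing function of [w x], so each superlevel set is the
    preimage under [w] of an interval [J]. *)
Lemma measurable_Hop_nneg g : measurable_fun D g ->
  wintegrable (fun t => w t * g t) -> (forall t, D t -> 0 <= g t) ->
  measurable_fun D (Hop g).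
Proof.
move=> mg Ig g0 _; apply: (measurability _ (RGenOInfty.measurableE R)) => //.
move=> /= _ [_ [y ->] <-].
have mono x x' : D x -> D x' -> w x <= w x' -> Hop g x <= Hop g x'.
  move=> Dx Dx' xx'; apply: le_wint; [exact: wintegrable_Hker|exact: wintegrable_Hker|].
  move=> t Dt; apply: ler_wpM2r; first exact: g0.
  by rewrite le_min !ge_min lexx xx' orbT.
pose J : set R := [set r | exists2 x, D x & w x <= r /\ y < Hop g x].
have -> : D `&` (Hop g) @^-1` `]y, +oo[ = D `&` w @^-1` J.
  apply/seteqP; split => x /= [Dx]; rewrite /= in_itv /= andbT.
    by move=> yx; split=> //; exists x.
  by move=> [x' Dx' [xx' yx']]; split=> //; apply: (lt_le_trans yx'); exact: mono.
apply: mw => //; apply: is_interval_measurable => r1 r2 [x1 Dx1 [h1 h2]] _ r.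
by move=> /andP[r1r _]; exists x1 => //; split=> //; exact: le_trans r1r.
Qed.

Lemma measurable_Hop g : measurable_fun D g -> wintegrable (fun t => w t * g t) ->
  measurable_fun D (Hop g).
Proof.
move=> mg Ig.
pose gp t := Num.max (g t) 0; pose gn t := Num.max (- g t) 0.
have mgp : measurable_fun D gp by exact: measurable_maxr.
have mgn : measurable_fun D gn by apply: measurable_maxr => //; exact: measurableT_comp.
have gpn t : g t = gp t - gn t by rewrite /gp /gn; case: (leP (g t) 0); case: (leP (- g t) 0); lra.
have gpb t : `|gp t| <= `|g t| by rewrite /gp; case: (leP (g t) 0); rewrite ?normr0.
have gnb t : `|gn t| <= `|g t|.
  by rewrite /gn; case: (leP (- g t) 0); rewrite ?normr0// normrN.
have Igp : wintegrable (fun t => w t * gp t).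
  apply: (wintegrable_le _ (wintegrable_norm Ig)); first exact: measurable_funM.
  by move=> t Dt; rewrite !normrM ler_wpM2l.
have Ign : wintegrable (fun t => w t * gn t).
  apply: (wintegrable_le _ (wintegrable_norm Ig)); first exact: measurable_funM.
  by move=> t Dt; rewrite !normrM ler_wpM2l.
have mp : measurable_fun D (Hop gp).
  by apply: measurable_Hop_nneg => // t _; rewrite /gp le_max lexx orbT.
have mn : measurable_fun D (Hop gn).
  by apply: measurable_Hop_nneg => // t _; rewrite /gn le_max lexx orbT.
apply: eq_measurable_fun (measurable_funB mp mn) => x /set_mem Dx /=.
rewrite /Hop -wintB; [|exact: wintegrable_Hker|exact: wintegrable_Hker].
by apply: eq_wint => t _; rewrite gpn mulrBr.
Qed.

Local Notation kappa := (wint w).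

Lemma wint_w_ge0 : 0 <= kappa.
Proof. by apply: wint_ge0 => t /w_gt0/ltW. Qed.

Lemma Hop_bound g M : measurable_fun D g -> (forall t, D t -> `|g t| <= M) ->
  forall x, D x -> `|Hop g x| <= M * kappa.
Proof.
move=> mg HM x Dx.
have Ig : wintegrable (fun t => w t * g t) by apply: wbounded_wint; split => //; exists M.
rewrite -wintZ//; apply: wint_norm; [exact: wintegrable_Hker|exact: wintegrableZ|].
move=> t Dt; rewrite normrM mulrC (ger0_norm (Hker_ge0 Dx Dt)).
by apply: ler_pM => //; [exact: Hker_ge0|exact: HM|rewrite ge_min lexx].
Qed.

Lemma wbounded_Hop g : wbounded g -> wbounded (Hop g).
Proof.
move=> gb; have [mg [M HM]] := gb; split.
  by apply: measurable_Hop => //; exact: wbounded_wint.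
by exists (M * kappa); exact: Hop_bound.
Qed.

Lemma wboundedB_w b g : wbounded g -> wbounded (fun t => - b * w t + g t).
Proof.
move=> [mg [M HM]]; split.
  by apply: measurable_funD => //; apply: measurable_funM.
exists (`|b| * w c + M) => t Dt; apply: le_trans (ler_normD _ _) _.
rewrite lerD ?HM// normrM normrN (gtr0_norm (w_gt0 Dt)).
by rewrite ler_wpM2l// w_lec.
Qed.

(** Below a level [x0] the kernel is at most [w t] and the tail of [w |g| rho] is small; above it
    the kernel is at most [w x], which tends to 0. *)
Lemma Hop_cvg0 g e : wbounded g -> 0 < e -> wnear (fun x => `|Hop g x| <= e).
Proof.
move=> gb e0; have [mg [M HM]] := gb; have e20 : 0 < e / 2 by lra.
have Iwg := wbounded_wint gb.
have [x0 Dx0 Hx0] := wint_tail Iwg e20.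
have Ih := wintegrable_norm (wintegrable_high Dx0 gb).
set C := wint (fun t => `|whigh x0 t * g t|) in Ih.
have C0 : 0 <= C by apply: wint_ge0.
have p0 : 0 < e / 2 / (C + 1) by rewrite divr_gt0//; lra.
have [x1 Dx1 Hx1] := wnear_small p0.
exists x1 => // x Dx xx1; have wx := Hx1 _ Dx xx1; have x_gt0 := w_gt0 Dx.
have h0 := Hx0 _ Dx0 (lexx _).
have : `|Hop g x| <= wint (fun t => wlow x0 t * `|w t * g t| + w x * `|whigh x0 t * g t|).
  apply: wint_norm.
  - exact: wintegrable_Hker.
  - apply: wintegrableD; first by apply: wintegrable_low; exact: wintegrable_norm.
    exact: wintegrableZ.
  - move=> t Dt; have t0 := w_gt0 Dt.
    rewrite /wlow /whigh !normrM (ger0_norm (Hker_ge0 Dx Dt)) (gtr0_norm t0).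
    case: (leP (w t) (w x0)) => _; rewrite ?normr0 ?normr1 ?mul1r ?mul0r ?mulr0 ?addr0 ?add0r.
      by rewrite ler_wpM2r// ge_min lexx.
    by rewrite ler_wpM2r// ge_min lexx orbT.
rewrite wintD; last 2 first.
- by apply: wintegrable_low; exact: wintegrable_norm.
- exact: wintegrableZ.
rewrite wintZ// -/C => h.
have : w x * C <= e / 2.
  apply: (@le_trans _ _ (e / 2 / (C + 1) * C)); first by rewrite ler_wpM2r.
  by rewrite mulrAC ler_pdivrMr ?ler_wpM2l//; lra.
lra.
Qed.

(** Only the part of the integral above [x0] can have the wrong sign, and it is at most [w x * C].
    Hence [s * g' x >= - (|b| + C) * w x >= - |g' x| / 2], the last step by [w = o(g')]; this rules
    out [s * g' x = - |g' x|]. *)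
Lemma wsign_Hop (b s : R) g g' : `|s| = 1 -> wbounded g -> wsign s g ->
  (forall x, D x -> g' x = - b * w x + Hop g x) -> wlittleo w g' -> wsign s g'.
Proof.
move=> s1 gb [x0 Dx0 sg] g'E [g'0 wo]; have [mg _] := gb.
have Iwg := wbounded_wint gb.
have Ih := wintegrable_norm (wintegrable_high Dx0 gb).
set C := wint (fun t => `|whigh x0 t * g t|) in Ih.
have C0 : 0 <= C by apply: wint_ge0.
have b0 := normr_ge0 b.
have p0 : 0 < 1 / (2 * (`|b| + C + 1)) by rewrite divr_gt0// mulr_gt0//; lra.
apply: wnearS (wnear_and g'0 (wo _ p0)) => x Dx [g'x wx].
have x_gt0 := w_gt0 Dx; rewrite (gtr0_norm x_gt0) in wx.
have HC : - (w x * C) <= s * Hop g x.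
  rewrite -(wintZ s); last exact: wintegrable_Hker.
  rewrite -mulNr -wintZ//.
  apply: le_wint; [exact: wintegrableZ|by apply: wintegrableZ; exact: wintegrable_Hker|].
  move=> t Dt; have k0 := Hker_ge0 Dx Dt; rewrite /whigh.
  case: (leP (w t) (w x0)) => tx.
    rewrite mul0r normr0 mulr0 mulrCA mulr_ge0//.
    exact/ltW/sg.
  rewrite mul1r mulNr; apply: (@le_trans _ _ (- (Num.min (w t) (w x) * `|g t|))).
    by rewrite lerN2 ler_wpM2r// ge_min lexx orbT.
  by rewrite lerNl; apply: le_trans (ler_norm _) _; rewrite normrN !normrM s1 mul1r (ger0_norm k0).
have : `|s * g' x| = `|g' x| by rewrite normrM s1 mul1r.
have : 0 < `|g' x| by rewrite normr_gt0.
have sbw : - (`|b| * w x) <= - (s * (b * w x)).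
  rewrite lerN2; apply: le_trans (ler_norm _) _.
  by rewrite !normrM s1 mul1r (gtr0_norm x_gt0).
have : s * g' x = - (s * (b * w x)) + s * Hop g x by rewrite g'E//; ring.
have : (`|b| + C) * w x <= `|g' x| / 2.
  apply: (@le_trans _ _ ((`|b| + C + 1) * w x)); first by rewrite ler_wpM2r ?ltW//; lra.
  apply: (@le_trans _ _ ((`|b| + C + 1) * (1 / (2 * (`|b| + C + 1)) * `|g' x|))).
    by rewrite ler_wpM2l//; lra.
  by rewrite le_eqVlt; apply/orP; left; apply/eqP; field; rewrite gt_eqF//; lra.
move=> h1 h2 h3 h4.
have h5 : - (`|g' x| / 2) <= s * g' x by lra.
rewrite ltNge; apply/negP => le0.
by rewrite ler0_norm// in h4; lra.
Qed.

(** Below the level [x0], the bound [|g1| <= e / 2 * (s * g0)] integrates against the nonnegative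
    kernel. All else is a multiple of [w x]: the parts of both integrals above [x0], where the
    kernel is at most [w x], and the terms in [b0] and [b1]. [K] collects these multiples, and
    [w = o(g0')] absorbs them into the other [e / 2]. *)
Lemma wlittleo_Hop (b0 b1 s : R) g0 g1 g0' g1' : `|s| = 1 ->
  wbounded g0 -> wbounded g1 -> wsign s g0 -> wlittleo g1 g0 ->
  (forall x, D x -> g0' x = - b0 * w x + Hop g0 x) ->
  (forall x, D x -> g1' x = - b1 * w x + Hop g1 x) ->
  wlittleo w g0' -> wlittleo g1' g0'.
Proof.
move=> s1 g0b g1b sg [_ go] g0'E g1'E [g0'0 wo]; split => // e e0.
have e20 : 0 < e / 2 by lra.
have [mg0 _] := g0b; have [mg1 _] := g1b.
have Iw0 := wbounded_wint g0b; have Iw1 := wbounded_wint g1b.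
have [x0 Dx0 Hx0] := wnear_and sg (go _ e20).
have I0 := wintegrable_norm (wintegrable_high Dx0 g0b).
have I1 := wintegrable_norm (wintegrable_high Dx0 g1b).
pose h t := `|whigh x0 t * g1 t| + e / 2 * `|whigh x0 t * g0 t|.
have Ih : wintegrable h by apply: wintegrableD => //; exact: wintegrableZ.
set C := wint h.
have C0 : 0 <= C by apply: wint_ge0 => t Dt; rewrite addr_ge0// mulr_ge0// ltW.
pose K := `|b1| + e / 2 * `|b0| + C.
have K0 : 0 <= K by rewrite /K !addr_ge0// mulr_ge0// ltW.
have p0 : 0 < e / (2 * (K + 1)) by rewrite divr_gt0// mulr_gt0//; lra.
apply: wnearS (wo _ p0) => x Dx wx.
have x_gt0 := w_gt0 Dx; rewrite (gtr0_norm x_gt0) in wx.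
have main : `|Hop g1 x| <= e / 2 * (s * Hop g0 x) + w x * C.
  have IH0 := wintegrable_Hker Dx mg0 Iw0.
  rewrite -(wintZ s)// -wintZ; last exact: wintegrableZ.
  rewrite -wintZ// -wintD; last 2 first.
  - by apply: wintegrableZ; exact: wintegrableZ.
  - exact: wintegrableZ.
  apply: wint_norm; first exact: wintegrable_Hker.
    apply: wintegrableD; last exact: wintegrableZ.
    by apply: wintegrableZ; exact: wintegrableZ.
  move=> t Dt; have k0 := Hker_ge0 Dx Dt; rewrite normrM (ger0_norm k0) /h /whigh.
  have kx : Num.min (w t) (w x) <= w x by rewrite ge_min lexx orbT.
  move: k0 kx; set k := Num.min _ _ => k0 kx.
  case: (leP (w t) (w x0)) => tx.
    have [sg0 gt] := Hx0 _ Dt tx.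
    rewrite !mul0r normr0 mulr0 addr0 mulr0 addr0.
    have -> : e / 2 * (s * (k * g0 t)) = k * (e / 2 * (s * g0 t)) by ring.
    rewrite ler_wpM2l//.
    by rewrite -(gtr0_norm sg0) normrM s1 mul1r.
  rewrite !mul1r.
  have : - (k * `|g0 t|) <= s * (k * g0 t).
    rewrite lerNl; apply: le_trans (ler_norm _) _.
    by rewrite normrN !normrM s1 mul1r (ger0_norm k0).
  move=> a1.
  have a2 : k * `|g1 t| <= w x * `|g1 t| by rewrite ler_wpM2r.
  have a3 : k * `|g0 t| <= w x * `|g0 t| by rewrite ler_wpM2r.
  have a4 : e / 2 * - (k * `|g0 t|) <= e / 2 * (s * (k * g0 t)) by rewrite ler_wpM2l// ltW.
  have a5 : e / 2 * (k * `|g0 t|) <= e / 2 * (w x * `|g0 t|) by rewrite ler_wpM2l// ltW.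
  have -> : w x * (`|g1 t| + e / 2 * `|g0 t|) = w x * `|g1 t| + e / 2 * (w x * `|g0 t|) by ring.
  lra.
have bound0 : s * Hop g0 x <= `|g0' x| + `|b0| * w x.
  have -> : Hop g0 x = g0' x + b0 * w x by rewrite g0'E//; ring.
  apply: le_trans (ler_norm _) _; rewrite normrM s1 mul1r.
  by apply: le_trans (ler_normD _ _) _; rewrite normrM (gtr0_norm x_gt0).
have bound1 : `|g1' x| <= `|b1| * w x + `|Hop g1 x|.
  by rewrite g1'E//; apply: le_trans (ler_normD _ _) _; rewrite normrM normrN (gtr0_norm x_gt0).
have Kw : K * w x <= e / 2 * `|g0' x|.
  apply: (@le_trans _ _ ((K + 1) * w x)); first by rewrite ler_wpM2r ?ltW//; lra.
  apply: (@le_trans _ _ ((K + 1) * (e / (2 * (K + 1)) * `|g0' x|))).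
    by rewrite ler_wpM2l//; lra.
  by rewrite le_eqVlt; apply/orP; left; apply/eqP; field; rewrite gt_eqF//; lra.
have a6 : e / 2 * (s * Hop g0 x) <= e / 2 * (`|g0' x| + `|b0| * w x).
  by rewrite ler_wpM2l// ltW.
apply: (le_trans bound1); apply: (@le_trans _ _ (e / 2 * `|g0' x| + K * w x)); last lra.
by apply: le_trans (lerD (lexx _) (le_trans main (lerD a6 (lexx _)))) _; rewrite /K; lra.
Qed.

(** * Mapping properties of [Top] *)

Lemma Top_bound g x : D x -> wintegrable g ->
  `|Top g x| <= w x * wint (fun t => wlow x t * `|g t|).
Proof.
move=> Dx Ig; have Il := wintegrable_low x (wintegrable_norm Ig).
rewrite -wintZ//; apply: wint_norm; [exact: wintegrable_Tker|exact: wintegrableZ|].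
move=> t Dt; have t0 := w_gt0 Dt; have x0 := w_gt0 Dx.
rewrite normrM mulrA; apply: ler_wpM2r => //; rewrite /wlow.
case: (leP (w t) (w x)) => tx.
  by rewrite min_l; [rewrite ler0_norm; lra|lra].
by rewrite min_r; [rewrite normr0; lra|lra].
Qed.

Lemma Top_littleo_w g : wintegrable g -> wlittleo (Top g) w.
Proof.
move=> Ig; split; first by exists c => // t Dt _; rewrite gt_eqF// w_gt0.
move=> e e0; apply: wnearS (wint_tail Ig e0) => x Dx h.
apply: (le_trans (Top_bound Dx Ig)).
by rewrite mulrC (gtr0_norm (w_gt0 Dx)) ler_wpM2r// ltW// w_gt0.
Qed.

Lemma TopE g x : D x -> wintegrable g -> Top g x = Hop g x - w x * wint g.
Proof.
move=> Dx Ig; have IH := wintegrable_Hker Dx Ig.1 (wintegrable_wM Ig).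
rewrite -wintZ// -wintB//; last exact: wintegrableZ.
apply: eq_wint => t Dt; rewrite -mulrBl; congr (_ * _).
by case: (leP (w t) (w x)) => h; [rewrite min_l//|rewrite min_r]; lra.
Qed.

Lemma measurable_Top g : wintegrable g -> measurable_fun D (Top g).
Proof.
move=> Ig.
have m1 : measurable_fun D (fun x => Hop g x - w x * wint g).
  apply: measurable_funB; first by apply: measurable_Hop; [exact: Ig.1|exact: wintegrable_wM].
  exact: measurable_funM.
by apply: eq_measurable_fun m1 => x /set_mem Dx; rewrite TopE.
Qed.

Lemma wintegrable_Top g : wintegrable g -> wintegrable (Top g).
Proof.
move=> Ig; apply: (@wintegrable_Ow (wint (fun t => `|g t|))); first exact: measurable_Top.
move=> x Dx; apply: le_trans (Top_bound Dx Ig) _; rewrite mulrC ler_wpM2r//.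
  by rewrite ltW// w_gt0.
apply: le_wint; [|exact: wintegrable_norm|].
  by apply: wintegrable_low; exact: wintegrable_norm.
move=> t Dt; rewrite /wlow; case: ifP; rewrite ?mul1r ?mul0r//.
Qed.

Lemma Tker_le0 x t : Num.min (w t - w x) 0 <= 0.
Proof. by rewrite ge_min lexx orbT. Qed.

(** The weak inequality is the sign of the kernel. For strictness: a zero integral would force the
    integrand to vanish almost everywhere, but it is nonzero on [w t < w x], which is not a null set
    by [mass]. *)
Lemma wsign_Top s g : wintegrable g -> wsign s g -> wsign (- s) (Top g).
Proof.
move=> Ig [x0 Dx0 sg]; exists x0 => // x Dx xx0.
pose k t := - s * (Num.min (w t - w x) 0 * g t).
have Ik : wintegrable k by apply: wintegrableZ; exact: wintegrable_Tker.
have k0 t : D t -> 0 <= k t.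
  move=> Dt; rewrite /k; case: (leP (w t) (w x)) => tx.
    have -> : - s * (Num.min (w t - w x) 0 * g t) = - Num.min (w t - w x) 0 * (s * g t) by ring.
    rewrite mulr_ge0 ?oppr_ge0 ?Tker_le0//.
    by apply/ltW/sg => //; exact: le_trans xx0.
  by rewrite min_r ?mul0r ?mulr0//; lra.
rewrite -wintZ; last exact: wintegrable_Tker.
rewrite lt_neqAle wint_ge0// andbT; apply/eqP => /esym kI0.
have mk : measurable_fun D (fun t => (k t * rho t)%:E) by exact: measurable_int Ik.2.
have : (\int[mu]_(t in D) `|(k t * rho t)%:E| = 0)%E.
  rewrite (eq_integral (fun t => (k t * rho t)%:E)).
    have := kI0; rewrite -/k /wint /Rintegral => /eqP.
    rewrite fine_eq0; first by move/eqP.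
    by apply: integrable_fin_num => //; exact: Ik.2.
  by move=> t /set_mem Dt; rewrite gee0_abs// lee_fin mulr_ge0// ?k0// ltW// rho_gt0.
move=> /(ae_eq_integral_abs mu mD mk) [A [mA A0 sA]].
apply: (mass Dx); apply: (subset_measure0 _ mA _ A0).
  rewrite [X in measurable X](_ : _ = D `&` w @^-1` `]-oo, w x[).
    by apply: mw => //.
  by apply/seteqP; split=> t /=; rewrite in_itv.
move=> t [Dt /= tx]; apply: sA => /= /(_ Dt) /eqP; rewrite eqe.
apply/negP; rewrite mulf_neq0 ?(gt_eqF (rho_gt0 Dt))// /k.
have := sg _ Dt (le_trans (ltW tx) xx0) => sgt.
rewrite min_l; last lra.
have -> : - s * ((w t - w x) * g t) = (w x - w t) * (s * g t) by ring.
by rewrite mulf_neq0// gt_eqF//; lra.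
Qed.

(** The kernel at [x] vanishes unless [w t < w x], so the pointwise bound near the endpoint
    integrates without remainder: in contrast to [Hop], no multiple of [w] has to be absorbed. *)
Lemma wlittleo_Top s g0 g1 : `|s| = 1 -> wintegrable g0 -> wintegrable g1 ->
  wsign s g0 -> wlittleo g1 g0 -> wlittleo (Top g1) (Top g0).
Proof.
move=> s1 I0 I1 sg [_ go]; split.
  apply: wnearS (wsign_Top I0 sg) => t _ h; apply/eqP => T0.
  by move: h; rewrite T0 mulr0 ltxx.
move=> e e0; have [x0 Dx0 Hx0] := wnear_and sg (go _ e0).
exists x0 => // x Dx xx0.
have IT0 := wintegrable_Tker Dx I0.
apply: (@le_trans _ _ (e * (- s * Top g0 x))); last first.
  rewrite ler_wpM2l ?(ltW e0)//; apply: le_trans (ler_norm _) _.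
  by rewrite normrM normrN s1 mul1r.
rewrite -wintZ// -wintZ; last exact: wintegrableZ.
apply: wint_norm; first exact: wintegrable_Tker.
  by apply: wintegrableZ; exact: wintegrableZ.
move=> t Dt; rewrite normrM (ler0_norm (Tker_le0 _ _)).
case: (leP (w t) (w x)) => tx; last by rewrite min_r; lra.
have [sg0 gt] := Hx0 _ Dt (le_trans tx xx0).
have -> : e * (- s * (Num.min (w t - w x) 0 * g0 t)) =
   - Num.min (w t - w x) 0 * (e * (s * g0 t)) by ring.
rewrite ler_wpM2l ?oppr_ge0 ?Tker_le0//.
by rewrite -(gtr0_norm sg0) normrM s1 mul1r.
Qed.

Lemma wlittleo_w_const a f : wlittleo f w ->
  wnear (fun x => f x = a * w x) -> a = 0.
Proof.
move=> [_ fo] fE; apply/eqP; rewrite -normr_le0; apply/ler_addgt0Pr => e e0.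
have [x Dx [h1 h2]] := wnear_witness (wnear_and (fo _ e0) fE).
rewrite add0r; move: h1; rewrite h2 normrM ler_pM2r//.
by rewrite normr_gt0 gt_eqF// w_gt0.
Qed.

Lemma wlittleoB f g h : wlittleo f h -> wlittleo g h -> wlittleo (fun t => f t - g t) h.
Proof.
move=> [h0 fo] [_ go]; split=> // e e0; have e20 : 0 < e / 2 by lra.
apply: wnearS (wnear_and (fo _ e20) (go _ e20)) => t Dt [a1 a2].
by apply: le_trans (ler_normB _ _) _; lra.
Qed.

(** By [TopE], [g'] is [Top g] plus a multiple of [w]; both [g'] and [Top g] are [o(w)], so the
    multiple is zero, that is, [b] is the integral of [g rho]. *)
Lemma Hop_littleo_w_Top b g g' : wintegrable g ->
  (forall x, D x -> g' x = - b * w x + Hop g x) -> wlittleo g' w ->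
  forall x, D x -> g' x = Top g x.
Proof.
move=> Ig g'E g'o.
have E x : D x -> g' x = (wint g - b) * w x + Top g x.
  by move=> Dx; rewrite g'E// TopE//; ring.
have c0 : wint g - b = 0.
  apply: (wlittleo_w_const (wlittleoB g'o (Top_littleo_w Ig))).
  by exists c => // x Dx _; rewrite E//; ring.
by move=> x Dx; rewrite E// c0 mul0r add0r.
Qed.

(** Monotone convergence along the exhaustion of [D] by the sets [F n] where [w > 1 / n.+1]: each of
    them lies above the level of some admissible [x], so it inherits the bound [C]. *)
Lemma wintegrable_of_bound k C : measurable_fun D k -> (forall t, D t -> 0 <= k t) ->
  (forall x, D x -> wintegrable (fun t => whigh x t * k t)) ->
  wnear (fun x => wint (fun t => whigh x t * k t) <= C) -> wintegrable k.
Proof.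
move=> mk k0 Ih [x0 Dx0 HC]; split=> //; apply/integrableP; split.
  by apply/measurable_EFinP/measurable_funM.
pose F n := D `&` [set t | n.+1%:R^-1 < w t].
have mF n : measurable (F n).
  rewrite [X in measurable X](_ : _ = D `&` w @^-1` `]n.+1%:R^-1, +oo[); first exact: mw.
  by apply/seteqP; split=> t /=; rewrite in_itv/= andbT.
have FD : \bigcup_n F n = D.
  apply/seteqP; split=> t; first by move=> [n _ []].
  move=> Dt; have [n _ /(_ n (leqnn n)) /= nt] := @near_infty_natSinv_lt R (PosNum (w_gt0 Dt)).
  by exists n.
have mkr : measurable_fun D (fun t => (k t * rho t)%:E).
  by apply/measurable_EFinP/measurable_funM.
have kr0 t : D t -> (0 <= (k t * rho t)%:E)%E.
  by move=> Dt; rewrite lee_fin mulr_ge0 ?k0// ltW// rho_gt0.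
rewrite (eq_integral (fun t => (k t * rho t)%:E)); last first.
  by move=> t /set_mem Dt; rewrite gee0_abs// kr0.
apply: (@le_lt_trans _ _ C%:E); last exact: ltry.
rewrite -[in leLHS]FD.
have ndF : nondecreasing_seq F.
  move=> m n mn; apply/subsetPset => t [Dt /= h]; split=> //=.
  by apply: le_lt_trans h; rewrite lef_pV2 ?posrE ?ltr0n// ler_nat ltnS.
have mkF n : measurable_fun (F n) (fun t => (k t * rho t)%:E).
  by apply: measurable_funS mkr => // t [].
have krF n t : F n t -> (0 <= (k t * rho t)%:E)%E by move=> [/kr0].
apply: (cvge_le _ (@ge0_nondecreasing_set_cvg_integral _ _ _ F _ mu ndF mF mkF krF)).
apply: nearW => n.
have [x [Dx xx0 xn]] : exists x, [/\ D x, w x <= w x0 & w x <= n.+1%:R^-1].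
  have [|y Dy yn] := @w_small n.+1%:R^-1; first by rewrite invr_gt0.
  have [h|h] := leP (w y) (w x0); first by exists y; split => //; exact: ltW.
  by exists x0; split => //; exact: ltW (lt_trans h yn).
have := HC x Dx xx0; rewrite -lee_fin /wint /Rintegral fineK; last first.
  by apply: integrable_fin_num => //; exact: (Ih x Dx).2.
apply: le_trans.
apply: (@le_trans _ _ (\int[mu]_(t in F n) (whigh x t * k t * rho t)%:E)%E).
  rewrite le_eqVlt; apply/orP; left; apply/eqP; apply: eq_integral => t /set_mem [Dt /= nt].
  by rewrite /whigh ifF ?mul1r//; apply/negbTE; rewrite -ltNge; exact: le_lt_trans nt.
apply: ge0_subset_integral => //; last by move=> t [].
  exact: measurable_int (Ih x Dx).2.
move=> t Dt; rewrite lee_fin mulr_ge0 ?(ltW (rho_gt0 Dt))// mulr_ge0 ?k0//.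
by rewrite /whigh; case: ifP.
Qed.

(** For [g] of constant sign, [|H g x|] controls, up to O(w x), [w x] times the integral of
    [|g| rho] between the levels of [x] and [x0]. If [g' = o(w)], this integral stays bounded as [x]
    approaches the endpoint. *)
Lemma wintegrable_Hop_littleo_w (b s : R) g g' : `|s| = 1 -> wbounded g -> wsign s g ->
  (forall x, D x -> g' x = - b * w x + Hop g x) -> wlittleo g' w -> wintegrable g.
Proof.
move=> s1 gb sg g'E [_ g'o]; have [mg [M HM]] := gb.
have [x0 Dx0 Hx0] := wnear_and sg (g'o _ ltr01).
apply: (wintegrable_low_eq Dx0 gb).
pose k t := wlow x0 t * `|g t|.
have mng := measurable_fun_normr mg.
have mk : measurable_fun D k by apply: measurable_funM => //; exact: measurable_wlow.
have kb : wbounded k.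
  split => //; exists M => t Dt; rewrite /k /wlow; case: ifP => _.
    by rewrite mul1r normr_id HM.
  by rewrite mul0r normr0; apply: le_trans (HM _ Dt).
have Iwg := wbounded_wint gb.
have Ih := wintegrable_norm (wintegrable_high Dx0 gb).
set C := wint (fun t => `|whigh x0 t * g t|) in Ih.
have k0 t : D t -> 0 <= k t by move=> _; rewrite /k /wlow; case: ifP; rewrite ?mul1r ?mul0r.
have : wintegrable k.
  (* After division by [w x]: 1 comes from [|g'| <= w], [|b|] from the term [- b * w], and [C] from
     the part of [Hop g] above [x0]. *)
  apply: (@wintegrable_of_bound k (1 + `|b| + C)) => //.
    by move=> x Dx; apply: wintegrable_high.
  exists x0 => // x Dx xx0; have x_gt0 := w_gt0 Dx.
  have Ihk := wintegrable_high Dx kb.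
  have IH := wintegrable_Hker Dx mg Iwg.
  rewrite -(ler_pM2l x_gt0) -wintZ//.
  have : wint (fun t => w x * (whigh x t * k t)) <= s * Hop g x + w x * C.
    rewrite -(wintZ s)// -wintZ// -wintD; [|exact: wintegrableZ|exact: wintegrableZ].
    apply: le_wint; [exact: wintegrableZ|by apply: wintegrableD; exact: wintegrableZ|].
    move=> t Dt; have kk0 := Hker_ge0 Dx Dt; rewrite /k /whigh /wlow.
    case: (leP (w t) (w x0)) => tx0.
      rewrite mul0r normr0 mulr0 addr0 mul1r.
      have [sgt _] := Hx0 _ Dt tx0.
      have gs : `|g t| = s * g t by rewrite -(gtr0_norm sgt) normrM s1 mul1r.
      case: (leP (w t) (w x)) => tx.
        by rewrite mul0r mulr0 mulrCA mulr_ge0// ltW// w_gt0.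
      by rewrite mul1r gs; lra.
    rewrite mul0r !mulr0 !mul1r.
    have : - (Num.min (w t) (w x) * `|g t|) <= s * (Num.min (w t) (w x) * g t).
      rewrite lerNl; apply: le_trans (ler_norm _) _.
      by rewrite normrN !normrM s1 mul1r (ger0_norm kk0).
    have : Num.min (w t) (w x) * `|g t| <= w x * `|g t|.
      by rewrite ler_wpM2r// ge_min lexx orbT.
    lra.
  move=> h; apply: (le_trans h).
  have : s * Hop g x <= `|g' x| + `|b| * w x.
    have -> : Hop g x = g' x + b * w x by rewrite g'E//; ring.
    apply: le_trans (ler_norm _) _; rewrite normrM s1 mul1r.
    by apply: le_trans (ler_normD _ _) _; rewrite normrM (gtr0_norm x_gt0).
  have [_] := Hx0 _ Dx xx0; rewrite (gtr0_norm x_gt0); lra.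
move=> Ik; apply: (wintegrable_le _ Ik).
  by apply: measurable_funM => //; exact: measurable_wlow.
move=> t Dt; rewrite /k normrM ler_wpM2r// /wlow.
by case: ifP; rewrite ?normr1 ?normr0.
Qed.

Lemma eq_wlittleo f g f' g' : (forall x, D x -> f x = f' x) ->
  (forall x, D x -> g x = g' x) -> wlittleo f g -> wlittleo f' g'.
Proof.
move=> ff gg [g0 fo]; split; first by apply: wnearS g0 => t Dt; rewrite gg.
by move=> e e0; apply: wnearS (fo e e0) => t Dt; rewrite ff// gg.
Qed.

Lemma eq_wsign s f g : (forall x, D x -> f x = g x) -> wsign s f -> wsign s g.
Proof. by move=> fg; apply: wnearS => t Dt; rewrite fg. Qed.

Lemma eq_wbounded f g : (forall x, D x -> f x = g x) -> wbounded f -> wbounded g.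
Proof.
move=> fg [mf [M HM]]; split.
  by apply: eq_measurable_fun mf => x /set_mem/fg.
by exists M => t Dt; rewrite -fg// HM.
Qed.

(** For two sequences of iterates of [Top] the relation at index 0 decides all others. It serves
    [phi_{n+1}] against [phi_n] and, past the index [l], [phi_k] against [theta_{l+k}], and
    [theta_{l+k+1}] against both [phi_k] and [theta_{l+k}]. *)
Lemma wlittleo_iter_Top s (P Q : nat -> T -> R) : `|s| = 1 ->
  wintegrable (P 0) -> wintegrable (Q 0) -> wsign s (Q 0) ->
  (forall n x, D x -> P n.+1 x = Top (P n) x) ->
  (forall n x, D x -> Q n.+1 x = Top (Q n) x) ->
  wlittleo (P 0) (Q 0) -> forall n, wlittleo (P n) (Q n).
Proof.
move=> s1 IP IQ sQ PE QE o0.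
(* [Top] reverses signs, so the sign of [Q n] alternates with [n]; hence the existential. *)
suff H n : [/\ wintegrable (P n), wintegrable (Q n), wlittleo (P n) (Q n) &
    exists2 s', `|s'| = 1 & wsign s' (Q n)] by move=> n; have [] := H n.
elim: n => [|n [IPn IQn on [s' s'1 sn]]]; first by split => //; exists s.
split.
- by apply: eq_wintegrable (wintegrable_Top IPn) => x Dx; rewrite PE.
- by apply: eq_wintegrable (wintegrable_Top IQn) => x Dx; rewrite QE.
- apply: eq_wlittleo (wlittleo_Top s'1 IQn IPn sn on).
    by move=> x Dx; rewrite PE.
  by move=> x Dx; rewrite QE.
- exists (- s'); first by rewrite normrN.
  by apply: eq_wsign (wsign_Top IQn sn) => x Dx; rewrite QE.
Qed.

(** * The chain of asymptotic relations between coefficients *)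

Section Chain.
Variables (A : R) (b : nat -> R) (Th Phi : nat -> T -> R).
Hypothesis A0 : A != 0.
Hypothesis Th0E : forall x, D x -> Th 0 x = A - b 0 * w x.
Hypothesis ThSE : forall n x, D x -> Th n.+1 x = - b n.+1 * w x + Hop (Th n) x.
Hypothesis Phi0E : forall x, D x -> Phi 0 x = w x.
Hypothesis PhiSE : forall n x, D x -> Phi n.+1 x = Top (Phi n) x.

Lemma wbounded_Th n : wbounded (Th n).
Proof.
elim: n => [|n IH].
  apply: (@eq_wbounded (fun x => - b 0 * w x + A)).
    by move=> x Dx; rewrite Th0E//; ring.
  apply: wboundedB_w; split => //; exists `|A| => //.
apply: eq_wbounded (wboundedB_w (b n.+1) (wbounded_Hop IH)) => x Dx.
by rewrite ThSE.
Qed.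

Lemma near_Th0 : wnear (fun t => `|A| / 2 <= Num.sg A * Th 0 t).
Proof.
have a0 : 0 < `|A| by rewrite normr_gt0.
have b0 := normr_ge0 (b 0).
have p0 : 0 < `|A| / (2 * (`|b 0| + 1)) by rewrite divr_gt0// mulr_gt0//; lra.
apply: wnearS (wnear_small p0) => t Dt wt; have t0 := w_gt0 Dt.
rewrite Th0E//.
have -> : Num.sg A * (A - b 0 * w t) = `|A| - Num.sg A * (b 0 * w t).
  by rewrite mulrBr -normrEsg.
have : Num.sg A * (b 0 * w t) <= `|b 0| * w t.
  apply: le_trans (ler_norm _) _; rewrite !normrM normr_sg A0 mul1r.
  by rewrite (gtr0_norm t0).
have : (`|b 0| + 1) * w t <= `|A| / 2.
  apply: (@le_trans _ _ ((`|b 0| + 1) * (`|A| / (2 * (`|b 0| + 1))))).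
    by rewrite ler_wpM2l//; lra.
  by rewrite le_eqVlt; apply/orP; left; apply/eqP; field; rewrite gt_eqF//; lra.
lra.
Qed.

Lemma wsign_Th0 : wsign (Num.sg A) (Th 0).
Proof.
apply: wnearS near_Th0 => t Dt; apply: lt_le_trans.
by rewrite divr_gt0// normr_gt0.
Qed.

(** [Th 0] tends to [A], which is not 0. This gives the start of the chain, for [w] and for
    [Th 1]. *)
Lemma wlittleo_of_small g : (forall e : R, 0 < e -> wnear (fun x => `|g x| <= e)) ->
  wlittleo g (Th 0).
Proof.
move=> gs; have a0 : 0 < `|A| by rewrite normr_gt0.
split.
  by apply: wnearS wsign_Th0 => t Dt h; apply/eqP => T0; rewrite T0 mulr0 ltxx in h.
move=> e e0; have p0 : 0 < e * (`|A| / 2) by rewrite mulr_gt0// divr_gt0.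
apply: wnearS (wnear_and (gs _ p0) near_Th0) => t Dt [h1 h2].
apply: (le_trans h1); rewrite ler_wpM2l ?(ltW e0)//; apply: (le_trans h2).
by apply: le_trans (ler_norm _) _; rewrite normrM normr_sg A0 mul1r.
Qed.

Lemma wlittleo_w_Th0 : wlittleo w (Th 0).
Proof.
apply: wlittleo_of_small => e e0; apply: wnearS (wnear_small e0) => t Dt.
by rewrite (gtr0_norm (w_gt0 Dt)).
Qed.

Lemma wlittleo_Th1_Th0 : wlittleo (Th 1) (Th 0).
Proof.
apply: wlittleo_of_small => e e0; have e20 : 0 < e / 2 by lra.
have b0 := normr_ge0 (b 1).
have p0 : 0 < e / 2 / (`|b 1| + 1) by rewrite divr_gt0//; lra.
apply: wnearS (wnear_and (wnear_small p0) (Hop_cvg0 (wbounded_Th 0) e20)) => t Dt [h1 h2].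
rewrite ThSE//; apply: le_trans (ler_normD _ _) _.
rewrite normrM normrN (gtr0_norm (w_gt0 Dt)).
have h3 : (`|b 1| + 1) * w t <= e / 2 by rewrite mulrC -ler_pdivlMr//; lra.
by have := w_gt0 Dt; lra.
Qed.

(** Sign and smallness are proved together: each step compares integrals of [Th k.+1] and [Th k],
    and the sign of [Th k] excludes cancellation. *)
Lemma wlittleo_Th_succ N : (forall n, (n <= N)%N -> wlittleo w (Th n)) ->
  forall k : nat, (k <= N)%N -> wsign (Num.sg A) (Th k) /\ wlittleo (Th k.+1) (Th k).
Proof.
move=> wo; have s1 : `|Num.sg A| = 1 by rewrite normr_sg A0.
elim=> [|k IH] kN; first by split; [exact: wsign_Th0|exact: wlittleo_Th1_Th0].
have [sk ok] := IH (ltnW kN).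
split; first exact: (wsign_Hop s1 (wbounded_Th k) sk (ThSE k) (wo _ kN)).
exact: (wlittleo_Hop s1 (wbounded_Th k) (wbounded_Th k.+1) sk ok (ThSE k) (ThSE k.+1) (wo _ kN)).
Qed.

Lemma wintegrable_Phi0 : wintegrable (Phi 0).
Proof. by apply: eq_wintegrable wintegrable_w => x Dx; rewrite Phi0E. Qed.

Lemma wsign_Phi0 : wsign 1 (Phi 0).
Proof. by exists c => // x Dx _; rewrite mul1r Phi0E// w_gt0. Qed.

Lemma wlittleo_Phi_succ n : wlittleo (Phi n.+1) (Phi n).
Proof.
apply: (@wlittleo_iter_Top 1 (fun n => Phi n.+1) Phi) => //; rewrite ?normr1//.
- apply: eq_wintegrable (wintegrable_Top wintegrable_Phi0) => x Dx.
  by rewrite PhiSE.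
- exact: wintegrable_Phi0.
- exact: wsign_Phi0.
- by move=> m x Dx; rewrite PhiSE.
- apply: eq_wlittleo (Top_littleo_w wintegrable_Phi0) => x Dx.
    by rewrite PhiSE.
  by rewrite Phi0E.
Qed.

(** [Th ell] is integrable against [rho] because it has constant sign and its successor is [o(w)].
    From there on [Top] produces integrable functions, and the normalization fixes the multiples of
    [w]. *)
Lemma Th_iter_Top ell : wlittleo w (Th ell) -> wsign (Num.sg A) (Th ell) ->
  (forall n, (ell < n)%N -> wlittleo (Th n) w) ->
  forall k : nat, wintegrable (Th (ell + k)%N) /\
    forall x, D x -> Th (ell + k).+1 x = Top (Th (ell + k)%N) x.
Proof.
move=> wo sg nat_o; have s1 : `|Num.sg A| = 1 by rewrite normr_sg A0.
have topE (k : nat) : wintegrable (Th (ell + k)%N) ->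
    forall x, D x -> Th (ell + k).+1 x = Top (Th (ell + k)%N) x.
  move=> Ik; apply: (Hop_littleo_w_Top Ik (ThSE (ell + k))).
  by apply: nat_o; rewrite ltnS leq_addr.
elim=> [|k [Ik Ek]].
  suff I0 : wintegrable (Th (ell + 0)%N) by split => //; exact: topE.
  rewrite addn0.
  exact: (wintegrable_Hop_littleo_w s1 (wbounded_Th ell) sg (ThSE ell) (nat_o _ (leqnn _))).
suff Ik1 : wintegrable (Th (ell + k.+1)%N) by split => //; exact: topE.
by rewrite addnS; apply: eq_wintegrable (wintegrable_Top Ik) => x Dx; rewrite Ek.
Qed.

Lemma natural_chain :
  (forall ell, (forall n, (n <= ell)%N -> wlittleo w (Th n)) ->
     ~ wlittleo w (Th ell.+1) -> forall n, (ell < n)%N -> wlittleo (Th n) w) ->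
  (forall k : nat, wlittleo (Phi k.+1) (Phi k) /\ wlittleo (Th k.+1) (Th k)) /\
  (forall ell, (forall n, (n <= ell)%N -> wlittleo w (Th n)) ->
     ~ wlittleo w (Th ell.+1) -> forall k : nat,
     wlittleo (Phi k) (Th (ell + k)%N) /\ wlittleo (Th (ell + k).+1) (Phi k)).
Proof.
move=> nat_o; have s1 : `|Num.sg A| = 1 by rewrite normr_sg A0.
have IP0 := wintegrable_Phi0; have sP0 := wsign_Phi0.
have eo f : wlittleo f w -> wlittleo f (Phi 0).
  by apply: eq_wlittleo => x Dx //; rewrite Phi0E.
have oe f : wlittleo w f -> wlittleo (Phi 0) f.
  by apply: eq_wlittleo => x Dx //; rewrite Phi0E.
have fin ell : (forall n, (n <= ell)%N -> wlittleo w (Th n)) ->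
     ~ wlittleo w (Th ell.+1) -> forall k : nat,
     [/\ wlittleo (Phi k) (Th (ell + k)%N), wlittleo (Th (ell + k).+1) (Phi k) &
         wlittleo (Th (ell + k).+1) (Th (ell + k)%N)].
  move=> wo nwo; have no := nat_o _ wo nwo.
  have [sl ol] := wlittleo_Th_succ wo (leqnn ell).
  have H := Th_iter_Top (wo _ (leqnn _)) sl no.
  have sl0 : wsign (Num.sg A) (Th (ell + 0)%N) by rewrite addn0.
  have HS (k : nat) x : D x -> Th (ell + k.+1)%N x = Top (Th (ell + k)%N) x.
    by move=> Dx; rewrite addnS; apply: (H k).2.
  have HSS (k : nat) x : D x -> Th (ell + k.+1).+1 x = Top (Th (ell + k).+1) x.
    by move=> Dx; rewrite (H k.+1).2// addnS.
  have I1 : wintegrable (Th (ell + 0).+1) by rewrite -addnS; exact: (H 1%N).1.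
  move=> k; split.
  - apply: (@wlittleo_iter_Top (Num.sg A) Phi (fun k : nat => Th (ell + k)%N)) => //.
      exact: (H 0%N).1.
    by apply: oe; rewrite addn0; exact: wo.
  - apply: (@wlittleo_iter_Top 1 (fun k : nat => Th (ell + k).+1) Phi) => //.
      exact: normr1.
    by apply: eo; apply: no; rewrite addn0.
  - apply: (@wlittleo_iter_Top (Num.sg A) (fun k : nat => Th (ell + k).+1) (fun k : nat => Th (ell + k)%N)) => //.
      exact: (H 0%N).1.
    by rewrite addn0.
split; last by move=> ell wo nwo k; have [] := fin ell wo nwo k.
move=> k; split; first exact: wlittleo_Phi_succ.
(* With a finite index, [k <= ell] is covered by the chain for [Hop] and [k > ell] by the last
   relation in [fin], shifted by [ell]. *)
have [[ell [wo nwo]]|noell] := pselect (exists ell,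
    (forall n, (n <= ell)%N -> wlittleo w (Th n)) /\ ~ wlittleo w (Th ell.+1)).
  have [kl|lk] := leqP k ell; first by have [] := wlittleo_Th_succ wo kl.
  have [_ _] := fin ell wo nwo (k - ell)%N.
  by rewrite subnKC// ltnW.
(* Without a finite index [w = o(Th n)] for every [n]: a first failure at [N.+1] would make [N] the
   index. *)
have wo N n : (n <= N)%N -> wlittleo w (Th n).
  elim: N n => [|N IH] n; first by rewrite leqn0 => /eqP->; exact: wlittleo_w_Th0.
  rewrite leq_eqVlt => /orP[/eqP->|]; last by rewrite ltnS; exact: IH.
  by apply: contrapT => h; apply: noell; exists N.
by have [] := wlittleo_Th_succ (wo k) (leqnn k).
Qed.

End Chain.

(** For the quotient [u / v], the indicator of the closed interval [[x, c]] of the Lagrange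
    identity; [whigh] omits the level of [x] itself. *)
Definition wup (x t : T) : R := if w x <= w t then 1 else 0.

Lemma measurable_wup x : measurable_fun D (wup x).
Proof. by apply: measurable_fun_if => //; exact: measurable_fun_ler. Qed.

Lemma wup_bound x M g t : (forall t, D t -> w x <= w t -> `|g t| <= M) -> D t ->
  `|wup x t * g t| <= Num.max M 0.
Proof.
move=> HM Dt; rewrite /wup; case: ifP => tx.
  by rewrite mul1r le_max HM.
by rewrite mul0r normr0 le_max lexx orbT.
Qed.

Lemma wintegrable_wup x g M : D x -> measurable_fun D g ->
  (forall t, D t -> w x <= w t -> `|g t| <= M) ->
  wintegrable (fun t => wup x t * g t).
Proof.
move=> Dx mg HM; have x0 := w_gt0 Dx.
have m0 : 0 <= Num.max M 0 by rewrite le_max lexx orbT.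
apply: (@wintegrable_Ow (Num.max M 0 / w x)).
  by apply: measurable_funM => //; exact: measurable_wup.
move=> t Dt; have t0 := w_gt0 Dt.
have [tx|tx] := leP (w x) (w t); last first.
  by rewrite /wup [w x <= w t]leNgt tx /= mul0r normr0 mulr_ge0 ?divr_ge0// ltW.
apply: le_trans (wup_bound HM Dt) _.
by rewrite mulrAC ler_pdivlMr// ler_wpM2l.
Qed.

Lemma wintegrable_wupM x g : D x -> wintegrable g -> wintegrable (fun t => wup x t * g t).
Proof.
move=> Dx Ig; apply: (wintegrable_le _ (wintegrable_norm Ig)).
  by apply: measurable_funM => //; [exact: measurable_wup|exact: Ig.1].
move=> t Dt; rewrite /wup; case: ifP => _; first by rewrite mul1r.
by rewrite mul0r normr0.
Qed.

Lemma wint_sub_wup g x : D x -> wintegrable g ->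
  `|wint g - wint (fun t => wup x t * g t)| <= wint (fun t => wlow x t * `|g t|).
Proof.
move=> Dx Ig; have Iu := wintegrable_wupM Dx Ig.
rewrite -wintB//; apply: wint_norm; first exact: wintegrableB.
  by apply: wintegrable_low; exact: wintegrable_norm.
move=> t Dt; rewrite /wup /wlow; case: (ltgtP (w t) (w x)) => h;
  by rewrite ?mul1r ?mul0r ?subr0 ?subrr ?normr0.
Qed.

(** * The Volterra equation with base point [c] *)

Section Volterra.
Variables (al be eps : R) (g : T -> R).
Hypothesis mg : measurable_fun D g.
Hypothesis gE : forall x, D x ->
  g x = al - be * w x - eps * wint (fun t => wup x t * ((w t - w x) * g t)).

(** On the set [w >= w x] some bound exists to begin with. The kernel is at most [w t] and
    [|eps| * kappa <= 1 / 2], so any bound [M] there improves to [|al| + |be| * w c + M / 2]. The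
    bound that results is independent of [x]. *)
Lemma volterra_bound : `|eps| * kappa <= 1 / 2 ->
  (forall x, D x -> exists M, forall t, D t -> w x <= w t -> `|g t| <= M) ->
  forall t, D t -> `|g t| <= 2 * (`|al| + `|be| * w c).
Proof.
move=> ek gloc x Dx.
have [M HM] := gloc x Dx.
apply: (@sup_halving R T [set t | D t /\ w x <= w t] g _ M _ _ x) => //.
  by move=> t [Dt xt]; exact: HM.
move=> {M HM} M HM y [Dy xy]; have y0 := w_gt0 Dy.
have M0 : 0 <= M by apply: le_trans (HM x _); [exact: normr_ge0|].
rewrite gE//; apply: le_trans (ler_normB _ _) _; apply: lerD.
  apply: le_trans (ler_normB _ _) _; apply: lerD => //.
  by rewrite normrM (gtr0_norm y0) ler_wpM2l// w_lec.
have mk : measurable_fun D (fun t => wup y t * ((w t - w y) * g t)).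
  apply: measurable_funM; first exact: measurable_wup.
  by apply: measurable_funM => //; exact: measurable_funB.
have kM t : D t -> `|wup y t * ((w t - w y) * g t)| <= M * w t.
  move=> Dt; have t0 := w_gt0 Dt; rewrite /wup; case: ifP => yt; last first.
    by rewrite mul0r normr0 mulr_ge0// ltW.
  rewrite mul1r normrM mulrC; apply: ler_pM => //.
    by apply: HM; split => //; exact: le_trans xy yt.
  by rewrite ger0_norm; lra.
have Ik := wintegrable_Ow mk kM.
have : `|wint (fun t => wup y t * ((w t - w y) * g t))| <= M * kappa.
  rewrite -wintZ//; apply: wint_norm => //; exact: wintegrableZ.
move=> h; rewrite normrM; apply: le_trans (ler_wpM2l _ h) _ => //.
have -> : `|eps| * (M * kappa) = M * (`|eps| * kappa) by ring.
by rewrite -[M / 2]mulr1 -mulrA; apply: ler_wpM2l => //; rewrite mulr1; lra.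
Qed.

(** The kernel, the positive part of [w t - w x], is [w t - min (w t) (w x)]. As [g] is bounded, the
    integral of [w g rho] over all of [D] splits off into the constant term. *)
Lemma volterra_Hop : wbounded g -> forall x, D x ->
  g x = (al - eps * wint (fun t => w t * g t)) - be * w x + eps * Hop g x.
Proof.
move=> gb x Dx; have Iwg := wbounded_wint gb; have [_ [M HM]] := gb.
have IH := wintegrable_Hker Dx mg Iwg.
have e : wint (fun t => wup x t * ((w t - w x) * g t)) = wint (fun t => w t * g t) - Hop g x.
  rewrite -wintB//; apply: eq_wint => t Dt; rewrite -mulrBl mulrA; congr (_ * _).
  rewrite /wup; case: (leP (w x) (w t)) => h; first by rewrite mul1r.
  by rewrite mul0r subrr.
by rewrite {1}gE// e; ring.
Qed.

End Volterra.

Lemma small_const_eq0 (a C : R) : (forall de : R, 0 < de -> de <= 1 -> `|a| <= C * de) -> a = 0.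
Proof.
move=> H; apply/eqP; rewrite -normr_le0; apply/ler_addgt0Pr => e e0; rewrite add0r.
have C0 : 0 <= C by have := H 1 ltr01 (lexx _); rewrite mulr1; apply: le_trans.
pose de := Num.min 1 (e / (C + 1)).
have d0 : 0 < de by rewrite lt_min ltr01 divr_gt0//; lra.
have d1 : de <= 1 by rewrite ge_min lexx.
have d2 : de * (C + 1) <= e by rewrite -ler_pdivlMr ?ge_min ?lexx ?orbT//; lra.
have := H de d0 d1; have : C * de + de = de * (C + 1) by ring.
lra.
Qed.

(* With theta = v g and phi = v h, the hypotheses on Wg, Vg, Wh, Vh say that these are
   the Wronskians of theta, phi with u and v; the last one is W(theta, phi) = 1. *)
Lemma wronskian_at_endpoint (al be al' be' eps K cst : R) (g h Wg Vg Wh Vh : T -> R) :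
  wbounded g -> measurable_fun D h -> 0 <= K ->
  (forall x, D x -> `|h x| <= K * w x) ->
  wlittleo (fun x => h x - cst * w x) w ->
  (forall x, D x -> Wg x = al - eps * wint (fun t => wup x t * (w t * g t))) ->
  (forall x, D x -> Vg x = be - eps * wint (fun t => wup x t * g t)) ->
  (forall x, D x -> Wh x = al' - eps * wint (fun t => wup x t * (w t * h t))) ->
  (forall x, D x -> Vh x = be' - eps * wint (fun t => wup x t * h t)) ->
  (forall x, D x -> h x = Wh x - w x * Vh x) ->
  (forall x, D x -> Wh x * Vg x - Wg x * Vh x = 1) ->
  (al - eps * wint (fun t => w t * g t)) * cst = 1.
Proof.
move=> gb mh K0 hK ho WgE VgE WhE VhE hE W1.
have [mg [M0 HM0]] := gb.
have [M M_ge0 HM] : exists2 M, 0 <= M & forall t, D t -> `|g t| <= M.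
  by exists `|M0| => // t Dt; apply: le_trans (HM0 t Dt) (ler_norm _).
have Iwg := wbounded_wint gb.
have Ih := wintegrable_Ow mh hK.
have Iwh := wintegrable_wM Ih.
pose A := al - eps * wint (fun t => w t * g t).
pose A' := al' - eps * wint (fun t => w t * h t).
have e0 := normr_ge0 eps; have b0 := normr_ge0 be; have c0 := normr_ge0 cst.
have bA := normr_ge0 A; have b0' := normr_ge0 be'.
have kap0 := wint_w_ge0.
have WgA x : D x -> `|Wg x - A| <= `|eps| * wint (fun t => wlow x t * `|w t * g t|).
  move=> Dx; rewrite WgE// /A.
  have -> : al - eps * wint (fun t => wup x t * (w t * g t)) -
     (al - eps * wint (fun t => w t * g t)) =
     eps * (wint (fun t => w t * g t) - wint (fun t => wup x t * (w t * g t))) by ring.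
  by rewrite normrM ler_wpM2l//; exact: wint_sub_wup.
(* Since [h = O(w)], this error carries an additional factor [w x]; once [A' = 0] is known,
   [Wh = o(w)] follows. *)
have WhA x : D x -> `|Wh x - A'| <= `|eps| * K * w x * wint (fun t => wlow x t * `|w t|).
  move=> Dx; rewrite WhE// /A'; have x0 := w_gt0 Dx.
  have -> : al' - eps * wint (fun t => wup x t * (w t * h t)) -
     (al' - eps * wint (fun t => w t * h t)) =
     eps * (wint (fun t => w t * h t) - wint (fun t => wup x t * (w t * h t))) by ring.
  rewrite normrM -!mulrA ler_wpM2l//.
  apply: le_trans (wint_sub_wup Dx Iwh) _.
  have Il := wintegrable_low x (wintegrable_norm wintegrable_w).
  rewrite -(wintZ (w x))// -wintZ; last exact: wintegrableZ.
  apply: le_wint.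
  - by apply: wintegrable_low; exact: wintegrable_norm.
  - by apply: wintegrableZ; exact: wintegrableZ.
  - move=> t Dt; have t0 := w_gt0 Dt; rewrite /wlow; case: ifP => tx; last first.
      by rewrite !mul0r !mulr0.
    rewrite !mul1r normrM (gtr0_norm t0).
    have -> : K * (w x * w t) = w t * (K * w x) by ring.
    rewrite ler_wpM2l ?(ltW t0)//; apply: le_trans (hK _ Dt) _.
    by rewrite ler_wpM2l.
have Vhb x : D x -> `|w x * Vh x| <= (`|be'| + `|eps| * (K * kappa)) * w x.
  move=> Dx; have x0 := w_gt0 Dx.
  rewrite normrM (gtr0_norm x0) mulrC ler_wpM2r ?(ltW x0)// VhE//.
  apply: le_trans (ler_normB _ _) _; rewrite lerD2l normrM ler_wpM2l//.
  rewrite -wintZ//; apply: wint_norm; [exact: wintegrable_wupM|exact: wintegrableZ|].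
  move=> t Dt; rewrite /wup; case: ifP => _; first by rewrite mul1r hK.
  by rewrite mul0r normr0 mulr_ge0// ltW// w_gt0.
have Vgb x : D x -> w x * `|Vg x| <= `|be| * w c + `|eps| * (M * kappa).
  move=> Dx; have x0 := w_gt0 Dx; rewrite VgE//.
  apply: (@le_trans _ _ (w x * (`|be| + `|eps| * `|wint (fun t => wup x t * g t)|))).
    by rewrite ler_wpM2l ?(ltW x0)//; apply: le_trans (ler_normB _ _) _; rewrite normrM.
  rewrite mulrDr; apply: lerD; first by rewrite mulrC ler_wpM2l// w_lec.
  rewrite mulrCA ler_wpM2l//.
  have Iu : wintegrable (fun t => wup x t * g t).
    by apply: (wintegrable_wup Dx mg) => t Dt _; exact: HM.
  rewrite -{1}(gtr0_norm x0) -normrM -wintZ// -wintZ//; apply: wint_norm.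
  - exact: wintegrableZ.
  - exact: wintegrableZ.
  - move=> t Dt; have t0 := w_gt0 Dt; rewrite normrM (gtr0_norm x0) /wup.
    case: ifP => xt; last by rewrite mul0r normr0 mulr0 mulr_ge0// ltW.
    rewrite mul1r mulrC; apply: ler_pM => //; [exact: ltW|exact: HM].
pose L := `|be| * w c + `|eps| * (M * kappa).
(* [A'] is the limit of [Wh] at the endpoint, and [Wh = h + w * Vh] with both terms O(w). *)
have A'0 : A' = 0.
  pose C := K + (`|be'| + `|eps| * (K * kappa)) + `|eps| * K.
  apply: (@small_const_eq0 A' C) => de de0 de1.
  have [x Dx [wx lx]] := wnear_witness
    (wnear_and (wnear_small de0) (wint_tail wintegrable_w de0)).
  have x0 := w_gt0 Dx.
  have -> : A' = h x + w x * Vh x - (Wh x - A') by rewrite hE//; ring.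
  apply: le_trans (ler_normB _ _) _.
  have h1 := ler_normD (h x) (w x * Vh x).
  have h2 := hK _ Dx; have h3 := Vhb _ Dx; have h4 := WhA _ Dx.
  have h5 : K * w x <= K * de by rewrite ler_wpM2l.
  have h6 : (`|be'| + `|eps| * (K * kappa)) * w x <= (`|be'| + `|eps| * (K * kappa)) * de.
    by rewrite ler_wpM2l// addr_ge0// mulr_ge0// mulr_ge0.
  have h7 : `|eps| * K * w x * wint (fun t => wlow x t * `|w t|) <= `|eps| * K * de.
    rewrite -[leRHS]mulr1; apply: ler_pM => //.
    - by rewrite mulr_ge0 ?(ltW x0)// mulr_ge0.
    - by apply: wint_ge0 => t _; rewrite mulr_ge0// /wlow; case: ifP.
    - by rewrite ler_wpM2l// mulr_ge0.
    - exact: le_trans lx de1.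
  rewrite /C !mulrDl; rewrite !mulrDl in h6 h3; lra.
apply/eqP; rewrite -subr_eq0; apply/eqP.
pose C := `|eps| * K * L + (`|cst| + (`|eps| * K + 1)) + `|A| * (`|eps| * K + 1).
apply: (@small_const_eq0 _ C) => de de0 de1.
have de' : 0 < de / (`|eps| + 1) by rewrite divr_gt0//; lra.
have [x Dx [[lx lgx] hox]] := wnear_witness (wnear_and
  (wnear_and (wint_tail wintegrable_w de0) (wint_tail Iwg de')) (ho.2 _ de0)).
have x0 := w_gt0 Dx.
have W1x := WgA _ Dx; have W2x := WhA _ Dx; rewrite A'0 subr0 in W2x.
have lx0 : 0 <= wint (fun t => wlow x t * `|w t|).
  by apply: wint_ge0 => t _; rewrite mulr_ge0// /wlow; case: ifP.
have W1d : `|Wg x - A| <= de.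
  apply: (le_trans W1x); apply: (@le_trans _ _ (`|eps| * (de / (`|eps| + 1)))).
    by rewrite ler_wpM2l.
  by rewrite mulrA ler_pdivrMr; [nra|lra].
have W2d : `|Wh x| <= `|eps| * K * de * w x.
  apply: (le_trans W2x); rewrite mulrAC ler_wpM2r ?(ltW x0)// ler_wpM2l//.
  exact: mulr_ge0.
(* [Vh = (Wh - h) / w] tends to [- cst], as [Wh = o(w)] and [h / w] tends to [cst]. *)
have Vhc : `|Vh x + cst| <= (`|eps| * K + 1) * de.
  have -> : Vh x + cst = (Wh x - (h x - cst * w x)) / w x.
    by rewrite hE//; field; rewrite gt_eqF.
  rewrite normrM normfV (gtr0_norm x0) ler_pdivrMr//.
  apply: le_trans (ler_normB _ _) _.
  by rewrite (gtr0_norm x0) in hox; lra.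
(* Only [w * Vg] is known to be bounded, but [Wh = o(w)]. So the product tends to 0, and
   [- Wg * Vh], with limit [A * cst], survives alone in the Wronskian identity. *)
have WhVg : `|Wh x * Vg x| <= `|eps| * K * L * de.
  rewrite normrM; apply: (@le_trans _ _ (`|eps| * K * de * w x * `|Vg x|)).
    by rewrite ler_wpM2r.
  rewrite -mulrA.
  have -> : `|eps| * K * L * de = `|eps| * K * de * L by ring.
  rewrite ler_wpM2l//; first by rewrite !mulr_ge0// ltW.
  exact: Vgb.
have -> : A * cst - 1 = - (Wh x * Vg x) + ((Wg x - A) * Vh x + A * (Vh x + cst)).
  by have := W1 _ Dx; rewrite -/A; lra.
have cVh : `|Vh x| <= `|cst| + (`|eps| * K + 1) * de.
  have -> : Vh x = - cst + (Vh x + cst) by ring.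
  by apply: le_trans (ler_normD _ _) _; rewrite normrN lerD2l.
have eK : 0 <= `|eps| * K by exact: mulr_ge0.
have t1 : `|(Wg x - A) * Vh x| <= de * (`|cst| + (`|eps| * K + 1)).
  rewrite normrM; apply: ler_pM => //; apply: (le_trans cVh).
  by rewrite lerD2l -[leRHS]mulr1 ler_wpM2l//; lra.
have t2 : `|A * (Vh x + cst)| <= `|A| * ((`|eps| * K + 1) * de).
  by rewrite normrM ler_wpM2l.
apply: le_trans (ler_normD _ _) _; rewrite normrN.
have t3 := ler_normD ((Wg x - A) * Vh x) (A * (Vh x + cst)).
have -> : C * de = `|eps| * K * L * de + (de * (`|cst| + (`|eps| * K + 1))
   + `|A| * ((`|eps| * K + 1) * de)) by rewrite /C; ring.
by apply: lerD => //; apply: le_trans t3 _; exact: lerD.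
Qed.

(** * The power series of phi near the endpoint *)

Definition tailw x : R := wint (fun t => wlow x t * `|w t|).

Lemma tailw_ge0 x : 0 <= tailw x.
Proof. by apply: wint_ge0 => t _; rewrite mulr_ge0// /wlow; case: ifP. Qed.

Lemma tailw_mono x y : w x <= w y -> tailw x <= tailw y.
Proof.
move=> xy; have I1 := wintegrable_norm wintegrable_w.
apply: le_wint; [exact: wintegrable_low|exact: wintegrable_low|].
move=> t Dt; rewrite ler_wpM2r// /wlow; case: ifP => tx; last by case: ifP.
by rewrite ifT//; exact: le_trans tx xy.
Qed.

Lemma tailw_le x : tailw x <= kappa.
Proof.
have I1 := wintegrable_norm wintegrable_w.
apply: le_wint; [exact: wintegrable_low|exact: wintegrable_w|].
move=> t Dt; rewrite (gtr0_norm (w_gt0 Dt)) /wlow; case: ifP => _; first by rewrite mul1r.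
by rewrite mul0r ltW// w_gt0.
Qed.

Section PhiSeries.
Variables (Phi : nat -> T -> R).
Hypothesis Phi0E : forall x, D x -> Phi 0 x = w x.
Hypothesis PhiSE : forall n x, D x -> Phi n.+1 x = Top (Phi n) x.

Lemma wintegrable_Phi n : wintegrable (Phi n).
Proof.
elim: n => [|n IH]; first exact: wintegrable_Phi0.
by apply: eq_wintegrable (wintegrable_Top IH) => x Dx; rewrite PhiSE.
Qed.

(** [Top] at [x] sees only [w t <= w x], with a kernel of size at most [w x]; as [tailw] is
    monotone, each iteration contributes one factor [tailw x]. *)
Lemma Phi_bound n x : D x -> `|Phi n x| <= w x * tailw x ^+ n.
Proof.
elim: n x => [|n IH] x Dx; first by rewrite expr0 mulr1 Phi0E// (gtr0_norm (w_gt0 Dx)).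
rewrite PhiSE//; apply: le_trans (Top_bound Dx (wintegrable_Phi n)) _.
have x0 := w_gt0 Dx; have I1 := wintegrable_norm wintegrable_w.
have Il := wintegrable_low x I1.
rewrite ler_wpM2l ?(ltW x0)// exprS mulrC {2}/tailw -wintZ//.
apply: le_wint; [|exact: wintegrableZ|].
  by apply: wintegrable_low; apply: wintegrable_norm; exact: wintegrable_Phi.
move=> t Dt; rewrite /wlow; case: ifP => tx; last by rewrite !mul0r mulr0.
rewrite !mul1r; apply: le_trans (IH _ Dt) _.
rewrite (gtr0_norm (w_gt0 Dt)) mulrC ler_wpM2r ?(ltW (w_gt0 Dt))//.
by rewrite lerXn2r ?nnegrE ?tailw_ge0// tailw_mono.
Qed.

Variables (cst eps : R) (h : T -> R).
Hypothesis eps_small : `|eps| * kappa <= 1 / 2.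
Hypothesis h_series : forall x, D x ->
  (fun N : nat => \sum_(k < N) cst * Phi k x * eps ^+ k) @ \oo --> h x.

(** The terms with [k >= 1] are dominated by a geometric series of ratio [|eps| * tailw x <= 1 / 2].
    The factor [tailw x] is kept because its limit 0 later turns the bound into [o(w)]. *)
Lemma phi_series_bound x : D x ->
  `|h x - cst * w x| <= `|cst| * w x * (2 * (`|eps| * tailw x)).
Proof.
move=> Dx; have x0 := w_gt0 Dx; have e0 := normr_ge0 eps.
have t0 := tailw_ge0 x; set y := `|eps| * tailw x.
have y0 : 0 <= y by exact: mulr_ge0.
have y1 : y <= 1 / 2 by apply: le_trans eps_small; rewrite ler_wpM2l// tailw_le.
have cvh : (fun N : nat => `|\sum_(k < N) cst * Phi k x * eps ^+ k - cst * w x|) @ \oo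
    --> `|h x - cst * w x|.
  by apply: cvg_norm; apply: cvgB; [exact: h_series|exact: cvg_cst].
apply: (cvgr_to_le cvh); near=> N.
have : (0 < N)%N by near: N; exact: nbhs_infty_gt.
case: (N : nat) => [//|m] _.
rewrite big_ord_recl expr0 mulr1 Phi0E// addrAC subrr add0r.
apply: le_trans (ler_norm_sum _ _ _) _.
apply: (@le_trans _ _ (\sum_(j < m) `|cst| * w x * y * y ^+ j)).
  apply: ler_sum => j _; rewrite lift0 !normrM normrX.
  have -> : `|cst| * w x * y * y ^+ j = `|cst| * (w x * tailw x ^+ j.+1) * `|eps| ^+ j.+1.
    by rewrite -(mulrA (`|cst| * w x)) -exprS /y exprMn; ring.
  by rewrite ler_wpM2r ?exprn_ge0// ler_wpM2l// Phi_bound.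
rewrite -mulr_sumr.
have -> : `|cst| * w x * (2 * y) = `|cst| * w x * y * 2 by ring.
rewrite ler_wpM2l ?sum_pow_le2// mulr_ge0// mulr_ge0// ltW//.
Unshelve. all: by end_near. Qed.

Lemma phi_series_Ow x : D x -> `|h x| <= 2 * `|cst| * w x.
Proof.
move=> Dx; have x0 := w_gt0 Dx; have c0 := normr_ge0 cst.
have -> : h x = (h x - cst * w x) + cst * w x by ring.
apply: le_trans (ler_normD _ _) _; rewrite [X in _ + X]normrM (gtr0_norm x0).
have := phi_series_bound Dx.
have : `|cst| * w x * (2 * (`|eps| * tailw x)) <= `|cst| * w x * 1.
  rewrite ler_wpM2l; [by []|by rewrite mulr_ge0// ltW|].
  have : `|eps| * tailw x <= 1 / 2.
    by apply: le_trans eps_small; rewrite ler_wpM2l// tailw_le.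
  lra.
lra.
Qed.

Lemma phi_series_littleo : wlittleo (fun x => h x - cst * w x) w.
Proof.
split; first by exists c => // t Dt _; rewrite gt_eqF// w_gt0.
move=> e e0; have K0 : 0 <= `|cst| * 2 * `|eps| by rewrite !mulr_ge0.
have p0 : 0 < e / (`|cst| * 2 * `|eps| + 1) by rewrite divr_gt0//; lra.
apply: wnearS (wint_tail wintegrable_w p0) => x Dx lx; have x0 := w_gt0 Dx.
apply: le_trans (phi_series_bound Dx) _; rewrite (gtr0_norm x0).
have -> : `|cst| * w x * (2 * (`|eps| * tailw x)) = (`|cst| * 2 * `|eps|) * tailw x * w x by ring.
rewrite ler_wpM2r ?(ltW x0)//.
have t0 := tailw_ge0 x.
apply: (@le_trans _ _ ((`|cst| * 2 * `|eps| + 1) * tailw x)); first by rewrite ler_wpM2r//; lra.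
by rewrite mulrC -ler_pdivlMr//; lra.
Qed.

End PhiSeries.

(** * The recursion for the coefficients of theta *)

Section Coefficients.
Variables (A eps0 : R) (th : R -> T -> R) (B : R -> R) (a : nat -> T -> R).
Hypothesis eps0_gt0 : 0 < eps0.
Hypothesis th_b : forall e, 0 < e -> e <= eps0 -> wbounded (th e).
Hypothesis thE : forall e x, 0 < e -> e <= eps0 -> D x ->
  th e x = A - B e * w x + e * Hop (th e) x.
Hypothesis th_series : forall e x, 0 < e -> e <= eps0 -> D x ->
  (fun N : nat => \sum_(k < N) a k x * e ^+ k) @ \oo --> th e x.

(* [hat] solves the recursion to be proved for [a], with the constants [hatb] fitted at
   the single point c; [hatrem N e] is then O(e^N) uniformly on D, whence [a = hat]. *)
Fixpoint hat (n : nat) : T -> R :=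
  match n with
  | 0 => fun x => A - (A - a 0 c) / w c * w x
  | n'.+1 => fun x => - ((Hop (hat n') c - a n'.+1 c) / w c) * w x + Hop (hat n') x
  end.

Definition hatb (n : nat) : R :=
  match n with
  | 0 => (A - a 0 c) / w c
  | n'.+1 => (Hop (hat n') c - a n'.+1 c) / w c
  end.

Lemma hat_c n : hat n c = a n c.
Proof.
have wc0 : w c != 0 by rewrite gt_eqF// w_gt0.
by case: n => [|n] /=; field.
Qed.

Lemma hat_bounded n : wbounded (hat n).
Proof.
elim: n => [|n IH]; last exact/wboundedB_w/wbounded_Hop.
apply: (@eq_wbounded (fun x => - ((A - a 0 c) / w c) * w x + A)).
  by move=> x Dx /=; ring.
by apply: wboundedB_w; split => //; exists `|A|.
Qed.

Definition hatrem (N : nat) (e : R) : T -> R :=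
  fun x => th e x - \sum_(k < N) hat k x * e ^+ k.

Lemma hatremS N e x : hatrem N.+1 e x = hatrem N e x - hat N x * e ^+ N.
Proof. by rewrite /hatrem big_ord_recr /=; ring. Qed.

Lemma hatrem_bounded N e : 0 < e -> e <= eps0 -> wbounded (hatrem N e).
Proof.
move=> e0 ee; elim: N => [|N [mr [M HM]]].
  by apply: eq_wbounded (th_b e0 ee) => x Dx; rewrite /hatrem big_ord0 subr0.
have [mh [K HK]] := hat_bounded N.
apply: (@eq_wbounded (fun x => hatrem N e x - hat N x * e ^+ N)).
  by move=> x Dx; rewrite hatremS.
split; first by apply: measurable_funB => //; exact: measurable_funM.
exists (M + K * e ^+ N) => t Dt; apply: le_trans (ler_normB _ _) _.
rewrite lerD ?HM// normrM normrX (gtr0_norm e0).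
by rewrite ler_wpM2r ?exprn_ge0 ?HK// ltW.
Qed.

Lemma hatrem_rec N e x : 0 < e -> e <= eps0 -> D x ->
  hatrem N.+1 e x = - (B e - \sum_(k < N.+1) hatb k * e ^+ k) * w x
     + e * Hop (hatrem N e) x.
Proof.
move=> e0 ee Dx; elim: N => [|N IH].
  rewrite hatremS big_ord_recl big_ord0 /= /hatrem big_ord0 !subr0 thE//.
  rewrite (_ : Hop _ x = Hop (th e) x); first by rewrite !expr0; ring.
  by apply: eq_wint => t _; rewrite big_ord0 subr0.
rewrite hatremS {}IH [in RHS]big_ord_recr /=.
have rb := hatrem_bounded N e0 ee; have hb := hat_bounded N.
have Ir := wintegrable_Hker Dx rb.1 (wbounded_wint rb).
have Ih := wintegrable_Hker Dx hb.1 (wbounded_wint hb).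
have -> : Hop (hatrem N.+1 e) x = Hop (hatrem N e) x - e ^+ N * Hop (hat N) x.
  rewrite -wintZ// -wintB//; last exact: wintegrableZ.
  by apply: eq_wint => t _; rewrite hatremS; ring.
by rewrite exprS; ring.
Qed.

(** At [c] the hats agree with [a], so the remainder there is that of a scalar power series, O(e^N).
    Read at [c], [hatrem_rec] thus bounds the coefficient of [w], which contains the unknown [B e];
    with this bound the recursion gains one power of [e] on all of [D]. *)
Lemma hatrem_bound N : exists e1 K, [/\ 0 < e1, e1 <= eps0, 0 <= K &
  forall e x, 0 < e -> e <= e1 -> D x -> `|hatrem N e x| <= K * e ^+ N].
Proof.
have wc0 := w_gt0 Dc; have kap0 := wint_w_ge0.
(* [eps0 / 2] is the range of [pseries_remainder] at [c]; the other bound gives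
   [e * kappa <= 1 / 4]. *)
pose e1 := Num.min (eps0 / 2) (1 / (4 * (kappa + 1))).
have e10 : 0 < e1 by rewrite lt_min !divr_gt0//; lra.
have e1l : e1 <= eps0 / 2 by rewrite ge_min lexx.
have e1r : e1 * (4 * (kappa + 1)) <= 1 by rewrite -ler_pdivlMr ?ge_min ?lexx ?orbT//; lra.
have pr := @pseries_remainder R (fun n => a n c) (fun e => th e c) eps0 eps0_gt0
    (fun e p1 p2 => th_series p1 p2 Dc).
suff H : exists2 K, 0 <= K & forall e x, 0 < e -> e <= e1 -> D x ->
    `|hatrem N e x| <= K * e ^+ N.
  by have [K K0 HK] := H; exists e1, K; split => //; lra.
elim: N => [|N [K K0 HK]].
  have [K K0 HK] := pr 0%N.
  exists (2 * (2 * `|A| + K)); first by rewrite mulr_ge0// addr_ge0// mulr_ge0.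
  move=> e x e0 ee Dx; rewrite expr0 mulr1 /hatrem big_ord0 subr0.
  have ee0 : e <= eps0 by lra.
  have ek : e * kappa <= 1 / 4 by nra.
  have [mt [M HM]] := th_b e0 ee0.
  (* One [M' / 4] comes from the integral term at [t], the other from bounding [B e * w c] through
     the equation at [c]. *)
  apply: (@sup_halving R T D (th e) _ M) => // M' HM' t Dt.
  have M'0 : 0 <= M' by apply: le_trans (HM' c Dc).
  have Hb y : D y -> `|e * Hop (th e) y| <= M' / 4.
    move=> Dy; rewrite normrM (gtr0_norm e0).
    apply: le_trans (ler_wpM2l (ltW e0) (Hop_bound mt HM' Dy)) _.
    have -> : e * (M' * kappa) = M' * (e * kappa) by ring.
    by rewrite -[X in _ <= M' * X]mul1r ler_wpM2l.
  have thc : `|th e c| <= K.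
    have ee2 : e <= eps0 / 2 by lra.
    by have := HK e e0 ee2; rewrite big_ord0 subr0 expr0 mulr1.
  have Bw : `|B e| * w c <= `|A| + K + M' / 4.
    rewrite -{1}(gtr0_norm wc0) -normrM.
    have -> : B e * w c = A - th e c + e * Hop (th e) c by rewrite (thE e0 ee0 Dc); ring.
    apply: le_trans (ler_normD _ _) _; apply: lerD (Hb _ Dc).
    by apply: le_trans (ler_normB _ _) _; rewrite lerD2l.
  have t0 := w_gt0 Dt.
  have Bt : `|B e| * w t <= `|B e| * w c by rewrite ler_wpM2l// w_lec.
  rewrite thE//; apply: le_trans (ler_normD _ _) _.
  have h1 := ler_normB A (B e * w t).
  rewrite [`|B e * w t|]normrM (gtr0_norm t0) in h1.
  by have := Hb _ Dt; lra.
have [K1 K10 HK1] := pr N.+1.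
exists (K1 + kappa * K + kappa * K); first by rewrite !addr_ge0// mulr_ge0.
move=> e x e0 ee Dx; have ee0 : e <= eps0 by lra.
have x0 := w_gt0 Dx.
have Hb y : D y -> `|e * Hop (hatrem N e) y| <= kappa * K * e ^+ N.+1.
  move=> Dy; rewrite normrM (gtr0_norm e0).
  have HKe t : D t -> `|hatrem N e t| <= K * e ^+ N by exact: HK.
  have rm := (hatrem_bounded N e0 ee0).1.
  apply: le_trans (ler_wpM2l (ltW e0) (Hop_bound rm HKe Dy)) _.
  by rewrite exprS le_eqVlt; apply/orP; left; apply/eqP; ring.
set be := B e - \sum_(k < N.+1) hatb k * e ^+ k.
have remc : `|hatrem N.+1 e c| <= K1 * e ^+ N.+1.
  rewrite /hatrem; under eq_bigr do rewrite hat_c.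
  by apply: HK1 => //; lra.
have bw : `|be| * w c <= K1 * e ^+ N.+1 + kappa * K * e ^+ N.+1.
  rewrite -{1}(gtr0_norm wc0) -normrM.
  have -> : be * w c = - hatrem N.+1 e c + e * Hop (hatrem N e) c.
    by rewrite hatrem_rec// -/be; ring.
  by apply: le_trans (ler_normD _ _) _; rewrite normrN lerD// Hb.
rewrite hatrem_rec// -/be; apply: le_trans (ler_normD _ _) _.
rewrite [X in X + _]normrM normrN (gtr0_norm x0).
have : `|be| * w x <= `|be| * w c by rewrite ler_wpM2l// w_lec.
by have := Hb _ Dx; rewrite !mulrDl; lra.
Qed.

(** For fixed [x], the remainders after [n.+1] terms of the hats and of [a] are both O(e^(n+1)), the
    latter by convergence at [x]. Their difference is a polynomial of degree at most [n], so its
    coefficients vanish. *)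
Lemma coef_hat n x : D x -> a n x = hat n x.
Proof.
move=> Dx; have [e1 [K [e10 e1e K0 HK]]] := hatrem_bound n.+1.
have [K1 K10 HK1] := @pseries_remainder R (fun n => a n x) (fun e => th e x) eps0 eps0_gt0
    (fun e p1 p2 => th_series p1 p2 Dx) n.+1.
pose e2 := Num.min e1 (eps0 / 2).
have e20 : 0 < e2 by rewrite lt_min e10 divr_gt0.
apply/eqP; rewrite -subr_eq0; apply/eqP.
apply: (@poly_small_coef0 R n.+1 (fun n => a n x - hat n x) (K + K1) e2 e20) => //.
move=> e e0; rewrite le_min => /andP[ee1 ee2].
have -> : \sum_(k < n.+1) (a k x - hat k x) * e ^+ k =
    hatrem n.+1 e x - (th e x - \sum_(k < n.+1) a k x * e ^+ k).
  under eq_bigr do rewrite mulrBl.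
  by rewrite sumrB /hatrem; ring.
apply: le_trans (ler_normB _ _) _; rewrite mulrDl; apply: lerD; first exact: HK.
exact: HK1.
Qed.

Lemma coefficient_recursion : exists b : nat -> R,
  (forall x, D x -> a 0 x = A - b 0 * w x) /\
  (forall n x, D x -> a n.+1 x = - b n.+1 * w x + Hop (a n) x).
Proof.
exists hatb; split => [x Dx|n x Dx]; first by rewrite coef_hat.
rewrite coef_hat//= ; congr (_ + _).
by apply: eq_wint => t Dt; rewrite coef_hat.
Qed.

End Coefficients.

End VolterraKernel.

(** * Solutions near the endpoint *)

Section Endpoint.
Context {R : realType}.
Local Notation mu := (@completed_lebesgue_measure R).
Local Notation cT := (caratheodory_type (wlength (R:=R) idfun)^*%mu).
Local Notation bT := (measurableTypeR R).
Implicit Types (a b : \bar R) (c d x y t : R) (f g : R -> R).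

Definition loc_itv a c : set R := [set t | (a < t%:E)%E /\ t <= c].

Lemma exists_rat_between a t : (a < t%:E)%E ->
  exists q : rat, (a < (ratr q)%:E)%E /\ ratr q < t.
Proof.
case: a => [s| |_]; [|by []|].
  rewrite lte_fin => st; have [q] := rat_in_itvoo st.
  by rewrite in_itv /= => /andP[sq qt]; exists q; rewrite lte_fin.
have [|q] := @rat_in_itvoo R (t - 1) t; first lra.
by rewrite in_itv /= => /andP[_ qt]; exists q; split => //; exact: ltNyr.
Qed.

Lemma at_a_proper_filter a : ProperFilter (at_a a).
Proof. by case: a => [s| |] /=; [exact: at_right_proper_filter|exact: proper_ninfty_nbhs|exact: proper_ninfty_nbhs]. Qed.

Lemma near_at_aP a c (P : R -> Prop) : (a < c%:E)%E ->
  (\forall x \near at_a a, P x) <->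
  exists2 d, loc_itv a c d & forall x, (a < x%:E)%E -> x <= d -> P x.
Proof.
case: a => [s|//|] ac.
- split=> [[e /= e0 H]|[d [sd dc] H]].
    rewrite lte_fin in ac.
    exists (Num.min c (s + e / 2)).
      split; first by rewrite lte_fin lt_min ac/=; lra.
      by rewrite ge_min lexx.
    move=> x; rewrite lte_fin le_min => sx /andP[xc xs]; apply: H => //=.
    by rewrite distrC gtr0_norm; lra.
  rewrite lte_fin in sd; exists (d - s) => /=; first by lra.
  move=> x /= xs sx; apply: H; first by rewrite lte_fin.
  by rewrite distrC gtr0_norm in xs; lra.
- split=> [[M [_ H]]|[d [_ dc] H]].
    exists (Num.min c (M - 1)); first by split; [exact: ltNyr|rewrite ge_min lexx].
    by move=> x _; rewrite le_min => /andP[_ xM]; apply: H; lra.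
  by exists d; split; [exact: num_real|move=> x xd; apply: H; [exact: ltNyr|exact: ltW]].
Qed.

Lemma measurable_loc_itv a c : measurable (loc_itv a c : set cT).
Proof.
apply: lebesgue_measurable_completed.
apply: is_interval_measurable => x y [ax xc] [ay yc] t /andP[xt ty]; split.
  by apply: lt_le_trans ax _; rewrite lee_fin.
exact: le_trans ty yc.
Qed.

(** [(a, c]] is the countable union of the [[q, c]] with [q] rational, whether [a] is finite or
    not. *)
Lemma measurable_fun_loc_itv a c f :
  (forall x, loc_itv a c x -> measurable_fun (`[x, c]%classic : set cT) (f : cT -> R)) ->
  measurable_fun (loc_itv a c : set cT) (f : cT -> R).
Proof.
move=> H _ Y mY.
pose F n : set R := if unpickle n is Some q then
  (if `[< loc_itv a c (ratr q) >] then `[ratr q, c]%classic `&` f @^-1` Y else set0)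
  else set0.
have -> : loc_itv a c `&` f @^-1` Y = \bigcup_n F n.
  apply/seteqP; split=> t.
    move=> [[at0 tc] Yt]; have [q [aq qt]] := exists_rat_between at0.
    exists (pickle q); first exact: I.
    rewrite /F pickleK asboolT; last by split => //; lra.
    by split => //=; rewrite in_itv /= tc andbT ltW.
  move=> [n _]; rewrite /F; case: unpickle => [q|//]; case: asboolP => [[aq qc]|//].
  move=> [/=]; rewrite in_itv /= => /andP[qt tc] Yt; split => //; split => //.
  by apply: lt_le_trans aq _; rewrite lee_fin.
apply: (@bigcupT_measurable _ cT) => n; rewrite /F.
case: unpickle => [q|]; last exact: measurable0.
case: asboolP => [Dq|_]; last exact: measurable0.
by apply: H => //; exact: lebesgue_measurable_completed.
Qed.

Lemma abs_cont_on_measurable c d f : abs_cont_on c d f ->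
  measurable_fun (`[c, d]%classic : set cT) (f : cT -> R).
Proof.
move=> ACf; apply: measurable_fun_completed => //.
apply: subspace_continuous_measurable_fun => //.
exact: abs_cont_on_continuous.
Qed.

Lemma integrable_mul_abs_cont c d f g : mu.-integrable `[c, d] (EFin \o g) ->
  abs_cont_on c d f -> mu.-integrable `[c, d] (EFin \o (fun x => g x * f x)).
Proof.
move=> ig ACf; have [M M0 HM] := within_continuous_bounded (abs_cont_on_continuous ACf).
have mcd : measurable (`[c, d]%classic : set cT) by exact: lebesgue_measurable_completed.
apply: (@integrableMl _ _ _ mu _ mcd (EFin \o g) f) => //.
  exact: abs_cont_on_measurable.
exists M; split; first exact: num_real.
move=> K MK x /=; rewrite in_itv /= => xcd; apply: le_trans (ltW MK); exact: HM.
Qed.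

End Endpoint.

Section Positivity.
Context {R : realType}.
Local Notation mu := (@completed_lebesgue_measure R).
Local Notation cT := (caratheodory_type (wlength (R:=R) idfun)^*%mu).

Lemma completed_Rintegral_gt0 (D : set R) (k : R -> R) :
  measurable (D : set cT) -> mu D <> 0%E -> mu.-integrable D (EFin \o k) ->
  {ae mu, forall x, D x -> 0 < k x} -> 0 < \int[mu]_(x in D) k x.
Proof.
move=> mD D0 ik k0.
have mk : measurable_fun (D : set cT) (EFin \o k) by exact: measurable_int ik.
have mak : measurable_fun (D : set cT) (abse \o (EFin \o k)) by exact: measurableT_comp.
have absE : (\int[mu]_(x in D) (k x)%:E = \int[mu]_(x in D) `|(k x)%:E|)%E.
  apply: ae_eq_integral; [exact: mD|exact: mk|exact: mak|].
  by apply: completed_aeS k0 => x h Dx /=; rewrite gtr0_norm// h.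
have fin : (\int[mu]_(x in D) (k x)%:E)%E \is a fin_num by exact: integrable_fin_num.
rewrite lt_neqAle; apply/andP; split; last first.
  by rewrite /Rintegral absE fine_ge0// integral_ge0.
apply/eqP => /esym/eqP; rewrite /Rintegral fine_eq0// absE => /eqP.
move=> /(ae_eq_integral_abs mu mD mk) h.
apply: D0; have [A [mA A0 sA]] : {ae mu, forall x, ~ D x}.
  by apply: completed_aeS2 k0 h => x kx zx Dx; have := kx Dx; have [->] := zx Dx; rewrite ltxx.
by apply: (subset_measure0 mD mA _ A0) => x Dx; apply: sA => /= /(_ Dx).
Qed.

End Positivity.

(** * Real solutions: Lagrange identity and quotients *)

Section RealSolutions.
Context {R : realType}.
Local Notation mu := (@completed_lebesgue_measure R).
Local Notation cT := (caratheodory_type (wlength (R:=R) idfun)^*%mu).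
Variables (a b : \bar R) (p q r : R -> R).
Hypothesis r_gt0 : {ae mu, forall x, oitv a b x -> 0 < r x}.
Hypothesis r_int : loc_integrable a b r.
Hypothesis p_gt0 : {ae mu, forall x, oitv a b x -> 0 < p x}.
Hypothesis p_int : loc_integrable a b (fun x => (p x)^-1).

(** Real part of [is_sol] at a real spectral parameter, with the second equation multiplied by [r]
    and solved for the derivative of [f1]. *)
Definition real_sol (t : R) (f f1 : R -> R) : Prop :=
  [/\ ACloc a b f, ACloc a b f1,
      {ae mu, forall x, oitv a b x -> derivable f x 1 /\ p x * derive1 f x = f1 x} &
      {ae mu, forall x, oitv a b x ->
         derivable f1 x 1 /\ derive1 f1 x = (q x - t * r x) * f x}].

Lemma oitv_between x y t : oitv a b x -> oitv a b y -> x <= t -> t <= y -> oitv a b t.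
Proof.
move=> [ax _] [_ yb] xt ty; split.
  by apply: lt_le_trans ax _; rewrite lee_fin.
by apply: le_lt_trans yb; rewrite lee_fin.
Qed.

Lemma is_sol_Re (t : R) (f f1 : R -> R[i]) : is_sol p q r a b t%:C f f1 ->
  real_sol t (cRe f) (cRe f1).
Proof.
move=> [[ACf _] [ACf1 _] e1 e2]; split => //.
  apply: completed_aeS e1 => x h ox; have [[dr di] pe] := h ox; split => //.
  have := congr1 (@complex.Re R) pe; rewrite /cderive /cRe /= => <-.
  by ring.
apply: completed_aeS2 e2 r_gt0 => x h rx ox; have [[dr di] pe] := h ox; split => //.
have r0 := rx ox; have rC : (r x)%:C != 0 by rewrite (inj_eq (@complexI R)) gt_eqF.
have : - cderive f1 x + (q x)%:C * f x = (r x)%:C * (t%:C * f x).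
  by rewrite -pe mulVKf.
move=> /(congr1 (@complex.Re R)); rewrite /cderive /cRe /=.
case: (f x) => fr fi /=; set D := derive1 _ _; lra.
Qed.

(** In the derivative of the Wronskian the terms with [p] cancel, and so do those with [q]; what
    remains is [(s - t) r f g]. *)
Lemma lagrange_identity (s t : R) (f f1 g g1 : R -> R) x y :
  real_sol s f f1 -> real_sol t g g1 -> oitv a b x -> oitv a b y -> x <= y ->
  wronsk f f1 g g1 y - wronsk f f1 g g1 x =
  (s - t) * \int[mu]_(z in `[x, y]) (r z * (f z * g z)).
Proof.
move=> [ACf ACf1 e1 e2] [ACg ACg1 e3 e4] ox oy xy.
have irfg : mu.-integrable `[x, y] (EFin \o (fun z => r z * (f z * g z))).
  by apply: integrable_mul_abs_cont; [exact: r_int|apply: abs_cont_onM; [exact: ACf|exact: ACg]].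
have mxy : measurable (`[x, y]%classic : set cT) by exact: lebesgue_measurable_completed.
rewrite -RintegralZl//.
apply: abs_cont_FTC => //.
- apply: abs_cont_onB; apply: abs_cont_onM; [exact: ACf|exact: ACg1|exact: ACf1|exact: ACg].
- have := integrableZl mxy (s - t) irfg; congr (_.-integrable _ _).
- apply: completed_aeS2 (completed_aeS2 (fun _ h1 h2 => conj h1 h2) e1 e2)
    (completed_aeS2 (fun _ h1 h2 => conj h1 h2) e3 e4) => z [h1 h2] [h3 h4] /andP[xz zy].
  have oz := oitv_between ox oy xz zy.
  have [df fE] := h1 oz; have [df1 f1E] := h2 oz.
  have [dg gE] := h3 oz; have [dg1 g1E] := h4 oz.
  have d1 : derivable (f \* g1) z 1 by apply: derivableM; [exact: df|exact: dg1].
  have d2 : derivable (f1 \* g) z 1 by apply: derivableM; [exact: df1|exact: dg].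
  split; first exact: (derivableB d1 d2).
  rewrite derive1E (deriveB d1 d2) (deriveM df dg1) (deriveM df1 dg) -!derive1E.
  rewrite /GRing.scale /= f1E g1E -fE -gE; ring.
Qed.

(** The derivative of [u / v] is [W(v, u) / (p v^2) = 1 / (p v^2)], positive almost everywhere. *)
Lemma quotient_increment (t : R) (u u1 v v1 : R -> R) x y :
  real_sol t u u1 -> real_sol t v v1 ->
  (forall z, oitv a b z -> wronsk v v1 u u1 z = 1) ->
  oitv a b x -> oitv a b y -> x < y -> (forall z, x <= z <= y -> v z != 0) ->
  u x / v x < u y / v y.
Proof.
move=> [ACu ACu1 e1 e2] [ACv ACv1 e3 e4] W1 ox oy xy v0.
have ACV : abs_cont_on x y (fun z => (v z)^-1).
  by apply: abs_cont_onV => //; exact: ACv.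
have mxy : measurable (`[x, y]%classic : set cT) by exact: lebesgue_measurable_completed.
pose k z := (p z)^-1 * ((v z)^-1 * (v z)^-1).
have ik : mu.-integrable `[x, y] (EFin \o k).
  by apply: integrable_mul_abs_cont; [exact: p_int|exact: abs_cont_onM].
have kE : u y / v y - u x / v x = \int[mu]_(z in `[x, y]) k z.
  apply: (@abs_cont_FTC R (fun z => u z / v z)) => //; first exact: ltW.
    by apply: abs_cont_onM => //; exact: ACu.
  apply: completed_aeS2 (completed_aeS2 (fun _ h1 h2 => conj h1 h2) e1 e3) p_gt0
    => z [h1 h3] hp zxy; have /andP[xz zy] := zxy.
  have oz := oitv_between ox oy xz zy.
  have [du uE] := h1 oz; have [dv vE] := h3 oz; have pz := hp oz.
  have vz := v0 _ zxy.
  have dV : derivable (fun z => (v z)^-1) z 1 by exact: derivableV.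
  split; first by apply: derivableM; [exact: du|exact: dV].
  rewrite derive1E (deriveM du dV) (deriveV vz dv) -!derive1E /GRing.scale /=.
  rewrite /k; have := W1 _ oz; rewrite /wronsk -uE -vE => W.
  have -> : (p z)^-1 = (p z)^-1 * (v z * (p z * derive1 u z) - p z * derive1 v z * u z).
    by rewrite W mulr1.
  by field; rewrite vz gt_eqF.
rewrite -subr_gt0 kE; apply: completed_Rintegral_gt0 => //.
  have : mu `[x, y]%classic = (y - x)%:E.
    have := @lebesgue_measure_itv R `[x, y]; rewrite /= lte_fin xy -EFinB; exact.
  by move=> ->; apply/eqP; rewrite eqe gt_eqF// subr_gt0.
apply: completed_aeS p_gt0 => z hp; rewrite /= in_itv /= => zxy.
have /andP[xz zy] := zxy; have oz := oitv_between ox oy xz zy.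
have vz := v0 _ zxy.
by rewrite /k mulr_gt0 ?invr_gt0 ?hp// -expr2 exprn_even_gt0//= invr_neq0.
Qed.

End RealSolutions.

(** * Scaling of [lim0], and power series at real points *)

Section LimitZero.
Context {R : realType}.
Implicit Types (a : \bar R) (f g : R -> R) (k : R).

Lemma lim0Zl a f g k : lim0 a f g -> lim0 a (fun x => k * f x) g.
Proof.
have FF := at_a_proper_filter a; move=> [g0 fg]; split => //.
have -> : (fun x => k * f x / g x) = (fun x => k * (f x / g x)).
  by apply/funext => x; rewrite mulrA.
by rewrite -(mulr0 k); apply: cvgM => //; exact: cvg_cst.
Qed.

Lemma lim0Zr a f g k : k != 0 -> lim0 a f g -> lim0 a f (fun x => k * g x).
Proof.
have FF := at_a_proper_filter a; move=> k0 [g0 fg]; split.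
  by apply: filterS g0 => x gx; rewrite mulf_neq0.
have -> : (fun x => f x / (k * g x)) = (fun x => k^-1 * (f x / g x)).
  by apply/funext => x; rewrite invfM mulrCA.
by rewrite -(mulr0 k^-1); apply: cvgM => //; exact: cvg_cst.
Qed.

Lemma lim0_scale_l a f g k : k != 0 -> lim0 a (fun x => k * f x) g <-> lim0 a f g.
Proof.
move=> k0; split=> [/(@lim0Zl _ _ _ k^-1)|]; last exact: lim0Zl.
by under eq_fun do rewrite mulKf//.
Qed.

Lemma lim0_scale_r a f g k : k != 0 -> lim0 a f (fun x => k * g x) <-> lim0 a f g.
Proof.
move=> k0; split=> [/(@lim0Zr _ _ _ k^-1)|]; last exact: lim0Zr.
by rewrite invr_eq0 => /(_ k0); under eq_fun do rewrite mulKf//.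
Qed.

End LimitZero.

Section ComplexSeries.
Context {R : realType}.
Implicit Types (lam e : R) (s : nat -> R).

Lemma real_term_Re lam e (x : R) n :
  x%:C * ((lam + e)%:C - lam%:C) ^+ n = (x * e ^+ n)%:C :> R[i].
Proof. by rewrite -rmorphB /= addrAC subrr add0r -rmorphXn -rmorphM. Qed.

(** At real [z = lam + e] every term is real. The vanishing imaginary part is used for phi, to bring
    the complex Wronskian identity down to the reals. *)
Lemma cseries_to_real s lam e (l : R[i]) :
  cseries_to (fun n => (s n)%:C * ((lam + e)%:C - lam%:C) ^+ n) l ->
  (fun N => \sum_(k < N) s k * e ^+ k) @ \oo --> complex.Re l /\ complex.Im l = 0.
Proof.
move=> [reS imS]; split.
  by move: reS; under eq_fun do under eq_bigr do rewrite real_term_Re.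
move: imS; under eq_fun do under eq_bigr do rewrite real_term_Re /=.
under eq_fun do rewrite big1//.
by move=> h; apply: (cvg_unique _ h) => //; exact: cvg_cst.
Qed.

End ComplexSeries.

(** * Solutions divided by the nonprincipal one *)

Section Normalized.
Context {R : realType}.
Local Notation mu := (@completed_lebesgue_measure R).
Local Notation cT := (caratheodory_type (wlength (R:=R) idfun)^*%mu).
Variables (a b : \bar R) (p q r : R -> R) (lam : R) (u u1 v v1 : R -> R) (c : R).
Hypothesis r_gt0 : {ae mu, forall x, oitv a b x -> 0 < r x}.
Hypothesis r_int : loc_integrable a b r.
Hypothesis p_gt0 : {ae mu, forall x, oitv a b x -> 0 < p x}.
Hypothesis p_int : loc_integrable a b (fun x => (p x)^-1).
Hypothesis u_sol : real_sol a b p q r lam u u1.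
Hypothesis v_sol : real_sol a b p q r lam v v1.
Hypothesis wronsk_vu : forall x, oitv a b x -> wronsk v v1 u u1 x = 1.
Hypothesis oc : oitv a b c.
Hypothesis v_neq0 : forall x, loc_itv a c x -> v x != 0.
Hypothesis quot_cvg0 : forall e : R, 0 < e ->
  exists2 d, loc_itv a c d & forall x, loc_itv a c x -> x <= d -> `|u x / v x| < e.
Hypothesis uvr_int : (\int[mu]_(x in loc_itv a c) (`|u x * v x * r x|)%:E < +oo)%E.

Local Notation D := (loc_itv a c).

(* r is positive only almost everywhere; [rpos] is positive everywhere. *)
Definition rpos (x : R) : R := if 0 < r x then r x else 1.
Definition quot (x : R) : R := u x / v x.
Definition dens (x : R) : R := v x * v x * rpos x.
Local Notation w := (quot : cT -> R).
Local Notation rho := (dens : cT -> R).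

Lemma loc_itv_oitv x : D x -> oitv a b x.
Proof. by move=> [ax xc]; split => //; apply: le_lt_trans oc.2; rewrite lee_fin. Qed.

Lemma loc_itv_itv x t : D x -> x <= t -> t <= c -> D t.
Proof.
by move=> [ax xc] xt tc; split => //; apply: lt_le_trans ax _; rewrite lee_fin.
Qed.

Lemma loc_itvc : D c. Proof. by split => //; exact: oc.1. Qed.

Lemma abs_cont_quot f x : ACloc a b f -> D x -> abs_cont_on x c (fun t => f t / v t).
Proof.
move=> ACf Dx; have ox := loc_itv_oitv Dx; apply: abs_cont_onM; first exact: ACf.
apply: abs_cont_onV; first by have [ACv _ _ _] := v_sol; exact: ACv.
by move=> t /andP[xt tc]; apply: v_neq0; exact: loc_itv_itv Dx xt tc.
Qed.

Lemma measurable_quot_v f : ACloc a b f -> measurable_fun (D : set cT) ((fun t => f t / v t) : cT -> R).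
Proof.
move=> ACf; apply: measurable_fun_loc_itv => x Dx.
by apply: abs_cont_on_measurable; exact: abs_cont_quot.
Qed.

Lemma measurable_AC f : ACloc a b f -> measurable_fun (D : set cT) (f : cT -> R).
Proof.
move=> ACf; apply: measurable_fun_loc_itv => x Dx.
by apply: abs_cont_on_measurable; apply: ACf => //; exact: loc_itv_oitv.
Qed.

Let mD : measurable (D : set cT). Proof. exact: measurable_loc_itv. Qed.

Let mw : measurable_fun (D : set cT) w.
Proof. by apply: measurable_quot_v; have [] := u_sol. Qed.

Let mr : measurable_fun (D : set cT) (r : cT -> R).
Proof.
apply: measurable_fun_loc_itv => x Dx.
by apply/measurable_EFinP; apply: (measurable_int mu); apply: r_int => //; exact: loc_itv_oitv.
Qed.

Let mrpos : measurable_fun (D : set cT) (rpos : cT -> R).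
Proof.
apply: measurable_fun_if; first exact: mD.
- by apply: measurable_fun_ltr; [exact: measurable_cst|exact: mr].
- by apply: measurable_funS mr; [exact: mD|move=> t []].
- exact: measurable_cst.
Qed.

Let mv : measurable_fun (D : set cT) (v : cT -> R).
Proof. by apply: measurable_AC; have [] := v_sol. Qed.

Let m_u : measurable_fun (D : set cT) (u : cT -> R).
Proof. by apply: measurable_AC; have [] := u_sol. Qed.

Let mrho : measurable_fun (D : set cT) rho.
Proof. by apply: measurable_funM; [exact: (measurable_funM mv mv)|exact: mrpos]. Qed.

Lemma quot_lt x y : D x -> D y -> x < y -> quot x < quot y.
Proof.
move=> Dx Dy xy; apply: (quotient_increment p_gt0 p_int u_sol v_sol wronsk_vu) => //.
- exact: loc_itv_oitv.
- exact: loc_itv_oitv.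
- move=> z /andP[xz zy]; apply: v_neq0; apply: (loc_itv_itv Dx xz).
  exact: le_trans zy Dy.2.
Qed.

Lemma quot_le x y : D x -> D y -> (quot x <= quot y) = (x <= y).
Proof.
move=> Dx Dy; have [xy|yx] := leP x y.
  move: xy; rewrite le_eqVlt => /orP[/eqP->|xy]; first by rewrite lexx.
  by rewrite ltW// quot_lt.
by apply/negbTE; rewrite -ltNge; exact: quot_lt.
Qed.

(** If [u / v] were at most 0 at [t], monotonicity would keep it below a fixed negative number near
    [a], against the limit 0. *)
Lemma quot_gt0 t : D t -> 0 < quot t.
Proof.
move=> Dt; rewrite ltNge; apply/negP => le0.
have [s [as_ st]] := exists_rat_between Dt.1.
have Ds : D (ratr s) by split => //; apply: le_trans (ltW st) Dt.2.
have ws := quot_lt Ds Dt st.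
have ws0 : 0 < - quot (ratr s) by lra.
have [d Dd Hd] := quot_cvg0 ws0.
pose x := Num.min d (ratr s).
have Dx : D x by rewrite /x; case: (leP d (ratr s)).
have xs : quot x <= quot (ratr s) by rewrite quot_le// /x ge_min lexx orbT.
have xd : x <= d by rewrite /x ge_min lexx.
by have := Hd _ Dx xd; rewrite -/(quot x) ltr_norml => /andP[]; lra.
Qed.

Lemma dens_gt0 t : D t -> 0 < dens t.
Proof.
move=> Dt; rewrite /dens mulr_gt0//; first by rewrite -expr2 exprn_even_gt0//= v_neq0.
by rewrite /rpos; case: ifP.
Qed.

Lemma quot_lec t : D t -> quot t <= quot c.
Proof. by move=> Dt; rewrite quot_le//; [exact: Dt.2|exact: loc_itvc]. Qed.

Lemma quot_small (e : R) : 0 < e -> exists2 t, D t & quot t < e.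
Proof.
move=> e0; have [d Dd Hd] := quot_cvg0 e0; exists d => //.
by apply: le_lt_trans (ler_norm _) _; exact: Hd.
Qed.

Lemma quot_mass x : D x -> mu (D `&` [set t | quot t < quot x]) <> 0%E.
Proof.
move=> Dx m0; have [s [as_ sx]] := exists_rat_between Dx.1.
have Ds : D (ratr s) by split => //; apply: le_trans (ltW sx) Dx.2.
have mS : measurable ((D `&` [set t | quot t < quot x]) : set cT).
  rewrite [X in measurable X](_ : _ = D `&` w @^-1` `]-oo, quot x[); first exact: mw.
  by apply/seteqP; split=> t /=; rewrite in_itv.
have mI : measurable (`]ratr s, x[%classic : set cT) by exact: lebesgue_measurable_completed.
have sub : `]ratr s, x[%classic `<=` D `&` [set t | quot t < quot x].
  move=> t /=; rewrite in_itv /= => /andP[st tx].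
  have Dt : D t by apply: (loc_itv_itv Ds (ltW st)); apply: le_trans (ltW tx) Dx.2.
  by split => //; exact: quot_lt.
have : mu `]ratr s, x[%classic = 0%E by apply: (subset_measure0 mI mS sub m0).
have := @lebesgue_measure_itv R `]ratr s, x[; rewrite /= lte_fin sx -EFinB => h.
move=> h0; have : (x - ratr s)%:E = 0%E by rewrite -h; exact: h0.
by move=> /eqP; rewrite eqe; apply/negP; rewrite gt_eqF// subr_gt0.
Qed.

Lemma ae_rpos : {ae mu, forall x, D x -> rpos x = r x}.
Proof.
by apply: completed_aeS r_gt0 => x h Dx; rewrite /rpos ifT//; apply: h; exact: loc_itv_oitv.
Qed.

(** [quot * dens] is [u v r] almost everywhere on [D]: this is where hypothesis (H_a) enters. *)
Lemma quot_int : mu.-integrable D (EFin \o (fun t => quot t * dens t)).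
Proof.
have mqd : measurable_fun (D : set cT) ((fun t => quot t * dens t) : cT -> R).
  exact: (measurable_funM mw mrho).
apply/integrableP; split; first exact/measurable_EFinP.
apply: le_lt_trans uvr_int; rewrite le_eqVlt; apply/orP; left; apply/eqP.
apply: ae_eq_integral; first exact: mD.
- by apply/measurable_EFinP; exact: (measurableT_comp (@normr_measurable R setT) mqd).
- have mn := measurable_funM (measurable_funM m_u mv) mr.
  by apply/measurable_EFinP; exact: (measurableT_comp (@normr_measurable R setT) mn).
- apply: completed_aeS ae_rpos => x h Dx /=; congr (_%:E); congr `|_|.
  by rewrite /quot /dens h//; field; exact: v_neq0.
Qed.

Local Notation wintD := (wint mu D dens).

Lemma near_at_aE (P : R -> Prop) : (\forall x \near at_a a, P x) <-> @wnear _ cT R D w P.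
Proof.
rewrite (near_at_aP P oc.1); split=> [[d Dd H]|[d Dd H]]; exists d => //.
  by move=> x Dx; rewrite quot_le// => xd; apply: H => //; exact: Dx.1.
move=> x ax xd; have Dx : D x by split => //; exact: le_trans xd Dd.2.
by apply: H => //; rewrite quot_le.
Qed.

(** The divisor [v], nonzero on [D], cancels from the ratio. *)
Lemma lim0E (f g : R -> R) : lim0 a f g <->
  wlittleo (D : set cT) w (fun x => f x / v x) (fun x => g x / v x).
Proof.
have FF := at_a_proper_filter a.
have v0 (x : R) : D x -> (0 < `|v x|) by move=> Dx; rewrite normr_gt0 v_neq0.
split=> [[g0 fg]|[g0 fg]]; split.
- move/near_at_aE : g0; apply: wnearS => x Dx gx.
  by rewrite mulf_neq0// invr_neq0// v_neq0.
- move=> e e0; have /cvgr0Pnorm_le /(_ _ e0) /near_at_aE h := fg.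
  move/near_at_aE : g0 => g0.
  apply: wnearS (wnear_and h g0) => x Dx [/= fx gx].
  move: fx; rewrite !normrM !normfV mulrA => fx.
  by rewrite ler_wpM2r ?invr_ge0// -ler_pdivrMr ?normr_gt0.
- apply/near_at_aE; apply: wnearS g0 => x Dx; apply: contra => /eqP ->.
  by rewrite mul0r.
- apply/cvgr0Pnorm_le => e e0; apply/near_at_aE.
  apply: wnearS (wnear_and g0 (fg e e0)) => x Dx [gx fx].
  have gx0 : g x != 0 by apply: contra gx => /eqP ->; rewrite mul0r.
  move: fx; rewrite !normrM !normfV mulrA ler_pM2r ?invr_gt0 ?v0// => fx.
  by rewrite ler_pdivrMr ?normr_gt0.
Qed.

Lemma Rintegral_wup (f g : R -> R) x : ACloc a b f -> ACloc a b g -> D x ->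
  \int[mu]_(z in `[x, c]) (r z * (f z * g z)) =
  wintD (fun t => wup w x t * ((f t / v t) * (g t / v t))).
Proof.
move=> ACf ACg Dx.
have mf := measurable_AC ACf; have mg := measurable_AC ACg.
have mfv := measurable_quot_v ACf; have mgv := measurable_quot_v ACg.
have mxc : measurable (`[x, c]%classic : set cT) by exact: lebesgue_measurable_completed.
have sub : `[x, c]%classic `<=` D.
  move=> t /=; rewrite in_itv /= => /andP[xt tc]; exact: loc_itv_itv Dx xt tc.
rewrite (_ : \int[mu]_(z in `[x, c]) (r z * (f z * g z)) =
    \int[mu]_(z in `[x, c]) ((f z / v z) * (g z / v z) * dens z)); last first.
  congr fine; apply: ae_eq_integral; first exact: mxc.
  - apply/measurable_EFinP; apply: (measurable_funS mD sub).
    exact: (measurable_funM mr (measurable_funM mf mg)).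
  - apply/measurable_EFinP; apply: (measurable_funS mD sub).
    exact: (measurable_funM (measurable_funM mfv mgv) mrho).
  - apply: completed_aeS ae_rpos => z h xz /=; congr (_%:E).
    have Dz := sub _ xz; rewrite /dens h//; field; exact: v_neq0.
rewrite -[X in \int[mu]_(z in X) _](_ : D `&` `[x, c]%classic = _); last exact/setIidPr.
rewrite Rintegral_mkcondr; apply: eq_Rintegral => t /set_mem Dt.
rewrite patchE mem_setE in_itv /= Dt.2 andbT /wup quot_le//.
by case: ifP => _; rewrite ?mul1r ?mul0r.
Qed.

(** The kernel of the construction is [v t * v x * (w t - w x)]. On [t <= x] the last factor is
    [min (w t - w x) 0]; for [t > x] that minimum is 0, which encodes the upper limit of
    integration. *)
Lemma phiC_step n x : D x -> wintegrable mu D dens (fun t => phiC r a u v n t / v t) ->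
  phiC r a u v n.+1 x / v x = Top mu D w rho (fun t => phiC r a u v n t / v t) x.
Proof.
move=> Dx IP; have vx := v_neq0 Dx.
have IT := wintegrable_Tker mD mw mrho quot_gt0 dens_gt0 Dx IP.
have mphi : measurable_fun (D : set cT) (phiC r a u v n : cT -> R).
  apply: eq_measurable_fun (measurable_funM IP.1 mv) => t /set_mem Dt /=.
  by rewrite divfK// v_neq0.
have mker : measurable_fun (D : set cT) ((fun t => u t * v x - v t * u x) : cT -> R).
  apply: measurable_funB; first exact: (measurable_funM m_u (measurable_cst (v x))).
  exact: (measurable_funM mv (measurable_cst (u x))).
apply: (mulIf vx); rewrite divfK// mulrC.
rewrite -(wintZ mD (v x) IT) /wint /=.
have sub : [set t | (a < t%:E)%E /\ t <= x] `<=` D.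
  by move=> t [at0 tx]; split => //; exact: le_trans tx Dx.2.
have mS : measurable ([set t | (a < t%:E)%E /\ t <= x] : set cT) by exact: measurable_loc_itv.
transitivity (\int[mu]_(t in [set t | (a < t%:E)%E /\ t <= x])
   ((u t * v x - v t * u x) * phiC r a u v n t * rpos t)).
  congr fine; apply: ae_eq_integral; first exact: mS.
  - apply/measurable_EFinP; apply: (measurable_funS mD sub).
    exact: (measurable_funM (measurable_funM mker mphi) mr).
  - apply/measurable_EFinP; apply: (measurable_funS mD sub).
    exact: (measurable_funM (measurable_funM mker mphi) mrpos).
  - by apply: completed_aeS ae_rpos => t h /sub Dt /=; rewrite h.
rewrite -[X in \int[mu]_(z in X) _](_ : D `&` [set t | (a < t%:E)%E /\ t <= x] = _);
  last exact/setIidPr.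
rewrite Rintegral_mkcondr; apply: eq_Rintegral => t /set_mem Dt.
have vt := v_neq0 Dt.
have [tx|xt] := leP t x.
  rewrite patchE mem_set; last by split => //; exact: Dt.1.
  rewrite min_l; last by rewrite subr_le0 quot_le.
  by rewrite /quot /dens; field; rewrite vx vt.
rewrite patchE memNset; last by move=> [_]; rewrite leNgt xt.
rewrite min_r; first by rewrite mul0r mulr0 mul0r.
by rewrite subr_ge0 quot_le// ltW.
Qed.

Local Notation Phi := (fun n (t : R) => phiC r a u v n t / v t).

Lemma phiC_Top : forall n x, D x -> Phi n.+1 x = Top mu D w rho (Phi n) x.
Proof.
have I0 : wintegrable mu D dens (Phi 0%N) by split; [exact: mw|exact: quot_int].
suff H n : wintegrable mu D dens (Phi n) by move=> n x Dx; apply: phiC_step.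
elim: n => [//|n IH].
apply: (eq_wintegrable mD _ (wintegrable_Top mD mw mrho quot_gt0 dens_gt0 quot_lec quot_int IH)).
by move=> x Dx; rewrite -phiC_step.
Qed.

Lemma measurable_sol (t : R) f f1 : real_sol a b p q r t f f1 ->
  measurable_fun (D : set cT) ((fun x => f x / v x) : cT -> R).
Proof. by move=> [ACf _ _ _]; exact: measurable_quot_v. Qed.

Lemma sol_quot_locally_bounded (t : R) f f1 : real_sol a b p q r t f f1 ->
  forall x, D x -> exists M : R, forall y, D y -> quot x <= quot y -> `|f y / v y| <= M.
Proof.
move=> [ACf _ _ _] x Dx.
have [M _ HM] := within_continuous_bounded (abs_cont_on_continuous (abs_cont_quot ACf Dx)).
by exists M => y Dy; rewrite quot_le// => xy; apply: HM; rewrite xy Dy.2.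
Qed.

Lemma wronsk_u_wint (e : R) f f1 x : real_sol a b p q r (lam + e) f f1 -> D x ->
  wronsk f f1 u u1 x = wronsk f f1 u u1 c -
    e * wintD (fun t => wup w x t * (quot t * (f t / v t))).
Proof.
move=> fs Dx; have [ACf _ _ _] := fs; have [ACu _ _ _] := u_sol.
have := lagrange_identity r_int fs u_sol (loc_itv_oitv Dx) oc Dx.2.
rewrite (Rintegral_wup ACf ACu Dx).
rewrite (_ : wintD (fun t => wup w x t * ((f t / v t) * (u t / v t))) =
    wintD (fun t => wup w x t * (quot t * (f t / v t)))).
  by rewrite [lam + e]addrC addrK; lra.
by apply: eq_wint => t Dt; rewrite [quot t * _]mulrC.
Qed.

Lemma wronsk_v_wint (e : R) f f1 x : real_sol a b p q r (lam + e) f f1 -> D x ->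
  wronsk f f1 v v1 x = wronsk f f1 v v1 c - e * wintD (fun t => wup w x t * (f t / v t)).
Proof.
move=> fs Dx; have [ACf _ _ _] := fs; have [ACv _ _ _] := v_sol.
have := lagrange_identity r_int fs v_sol (loc_itv_oitv Dx) oc Dx.2.
rewrite (Rintegral_wup ACf ACv Dx).
rewrite (_ : wintD (fun t => wup w x t * ((f t / v t) * (v t / v t))) =
    wintD (fun t => wup w x t * (f t / v t))).
  by rewrite [lam + e]addrC addrK; lra.
by apply: eq_wint => t Dt; rewrite [v t / v t]divff ?mulr1// v_neq0.
Qed.

(** Expansion in the basis [v], [u]: [f W(v, u) = v W(f, u) - u W(f, v)]. *)
Lemma quot_wronsk f f1 x : D x ->
  f x / v x = wronsk f f1 u u1 x - quot x * wronsk f f1 v v1 x.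
Proof.
move=> Dx; have vx := v_neq0 Dx; have W := wronsk_vu (loc_itv_oitv Dx).
have -> : f x = f x * wronsk v v1 u u1 x by rewrite W mulr1.
by rewrite /wronsk /quot; field.
Qed.

Lemma sol_volterra (e : R) f f1 x : real_sol a b p q r (lam + e) f f1 -> D x ->
  f x / v x = wronsk f f1 u u1 c - wronsk f f1 v v1 c * quot x
    - e * wintD (fun t => wup w x t * ((quot t - quot x) * (f t / v t))).
Proof.
move=> fs Dx; have mf := measurable_sol fs.
have [M HM] := sol_quot_locally_bounded fs Dx.
have I1 := wintegrable_wup mD mw mrho quot_gt0 quot_int Dx mf HM.
have I2 : wintegrable mu D dens (fun t => wup w x t * (quot t * (f t / v t))).
  apply: (wintegrable_wup mD mw mrho quot_gt0 quot_int (M := quot c * M) Dx).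
    exact: (measurable_funM mw mf).
  move=> t Dt xt; rewrite normrM; apply: ler_pM => //; last exact: HM.
  by rewrite gtr0_norm ?quot_gt0// quot_lec.
rewrite (quot_wronsk f f1 Dx) (wronsk_u_wint fs Dx) (wronsk_v_wint fs Dx).
have -> : wintD (fun t => wup w x t * ((quot t - quot x) * (f t / v t))) =
   wintD (fun t => wup w x t * (quot t * (f t / v t)))
   - quot x * wintD (fun t => wup w x t * (f t / v t)).
  rewrite -(wintZ mD (quot x) I1) -(wintB mD I2 (wintegrableZ mD (quot x) I1)).
  by apply: eq_wint => t Dt; ring.
by ring.
Qed.

Lemma sol_wbounded (e : R) f f1 : real_sol a b p q r (lam + e) f f1 ->
  `|e| * wintD quot <= 1 / 2 -> wbounded (D : set cT) (fun x => f x / v x).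
Proof.
move=> fs ek; have mf := measurable_sol fs; split => //.
exists (2 * (`|wronsk f f1 u u1 c| + `|wronsk f f1 v v1 c| * quot c)).
apply: (volterra_bound mD mw mrho quot_gt0 dens_gt0 quot_lec quot_int mf _ ek).
  by move=> x Dx; exact: sol_volterra.
exact: sol_quot_locally_bounded fs.
Qed.

(** [volterra_Hop] gives the equation with some constant term; its product with [cst] is the value 1
    of [W(theta, phi)] read at the endpoint. *)
Lemma theta_Hop (e cst : R) f f1 h h1 : cst != 0 -> `|e| * wintD quot <= 1 / 2 ->
  real_sol a b p q r (lam + e) f f1 -> real_sol a b p q r (lam + e) h h1 ->
  (forall x, D x -> wronsk f f1 h h1 x = 1) ->
  (forall x, D x -> (fun N => \sum_(k < N) cst * Phi k x * e ^+ k) @ \oo --> h x / v x) ->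
  forall x, D x -> f x / v x =
    cst^-1 - wronsk f f1 v v1 c * quot x + e * Hop mu D w rho (fun t => f t / v t) x.
Proof.
move=> cst0 ek fs hs W1 hser x Dx.
have fb := sol_wbounded fs ek.
rewrite (volterra_Hop mD mw mrho quot_gt0 dens_gt0 quot_int fb.1
   (fun y Dy => sol_volterra fs Dy) fb Dx).
have Phi0E y : D y -> Phi 0%N y = quot y by [].
have K0 : 0 <= 2 * `|cst| by rewrite mulr_ge0.
have A1 := @wronskian_at_endpoint _ _ _ mu D w rho c mD mw mrho quot_gt0 dens_gt0 quot_lec
  quot_small quot_int _ _ _ _ e (2 * `|cst|) cst _ _ _ _ _ _ fb (measurable_sol hs) K0
  (fun y Dy => phi_series_Ow mD mw mrho quot_gt0 dens_gt0 quot_lec quot_int Phi0E phiC_Top ek hser Dy)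
  (phi_series_littleo mD mw mrho quot_gt0 dens_gt0 loc_itvc quot_lec quot_small quot_int
     Phi0E phiC_Top ek hser)
  (fun y Dy => wronsk_u_wint fs Dy) (fun y Dy => wronsk_v_wint fs Dy)
  (fun y Dy => wronsk_u_wint hs Dy) (fun y Dy => wronsk_v_wint hs Dy)
  (fun y Dy => quot_wronsk h h1 Dy).
congr (_ - _ + _); apply: (mulIf cst0); rewrite mulVf// A1// => y Dy.
(* Plücker relation: [W(f, h) W(v, u) = W(h, u) W(f, v) - W(f, u) W(h, v)]. *)
have W := wronsk_vu (loc_itv_oitv Dy).
have -> : 1 = wronsk f f1 h h1 y * wronsk v v1 u u1 y by rewrite W W1 // mulr1.
by rewrite /wronsk; ring.
Qed.

Lemma natural_asymptotics (cst : R) (thn : nat -> R -> R) (f f1 h h1 : R -> R -> R) :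
  cst != 0 ->
  (forall e, real_sol a b p q r (lam + e) (f e) (f1 e)) ->
  (forall e, real_sol a b p q r (lam + e) (h e) (h1 e)) ->
  (forall e x, D x -> wronsk (f e) (f1 e) (h e) (h1 e) x = 1) ->
  (forall e x, D x -> (fun N => \sum_(k < N) thn k x * e ^+ k) @ \oo --> f e x) ->
  (forall e x, D x ->
     (fun N => \sum_(k < N) phiN r a u v cst k x * e ^+ k) @ \oo --> h e x) ->
  (forall ell, reg_index a (phiN r a u v cst 0) thn ell ->
     forall n, (ell < n)%N -> lim0 a (thn n) (phiN r a u v cst 0)) ->
  (forall k : nat,
     lim0 a (phiN r a u v cst k.+1) (phiN r a u v cst k) /\ lim0 a (thn k.+1) (thn k)) /\
  (forall ell, reg_index a (phiN r a u v cst 0) thn ell ->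
     forall k : nat,
       lim0 a (phiN r a u v cst k) (thn (ell + k)%N) /\
       lim0 a (thn (ell + k).+1) (phiN r a u v cst k)).
Proof.
move=> cst0 fs hs W1 fser hser nat_o.
set kappa := wintD quot.
have kap0 : 0 <= kappa by apply: wint_w_ge0; [exact: quot_gt0|exact: dens_gt0].
(* Ensures [|e| * kappa <= 1 / 2] for [0 < e <= eps0], as the bounds on [theta / v] and [phi / v]
   require. *)
pose eps0 : R := 1 / (2 * (kappa + 1)).
have eps00 : 0 < eps0 by rewrite divr_gt0//; lra.
have small e : 0 < e -> e <= eps0 -> `|e| * kappa <= 1 / 2.
  move=> e0; rewrite /eps0 ler_pdivlMr; last lra.
  by rewrite (gtr0_norm e0); nra.
have divser (s : nat -> R) (e l x : R) :
    (fun N => \sum_(k < N) s k * e ^+ k) @ \oo --> l ->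
    (fun N => \sum_(k < N) s k / v x * e ^+ k) @ \oo --> l / v x.
  move=> sl; have -> : (fun N : nat => \sum_(k < N) s k / v x * e ^+ k) =
      (fun N => (\sum_(k < N) s k * e ^+ k) * (v x)^-1).
    by apply/funext => N; rewrite mulr_suml; apply: eq_bigr => k _; rewrite mulrAC.
  by apply: cvgM => //; exact: cvg_cst.
have hPhi e x : D x -> (fun N => \sum_(k < N) cst * Phi k x * e ^+ k) @ \oo --> h e x / v x.
  move=> Dx; have -> : (fun N : nat => \sum_(k < N) cst * Phi k x * e ^+ k) =
      (fun N => \sum_(k < N) phiN r a u v cst k x / v x * e ^+ k).
    by apply/funext => N; apply: eq_bigr => k _; rewrite /phiN mulrA.
  exact: (divser (fun n => phiN r a u v cst n x) e _ x (hser e x Dx)).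
have [bb [Th0E ThSE]] := @coefficient_recursion _ _ _ mu D w rho c mD mw mrho quot_gt0
  dens_gt0 loc_itvc quot_lec quot_int cst^-1 eps0 (fun e t => f e t / v t)
  (fun e => wronsk (f e) (f1 e) v v1 c) (fun n t => thn n t / v t) eps00
  (fun e p1 p2 => sol_wbounded (fs e) (small e p1 p2))
  (fun e x p1 p2 Dx => theta_Hop cst0 (small e p1 p2) (fs e) (hs e) (W1 e) (hPhi e) Dx)
  (fun e x _ _ Dx => divser (fun n => thn n x) e _ x (fser e x Dx)).
have cstV0 : cst^-1 != 0 by rewrite invr_eq0.
have phi_l n g : lim0 a (phiN r a u v cst n) g <->
    wlittleo (D : set cT) w (Phi n) (fun x => g x / v x).
  exact: (iff_trans (lim0_scale_l _ _ _ cst0) (lim0E _ _)).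
have phi_r n g : lim0 a g (phiN r a u v cst n) <->
    wlittleo (D : set cT) w (fun x => g x / v x) (Phi n).
  exact: (iff_trans (lim0_scale_r _ _ _ cst0) (lim0E _ _)).
have regE ell : (forall n, (n <= ell)%N -> wlittleo (D : set cT) w w (fun x => thn n x / v x)) ->
    ~ wlittleo (D : set cT) w w (fun x => thn ell.+1 x / v x) ->
    reg_index a (phiN r a u v cst 0) thn ell.
  by move=> h2 h3; split=> [n nl|/phi_l//]; apply/phi_l; exact: h2.
have [chain1 chain2] := natural_chain mD mw mrho quot_gt0 dens_gt0 loc_itvc quot_lec
  quot_small quot_mass quot_int cstV0 Th0E ThSE (fun x _ => erefl (Phi 0%N x)) phiC_Top
  (fun ell h2 h3 n nl => (phi_r 0%N _).1 (nat_o ell (regE ell h2 h3) n nl)).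
split=> [k|ell [h2 h3] k].
  have [c1 c2] := chain1 k; split; last exact/lim0E.
  by apply: (lim0_scale_l _ _ _ cst0).2; apply: (lim0_scale_r _ _ _ cst0).2; apply/lim0E.
have [||c1 c2] := chain2 ell _ _ k.
- by move=> n nl; apply/(phi_l 0%N); exact: h2.
- by move=> /(phi_l 0%N); exact: h3.
- by split; [apply/phi_l|apply/phi_r].
Qed.

End Normalized.

Unset Implicit Arguments.

Theorem mainTheorem15 (R : realType) (a b : \bar R) (p q r : R -> R)
  (lam : R) (u u1 v v1 : R -> R) (cst : R)
  (phi phi1 theta theta1 : R[i] -> R -> R[i]) (thn : nat -> R -> R) :
  (* standing setting *)
  (a < b)%E ->
  {ae (@completed_lebesgue_measure R), forall x, oitv a b x -> 0 < r x} ->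
  loc_integrable a b r ->
  {ae (@completed_lebesgue_measure R), forall x, oitv a b x -> 0 < p x} ->
  loc_integrable a b (fun x => (p x)^-1) ->
  loc_integrable a b q ->
  (* hypothesis (H_a) and construction (C) *)
  nonosc p q r a b lam ->
  principal p q r a b lam u u1 ->
  nonprincipal p q r a b lam u v v1 ->
  (forall x, oitv a b x -> wronsk v v1 u u1 x = 1) ->
  (exists2 c, oitv a b c &
     (\int[@completed_lebesgue_measure R]_(x in [set x | (a < x%:E)%E /\ (x <= c)%R])
        (`|u x * v x * r x|%R)%:E < +oo)%E) ->
  (* phi = cst * (function of Construction (C)), with its quasi-derivative phi1 *)
  cst != 0 ->
  (forall z x, oitv a b x ->
     cseries_to (fun n => (phiN r a u v cst n x)%:C * (z - lam%:C) ^+ n) (phi z x)) ->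
  (forall z, is_sol p q r a b z (phi z) (phi1 z)) ->
  (* theta: entire in z with expansion coefficients thn about lam, real for real z,
     solution with quasi-derivative theta1, and W(theta, phi) = 1 *)
  (forall z x, oitv a b x ->
     cseries_to (fun n => (thn n x)%:C * (z - lam%:C) ^+ n) (theta z x)) ->
  (forall (t : R) x, oitv a b x -> complex.Im (theta t%:C x) = 0) ->
  (forall z, is_sol p q r a b z (theta z) (theta1 z)) ->
  (forall z x, oitv a b x -> wronsk (theta z) (theta1 z) (phi z) (phi1 z) x = 1) ->
  (* natural normalization *)
  (forall ell, reg_index a (phiN r a u v cst 0) thn ell ->
     forall n, (ell < n)%N -> lim0 a (thn n) (phiN r a u v cst 0)) ->
  (* conclusion *)
  (forall k : nat,
     lim0 a (phiN r a u v cst k.+1) (phiN r a u v cst k) /\ lim0 a (thn k.+1) (thn k)) /\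
  (forall ell, reg_index a (phiN r a u v cst 0) thn ell ->
     forall k : nat,
       lim0 a (phiN r a u v cst k) (thn (ell + k)%N) /\
       lim0 a (thn (ell + k).+1) (phiN r a u v cst k)).
Proof.
move=> _ r_gt0 r_int p_gt0 p_int _ _ [us _ up] [vs vi] W1 [c0 oc0 Hint] cst0
  phis phisol thetas thetaIm thetasol Wth nat_o.
have FF := at_a_proper_filter a.
have u_sol : real_sol a b p q r lam u u1 := is_sol_Re r_gt0 us.
have v_sol : real_sol a b p q r lam v v1 := is_sol_Re r_gt0 vs.
have [vn0 uv0] := up v v1 vs vi.
(* [c] is moved from the point [c0] of (H_a) towards [a], so that [v] has no zero on [(a, c]]. *)
have [c [ac cc0] v_neq0'] := (near_at_aP _ oc0.1).1 vn0.
have oitv_le x y : oitv a b y -> (a < x%:E)%E -> x <= y -> oitv a b x.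
  by move=> [_ yb] ax xy; split => //; apply: le_lt_trans yb; rewrite lee_fin.
have oc := oitv_le _ _ oc0 ac cc0.
have v_neq0 x : loc_itv a c x -> v x != 0 by move=> [ax xc]; exact: v_neq0'.
have quot_cvg0 (e : R) : 0 < e ->
    exists2 d, loc_itv a c d & forall x, loc_itv a c x -> x <= d -> `|u x / v x| < e.
  move=> e0; have /cvgr0Pnorm_lt /(_ _ e0) /(near_at_aP _ ac)[d Dd Hd] := uv0.
  by exists d => // x [ax _] xd; exact: Hd.
have mr : measurable_fun
    (loc_itv a c0 : set (caratheodory_type (wlength (R:=R) idfun)^*%mu)) r.
  apply: measurable_fun_loc_itv => x [ax xc]; apply/measurable_EFinP.
  apply: (measurable_int (@completed_lebesgue_measure R)); apply: r_int => //.
  exact: oitv_le oc0 ax xc.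
have mAC f : ACloc a b f -> measurable_fun
    (loc_itv a c0 : set (caratheodory_type (wlength (R:=R) idfun)^*%mu)) f.
  move=> ACf; apply: measurable_fun_loc_itv => x [ax xc].
  by apply: abs_cont_on_measurable; apply: ACf => //; exact: oitv_le oc0 ax xc.
have [ACu _ _ _] := u_sol; have [ACv _ _ _] := v_sol.
have uvr_int : (\int[@completed_lebesgue_measure R]_(x in loc_itv a c)
    (`|u x * v x * r x|)%:E < +oo)%E.
  apply: le_lt_trans Hint; apply: ge0_subset_integral.
  - exact: measurable_loc_itv.
  - exact: measurable_loc_itv.
  - have mn := measurable_funM (measurable_funM (mAC _ ACu) (mAC _ ACv)) mr.
    by apply/measurable_EFinP; exact: (measurableT_comp (@normr_measurable R setT) mn).
  - by move=> x _; rewrite lee_fin.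
  - by move=> x [ax xc]; split => //; exact: le_trans xc cc0.
have inab x : loc_itv a c x -> oitv a b x.
  by move=> [ax xc]; exact: oitv_le oc ax xc.
apply: (natural_asymptotics r_gt0 r_int p_gt0 p_int u_sol v_sol W1 oc v_neq0 quot_cvg0 uvr_int
  (f := fun e => cRe (theta (lam + e)%:C)) (f1 := fun e => cRe (theta1 (lam + e)%:C))
  (h := fun e => cRe (phi (lam + e)%:C)) (h1 := fun e => cRe (phi1 (lam + e)%:C))) => //.
- by move=> e; apply: (is_sol_Re r_gt0 (thetasol _)).
- by move=> e; apply: (is_sol_Re r_gt0 (phisol _)).
(* The quasi-derivatives are not known to be real, but in the real part of the Wronskian their
   imaginary parts are multiplied only by those of theta and phi, which are 0. *)
- move=> e x Dx; have ox := inab _ Dx.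
  have := congr1 (@complex.Re R) (Wth (lam + e)%:C x ox).
  have := thetaIm (lam + e) x ox.
  have [_] := cseries_to_real (phis (lam + e)%:C x ox).
  rewrite /wronsk /cRe /=.
  case: (theta _ x) => tr ti; case: (theta1 _ x) => t1r t1i.
  case: (phi _ x) => pr_ pi_; case: (phi1 _ x) => p1r p1i /= -> ->.
  by rewrite !(mul0r, mulr0, subr0).
- by move=> e x Dx; have [] := cseries_to_real (thetas (lam + e)%:C x (inab _ Dx)).
- by move=> e x Dx; have [] := cseries_to_real (phis (lam + e)%:C x (inab _ Dx)).
Qed.
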